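(* Let $X$ be an infinite-dimensional separable Banach space which is determined by its finite dimensional subspaces. Then $X$ contains an isometric copy of $c_0$ or of $\ell_p$ for some $1\le p<\infty$. Moreover, $X$ contains an isometric copy of every Banach space which has a (Schauder) basis and is finitely representable in $X$.
   Context: Banach spaces are real. A Banach space $X$ is finitely representable (f.r.) in a Banach space $Y$ if for each finite-dimensional subspace $E$ of $X$ and each $\lambda>1$ there is an isomorphism $T$ of $E$ into $Y$ with $\lambda^{-1}\|x\|\le\|T(x)\|\le\lambda\|x\|$ for all $x\in E$. A separable Banach space $X$ is determined by its finite dimensional subspaces (finitely determined) if every separable Banach space $Y$ such that $X$ is f.r. in $Y$ and $Y$ is f.r. in $X$ is isometric to $X$. An isometric copy of $E$ in $X$ is a closed linear subspace of $X$ linearly isometric to $E$. *)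

(* Defs.v *)
From HB Require Import structures.
From mathcomp Require Import all_boot all_order all_algebra.
From mathcomp Require Import all_classical all_reals all_analysis.
Set Implicit Arguments.
Unset Strict Implicit.
Unset Printing Implicit Defensive.
Import Order.TTheory GRing.Theory Num.Theory.
Import numFieldNormedType.Exports.

Local Open Scope classical_set_scope.
Local Open Scope ring_scope.

Section subspaces.
Context {R : realType}.
Implicit Types X Y : normedModType R.

Definition linear_subspace X (E : set X) :=
  E 0 /\ forall (a : R) (x y : X), E x -> E y -> E (a *: x + y).

Definition linear_span X n (v : 'I_n -> X) : set X :=
  [set x | exists a : 'I_n -> R, x = \sum_(i < n) a i *: v i].

Definition fin_dim_subspace X (E : set X) :=
  exists n (v : 'I_n -> X), E = linear_span v.

Definition finite_dimensional X := fin_dim_subspace [set: X].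

Definition infinite_dimensional X := ~ finite_dimensional X.

Definition separable_space X := exists2 D : set X, countable D & dense D.

(* The values of T outside E are irrelevant. *)
Definition linear_on X Y (E : set X) (T : X -> Y) :=
  forall (a : R) (x y : X), E x -> E y -> T (a *: x + y) = a *: T x + T y.

Definition fin_representable X Y :=
  forall E : set X, fin_dim_subspace E -> forall lambda : R, 1 < lambda ->
  exists2 T : X -> Y, linear_on E T &
    forall x, E x -> lambda^-1 * `|x| <= `|T x| <= lambda * `|x|.

Definition linear_isometry X Y (T : {linear X -> Y}) :=
  forall x, `|T x| = `|x|.

Definition isometric X Y :=
  exists2 T : {linear X -> Y}, linear_isometry T & range T = [set: Y].

Definition contains_isometric_copy X (E : normedModType R) :=
  exists F : set X, [/\ linear_subspace F, closed F &
    exists2 T : {linear E -> X}, linear_isometry T & range T = F].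

Definition schauder_basis X (e : nat -> X) :=
  forall x : X, exists! a : nat -> R,
    series (fun k => a k *: e k) @ \oo --> x.

(* A Schauder basis indexed by nat forces infinite dimension; the finite bases
   of finite-dimensional spaces are admitted as well. *)
Definition has_basis X :=
  finite_dimensional X \/ exists e : nat -> X, schauder_basis e.

End subspaces.

Definition finitely_determined (R : realType) (X : completeNormedModType R) :=
  forall Y : completeNormedModType R, separable_space Y ->
    fin_representable X Y -> fin_representable Y X -> isometric Y X.

Section c0.
Context {R : realType}.

Definition c0_pred : {pred nat -> R} := mem [set u : nat -> R | u @ \oo --> 0].

Record c0 := C0 { c0_val :> nat -> R ; _ : c0_val \in c0_pred }.

HB.instance Definition _ := [isSub for c0_val].
HB.instance Definition _ := [Choice of c0 by <:].

Lemma c0_submod_closed : submod_closed c0_pred.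
Proof.
split; first by rewrite inE; exact: cvg_cst.
move=> a u v /[!inE] u0 v0.
rewrite -[0](addr0 0) -{1}[0](scaler0 _ a).
by apply: cvgD v0; apply: cvgZr.
Qed.

HB.instance Definition _ := GRing.isSubmodClosed.Build _ _ c0_pred
  c0_submod_closed.
HB.instance Definition _ := [SubChoice_isSubLmodule of c0 by <:].

Definition c0_norm (u : c0) : R := sup (range (fun n => `|u n|)).

Lemma c0_has_sup (u : c0) : has_sup (range (fun n => `|u n|)).
Proof.
split; first by exists `|u 0%N|; exists 0%N.
have /set_mem u0 : (u : nat -> R) \in c0_pred := valP u.
have [M [_ Mu]] : bounded_fun (u : nat -> R).
  by apply: cvg_seq_bounded; apply/cvg_ex; exists 0.
by exists (M + 1) => _ [n _ <-]; apply: Mu => //; rewrite ltrDl.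
Qed.

Lemma c0_norm_ub (u : c0) n : `|u n| <= c0_norm u.
Proof. by apply: sup_upper_bound; [exact: c0_has_sup|exists n]. Qed.

Lemma c0_norm_le (u : c0) M : (forall n, `|u n| <= M) -> c0_norm u <= M.
Proof.
by move=> uM; apply: ge_sup => [|_ [n _ <-]//]; case: (c0_has_sup u).
Qed.

Lemma c0_normD (u v : c0) : c0_norm (u + v) <= c0_norm u + c0_norm v.
Proof.
apply: c0_norm_le => n.
by rewrite (le_trans (ler_normD (u n) (v n)))// lerD// c0_norm_ub.
Qed.

Lemma c0_normZ (a : R) (u : c0) : c0_norm (a *: u) = `|a| * c0_norm u.
Proof.
have le b (v : c0) : c0_norm (b *: v) <= `|b| * c0_norm v.
  apply: c0_norm_le => n.
  have -> : (b *: v) n = b * v n by [].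
  by rewrite normrM ler_wpM2l// c0_norm_ub.
apply/eqP; rewrite eq_le le/=.
have [->|a0] := eqVneq a 0.
  rewrite normr0 mul0r; apply: le_trans (c0_norm_ub _ 0%N); exact: normr_ge0.
have := le a^-1 (a *: u).
rewrite scalerA mulVf// scale1r normfV => h.
by rewrite -ler_pdivlMl ?normr_gt0.
Qed.

Lemma c0_norm0_eq0 (u : c0) : c0_norm u = 0 -> u = 0.
Proof.
move=> u0; apply/val_inj/funext => n /=.
by apply/normr0_eq0/eqP; rewrite eq_le normr_ge0 -u0 c0_norm_ub.
Qed.

HB.instance Definition _ := Lmodule_isNormed.Build R c0
  c0_normD c0_normZ c0_norm0_eq0.

End c0.
Arguments c0 : clear implicits.

Lemma counting_eq0 (R : realType) (A : set nat) :
  counting A = 0 :> \bar R -> A = set0.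
Proof.
rewrite /counting; case: asboolP => // finA /eqP.
rewrite eqe pnatr_eq0 => /eqP/finmap.cardfs0_eq A0.
by rewrite -[A]fset_setK// A0 set_fset0.
Qed.

Section ell.
Context {R : realType} (p : R) (p1 : 1 <= p).

Lemma ell_ge1 : (1 <= p%:E)%E. Proof. by rewrite lee_fin. Qed.

(* All functions on nat are measurable and equality almost everywhere for the
   counting measure is equality, so no quotient is needed; see ell_sub and
   ell_normE below. *)
Definition ell : Type :=
  LfunType (counting : {measure set nat -> \bar R}) ell_ge1.

HB.instance Definition _ :=
  GRing.Lmodule.copy ell (LfunType (@counting nat R) ell_ge1).

Definition ell_norm (u : ell) : R := fine 'N[counting]_p%:E[EFin \o u].

Lemma ell_normD (u v : ell) : ell_norm (u + v) <= ell_norm u + ell_norm v.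
Proof. exact: ler_LnormD. Qed.

Lemma ell_normZ (a : R) (u : ell) : ell_norm (a *: u) = `|a| * ell_norm u.
Proof.
have L := @LnormZ _ _ _ (@counting nat R) _ ell_ge1.
apply/EFin_inj; rewrite EFinM.
have F := @finite_norm_fine _ _ _ (@counting nat R) _ ell_ge1.
by rewrite /ell_norm !F L.
Qed.

Lemma ell_norm0_eq0 (u : ell) : ell_norm u = 0 -> u = 0.
Proof.
move=> /fine_Lnormr_eq0 [A [_ /counting_eq0 A0 uA]]; apply/LfuneqP => n.
apply: contrapT => un0; have : A n by apply: uA => /= un; exact: un0 (un I).
by rewrite A0.
Qed.

HB.instance Definition _ := Lmodule_isNormed.Build R ell
  ell_normD ell_normZ ell_norm0_eq0.

Lemma ell_normE (u : ell) :
  (`|u|%:E = (\sum_(0 <= k <oo) (`|u k| `^ p)%:E) `^ p^-1)%E.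
Proof.
have -> : `|u| = ell_norm u by [].
by rewrite /ell_norm finite_norm_fine Lnorm_counting// (lt_le_trans ltr01).
Qed.

Lemma ell_sub (u : nat -> R) :
  (\sum_(0 <= k <oo) (`|u k| `^ p)%:E < +oo)%E ->
  exists v : ell, (v : nat -> R) = u.
Proof.
move=> u_fin.
have uL : (u : nat -> R) \in Lfun (@counting nat R) p%:E.
  apply/andP; split; rewrite inE//=.
  by rewrite /finite_norm Lnorm_counting ?poweR_lty// (lt_le_trans ltr01).
by exists (Lfun_Sub ell_ge1 uL).
Qed.

End ell.

(* Main.v *)
(* If E is separable and finitely representable in X, then E embeds
   isometrically in an ultrapower of X.  The closed span Y of X and E in the
   ultrapower is separable and X and Y are finitely representable in each other,
   so Y is isometric to X and X contains E.  A space with a basis is separable,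
   which gives the second assertion.

   For the first assertion it remains to see that c_0 or some l_p is finitely
   representable in X, which is Krivine's theorem; the argument is Lemberg's.  The
   seminorms on finitely supported sequences that can be approximated on finite
   sets by sequences of vectors of X are stable under limits and under passing to
   blocks.  An iterated limit of a separated sequence gives one which is invariant
   under spreading; differences and alternating blocks make it unconditional.
   Repeating a vector n times defines commuting positive operators T_n on the
   finitely supported functions on the rationals of [0, 1); in the limit, blocks
   along common approximate eigenvectors of the T_n give a norm in which n
   consecutive letters a can be replaced by the single letter phi(n) a.  Then phi
   is multiplicative and monotone, hence phi(n) = n^(1/p), and the norm is that of
   l_p, or of c_0 if phi is constant. *)
Require Import Defs.
From HB Require Import structures.
From mathcomp Require Import all_boot all_order all_algebra.
From mathcomp Require Import all_classical all_reals all_analysis.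
From mathcomp Require Import zify ring lra.
Set Implicit Arguments.
Unset Strict Implicit.
Unset Printing Implicit Defensive.
Import Order.TTheory GRing.Theory Num.Theory.
Import numFieldNormedType.Exports.

Local Open Scope classical_set_scope.
Local Open Scope ring_scope.

(** * Limits along ultrafilters *)

(** Until c_0 or l_p is reached, only norms on words are handled. Blocks and limits taken inside X
    would require new vectors at every stage, whereas norms on words are real functions, and an
    ultralimit exists for all words at once, without diagonal or Ramsey arguments. Unconditionality
    has to precede the eigenvectors: the eigenvector y of a dilation T comes with a pointwise bound
    on T y - r y, and only a monotone norm turns a pointwise bound into a norm estimate. A growth
    rate, defined as a supremum, stands in for the spectrum, so that no complexification occurs. The
    ultrapower itself is never formed: the norm of x + T y in it is a seminorm on X x E, an
    ultralimit over finite subsets of E and precisions, and Y is the completion for this seminorm.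
    That completion is realised by functions on the dual ball; the Hahn-Banach theorem is what makes
    the embedding into it isometric. *)

Section ultralimit.
Context {R : realType} {I : Type} (U : set_system I) {UU : UltraFilter U}.
Implicit Types u v w : I -> R.

Definition ulim u : R := lim (u @ U).

Lemma ulimP u C : (\forall i \near U, `|u i| <= C) -> u @ U --> ulim u.
Proof.
move=> uC; rewrite /ulim.
have uU : UltraFilter (fmap u U).
  apply: (@Build_UltraFilter _ (fmap u U)) => G PG sG.
  rewrite predeqE => A; split=> [GA|/sG//].
  have [//|UnA] := in_ultra_setVsetC (u @^-1` A) UU.
  have : G (A `&` ~` A) by apply: filterI => //; exact: sG.
  by move=> /filter_ex[? []].
have := @segment_compact R (- C) C; rewrite compact_ultra => /(_ _ uU).
case=> [|p [_ up]].
  by apply: filterS uC => i; rewrite /= in_itv /= -ler_norml.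
by apply/cvg_ex; exists p.
Qed.

Lemma ulim_cst (a : R) : ulim (fun=> a) = a.
Proof. by apply/cvg_lim => //; exact: cvg_cst. Qed.

Lemma ulim_near_eq u v : (\forall i \near U, u i = v i) -> ulim u = ulim v.
Proof.
move=> uv; congr (lim _).
rewrite eqEsubset; split=> A.
  by apply: filterS2 uv => i /= ->.
by apply: filterS2 uv => i /= ->.
Qed.

Lemma ulim_le u v Cu Cv : (\forall i \near U, `|u i| <= Cu) ->
  (\forall i \near U, `|v i| <= Cv) -> (\forall i \near U, u i <= v i) ->
  ulim u <= ulim v.
Proof.
move=> /ulimP uc /ulimP vc uv; rewrite -subr_ge0.
apply: (cvgr_to_ge (cvgB vc uc)).
by apply: filterS uv => i; rewrite subr_ge0.
Qed.

Lemma ulim_leD u v w Cu Cv Cw : (\forall i \near U, `|u i| <= Cu) ->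
  (\forall i \near U, `|v i| <= Cv) -> (\forall i \near U, `|w i| <= Cw) ->
  (\forall i \near U, u i <= v i + w i) -> ulim u <= ulim v + ulim w.
Proof.
move=> /ulimP uc /ulimP vc /ulimP wc uvw; rewrite -subr_ge0.
have H : (fun i => v i + w i - u i) @ U --> ulim v + ulim w - ulim u.
  by apply: cvgB => //; exact: cvgD.
by apply: (cvgr_to_ge H); apply: filterS uvw => i; rewrite subr_ge0.
Qed.

Lemma ulim_ge u C a : (\forall i \near U, `|u i| <= C) ->
  (\forall i \near U, a <= u i) -> a <= ulim u.
Proof. by move=> /ulimP uc; exact: cvgr_to_ge uc. Qed.

Lemma ulim_bounded u C : (\forall i \near U, `|u i| <= C) -> `|ulim u| <= C.
Proof.
move=> uC; have uc := ulimP uC; apply: (cvgr_to_le (cvg_norm uc)).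
by apply: filterS uC.
Qed.

Lemma ulimZ c u C : (\forall i \near U, `|u i| <= C) ->
  ulim (fun i => c * u i) = c * ulim u.
Proof. by move=> /ulimP uc; apply/cvg_lim => //; exact: cvgMl_tmp. Qed.

Lemma ulim_near u C (e : R) : 0 < e -> (\forall i \near U, `|u i| <= C) ->
  \forall i \near U, `|u i - ulim u| <= e.
Proof.
move=> e0 /ulimP /cvgrPdist_le /(_ _ e0).
by apply: filterS => i; rewrite distrC.
Qed.

Lemma ulim_eq_cvg u a : u @ U --> a -> ulim u = a.
Proof. by move=> ua; apply/cvg_lim. Qed.

End ultralimit.

Lemma free_ultrafilter : exists U : set_system nat,
  UltraFilter U /\ \oo `<=` U.
Proof. exact: ultraFilterLemma. Qed.

(** * Spreading norms and their representability *)

Section words.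
Context {R : realType}.
Implicit Types (M : seq R -> R) (u v w : seq R) (a c : R).

Definition wadd u v : seq R := [seq p.1 + p.2 | p <- zip u v].
Definition wscale c u : seq R := [seq c * b | b <- u].
(** Passing to blocks: with letters as coefficients along a sequence, this is the combination with
    coefficients [w] of consecutive disjoint copies of the block [u]. *)
Definition blowup u w : seq R := flatten [seq wscale a u | a <- w].

(* A spreading seminorm on finitely supported sequences: as zero entries may be
   inserted and removed at will, only the word of nonzero entries matters. *)
Record word_norm M : Prop := WordNorm {
  wnD : forall u v, size u = size v -> M (wadd u v) <= M u + M v ;
  wnZ : forall c u, M (wscale c u) = `|c| * M u ;
  wn0 : forall u v, M (u ++ 0 :: v) = M (u ++ v) }.

(** [all2] fails on words of different lengths. Since absolute values are compared, this contains
    both invariance under changes of sign and the lattice property. *)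
Definition word_monotone M := forall u v,
  all2 (fun a b => `|a| <= `|b|) u v -> M u <= M v.

Lemma wadd_cons a b u v : wadd (a :: u) (b :: v) = (a + b) :: wadd u v.
Proof. by []. Qed.

Lemma wscale_cons c a u : wscale c (a :: u) = c * a :: wscale c u.
Proof. by []. Qed.

Lemma size_wadd u v : size u = size v -> size (wadd u v) = size u.
Proof. by move=> uv; rewrite size_map size1_zip // uv. Qed.

Lemma size_wscale c u : size (wscale c u) = size u.
Proof. exact: size_map. Qed.

Lemma wadd_cat u u' v v' : size u = size v ->
  wadd (u ++ u') (v ++ v') = wadd u v ++ wadd u' v'.
Proof. by move=> uv; rewrite /wadd zip_cat // map_cat. Qed.

Lemma wscale_cat c u v : wscale c (u ++ v) = wscale c u ++ wscale c v.
Proof. exact: map_cat. Qed.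

Lemma wscale_nseq c n a : wscale c (nseq n a) = nseq n (c * a).
Proof. exact: map_nseq. Qed.

Lemma wscaleA a c u : wscale a (wscale c u) = wscale (a * c) u.
Proof. by rewrite /wscale -map_comp; apply: eq_map => b /=; rewrite mulrA. Qed.

Lemma wscale1 u : wscale 1 u = u.
Proof. by rewrite /wscale (eq_map (@mul1r R)) map_id. Qed.

Lemma wscale0 u : wscale 0 u = nseq (size u) 0.
Proof. by elim: u => //= a u ->; rewrite mul0r. Qed.

Lemma waddw0 u : wadd u (nseq (size u) 0) = u.
Proof. by elim: u => // a u IH; rewrite wadd_cons addr0 IH. Qed.

Lemma wadd0w u : wadd (nseq (size u) 0) u = u.
Proof. by elim: u => // a u IH; rewrite wadd_cons add0r IH. Qed.

Lemma waddC u v : wadd u v = wadd v u.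
Proof.
by elim: u v => [|a u IH] [|b v] //; rewrite !wadd_cons IH addrC.
Qed.

Lemma waddN u : wadd u (wscale (-1) u) = nseq (size u) 0.
Proof.
by elim: u => // a u IH; rewrite wscale_cons wadd_cons mulN1r subrr IH.
Qed.

Lemma waddK u v : size u = size v -> wadd (wadd u (wscale (-1) v)) v = u.
Proof.
elim: u v => [|a u IH] [|b v] // [uv].
by rewrite wscale_cons !wadd_cons mulN1r subrK IH.
Qed.

Lemma wadd_map (I : Type) (s : seq I) (f g : I -> R) :
  wadd (map f s) (map g s) = [seq f i + g i | i <- s].
Proof. by elim: s => // i s IH; rewrite !map_cons wadd_cons IH. Qed.

Lemma wscale_wadd c u v : wscale c (wadd u v) = wadd (wscale c u) (wscale c v).
Proof.
elim: u v => [|a u IH] [|b v] //.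
by rewrite !(wscale_cons, wadd_cons) mulrDr IH.
Qed.

Lemma wadd_wscale a b u : wadd (wscale a u) (wscale b u) = wscale (a + b) u.
Proof. by rewrite /wscale wadd_map; apply: eq_map => c; rewrite mulrDl. Qed.

Lemma blowup_cat u w w' : blowup u (w ++ w') = blowup u w ++ blowup u w'.
Proof. by rewrite /blowup map_cat flatten_cat. Qed.

Lemma blowup_cons u a w : blowup u (a :: w) = wscale a u ++ blowup u w.
Proof. by []. Qed.

Lemma size_blowup u w : size (blowup u w) = (size w * size u)%N.
Proof.
elim: w => // a w IH.
by rewrite blowup_cons size_cat size_wscale IH.
Qed.

Lemma blowup_wadd u w w' : size w = size w' ->
  blowup u (wadd w w') = wadd (blowup u w) (blowup u w').
Proof.
elim: w w' => [|a w IH] [|b w'] // [ww'].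
by rewrite wadd_cons !blowup_cons IH // -wadd_wscale wadd_cat ?size_wscale.
Qed.

Lemma blowup_wscale u c w : blowup u (wscale c w) = wscale c (blowup u w).
Proof.
elim: w => // a w IH.
by rewrite [wscale c (a :: w)]/= !blowup_cons wscale_cat IH wscaleA.
Qed.

Section word_norm_theory.
Variables (M : seq R -> R) (Mn : word_norm M).

Lemma wn_nil : M [::] = 0.
Proof.
have := wnZ Mn 0 [::]; rewrite normr0 mul0r => h.
exact: h.
Qed.

Lemma wn_nseq0 u n v : M (u ++ nseq n 0 ++ v) = M (u ++ v).
Proof. by elim: n => //= n <-; rewrite (wn0 Mn). Qed.

Lemma wn_zeros n : M (nseq n 0) = 0.
Proof. by have := wn_nseq0 [::] n [::]; rewrite /= cats0 => ->; exact: wn_nil. Qed.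

Lemma wnN u : M (wscale (-1) u) = M u.
Proof. by rewrite (wnZ Mn) normrN normr1 mul1r. Qed.

Lemma wn_ge0 u : 0 <= M u.
Proof.
have := wnD Mn (esym (size_wscale (-1) u)).
by rewrite waddN wn_zeros wnN; lra.
Qed.

Lemma wn_le_sub u v : size u = size v ->
  M u <= M (wadd u (wscale (-1) v)) + M v.
Proof.
move=> uv; rewrite -{1}(waddK uv); apply: (wnD Mn).
by rewrite size_wadd ?size_wscale.
Qed.

Lemma wn_dist u v : size u = size v ->
  `|M u - M v| <= M (wadd u (wscale (-1) v)).
Proof.
move=> uv; rewrite ler_norml lerBlDr wn_le_sub // andbT.
have := wn_le_sub (esym uv); rewrite -(wnN (wadd v _)) wscale_wadd wscaleA.
rewrite mulrNN mulr1 wscale1.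
by rewrite waddC; lra.
Qed.

Lemma wn_mid u p v : M (nseq (size u) 0 ++ p ++ nseq (size v) 0) = M p.
Proof.
have := wn_nseq0 [::] (size u) (p ++ nseq (size v) 0); rewrite /= => ->.
by have := wn_nseq0 p (size v) [::]; rewrite !cats0.
Qed.

Lemma wn_dist_mid u v p q : size p = size q ->
  `|M (u ++ p ++ v) - M (u ++ q ++ v)| <= M (wadd p (wscale (-1) q)).
Proof.
move=> pq; apply: le_trans (wn_dist _) _; first by rewrite !size_cat pq.
by rewrite !wscale_cat !wadd_cat ?size_wscale // !waddN wn_mid.
Qed.

Lemma wn1 a : M [:: a] = `|a| * M [:: 1].
Proof. by rewrite -(wnZ Mn) /= mulr1. Qed.

Lemma wn_cat u v : M (u ++ v) <= M u + M v.
Proof.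
have -> : u ++ v = wadd (u ++ nseq (size v) 0) (nseq (size u) 0 ++ v).
  by rewrite wadd_cat ?size_nseq // waddw0 wadd0w.
apply: le_trans (wnD Mn _) _; first by rewrite !size_cat !size_nseq.
have := wn_nseq0 u (size v) [::]; rewrite !cats0 => ->.
by have := wn_nseq0 [::] (size u) v; rewrite /= => ->.
Qed.

(** Norms normalised on the one-letter word are thereby bounded on each fixed word, uniformly in the
    norm, which is what ultralimits of families of them require. *)
Lemma wn_bound w : M w <= (\sum_(a <- w) `|a|) * M [:: 1].
Proof.
elim: w => [|a w IH]; first by rewrite big_nil mul0r wn_nil.
rewrite big_cons mulrDl -wn1; apply: le_trans (wn_cat [:: a] w) _.
by rewrite lerD2l.
Qed.

Lemma word_norm_blowup u c : 0 <= c ->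
  word_norm (fun w => c * M (blowup u w)).
Proof.
move=> c0; split=> [w w' ww'|a w|w w'].
- rewrite -mulrDr ler_wpM2l // blowup_wadd //.
  by apply: (wnD Mn); rewrite !size_blowup ww'.
- by rewrite blowup_wscale (wnZ Mn) mulrCA.
- by rewrite !blowup_cat blowup_cons wscale0 wn_nseq0.
Qed.

End word_norm_theory.

Section word_norm_limit.
Context {I : Type} (U : set_system I) {UU : UltraFilter U}.
Variables (M : I -> seq R -> R) (C : R).
Hypotheses (Mn : forall i, word_norm (M i)) (MC : forall i, M i [:: 1] <= C).

Lemma word_limit_bounded w :
  \forall i \near U, `|M i w| <= (\sum_(a <- w) `|a|) * C.
Proof.
near=> i; rewrite ger0_norm ?(wn_ge0 (Mn i)) //.
apply: le_trans (wn_bound (Mn i) w) _.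
by rewrite ler_wpM2l // sumr_ge0.
Unshelve. all: by end_near. Qed.

Definition word_limit w := ulim U (fun i => M i w).

Lemma word_limitP w (e : R) : 0 < e ->
  \forall i \near U, `|M i w - word_limit w| <= e.
Proof. by move=> e0; exact: ulim_near e0 (word_limit_bounded w). Qed.

Lemma cvg_word_limit w : (fun i => M i w) @ U --> word_limit w.
Proof. exact: ulimP (word_limit_bounded w). Qed.

Lemma word_limit_norm : word_norm word_limit.
Proof.
split=> [u v uv|c u|u v].
- apply: ulim_leD (word_limit_bounded _) (word_limit_bounded _)
    (word_limit_bounded _) _.
  by near=> i; exact: (wnD (Mn i)).
- rewrite /word_limit -(ulimZ _ (word_limit_bounded u)).
  by congr ulim; apply/funext => i; rewrite (wnZ (Mn i)).
- by congr ulim; apply/funext => i; exact: (wn0 (Mn i)).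
Unshelve. all: by end_near. Qed.

Lemma word_limit_le u v : (\forall i \near U, M i u <= M i v) ->
  word_limit u <= word_limit v.
Proof. exact: ulim_le (word_limit_bounded u) (word_limit_bounded v). Qed.

Lemma word_limit_ub w c : (\forall i \near U, M i w <= c) -> word_limit w <= c.
Proof. exact: cvgr_to_le (@cvg_word_limit w). Qed.

End word_norm_limit.

End words.

(** * Approximation of norms on words by vectors of a normed space *)

Section representable_words.
Context {R : realType} (X : normedModType R).
Implicit Types (x : nat -> X) (M : seq R -> R) (u w : seq R).

Definition comb x w : X := \sum_(i < size w) w`_i *: x i.

(** The vectors depend on the finite set and on the error; no sequence in X need realise [M]. For a
    word norm the common length costs nothing, since trailing zeros change neither side. *)
Definition word_fr M := forall k (A : seq (seq R)) (e : R), 0 < e ->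
  (forall w, w \in A -> size w = k) ->
  exists x, forall w, w \in A -> `| `|comb x w| - M w | <= e.

Lemma comb_nil x : comb x [::] = 0.
Proof. by rewrite /comb big_ord0. Qed.

Lemma comb_cons x a w : comb x (a :: w) = a *: x 0%N + comb (x \o succn) w.
Proof. by rewrite /comb big_ord_recl. Qed.

Lemma comb_cat x u w :
  comb x (u ++ w) = comb x u + comb (fun i => x (size u + i)%N) w.
Proof.
elim: u x => [|a u IH] x; first by rewrite comb_nil add0r.
by rewrite cat_cons !comb_cons IH addrA.
Qed.

Lemma comb_wscale x c w : comb x (wscale c w) = c *: comb x w.
Proof.
elim: w x => [|a w IH] x; first by rewrite !comb_nil scaler0.
by rewrite wscale_cons !comb_cons IH scalerDr scalerA.
Qed.

Lemma comb_wadd x u w : size u = size w ->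
  comb x (wadd u w) = comb x u + comb x w.
Proof.
elim: u w x => [|a u IH] [|b w] // x; first by rewrite !comb_nil addr0.
move=> [uw].
by rewrite wadd_cons !comb_cons IH // scalerDl addrACA.
Qed.

Lemma comb_blowup x u w :
  comb x (blowup u w) = comb (fun j => comb (fun i => x (j * size u + i)%N) u) w.
Proof.
elim: w x => [|a w IH] x; first by rewrite !comb_nil.
rewrite blowup_cons comb_cat size_wscale comb_wscale comb_cons IH.
congr (_ + _).
congr (comb _ w); apply/funext => j /=; congr (comb _ u); apply/funext => i.
by rewrite mulSn addnA.
Qed.

Lemma comb_scale x c w : comb (fun i => c *: x i) w = c *: comb x w.
Proof. by rewrite /comb scaler_sumr; apply: eq_bigr => i _; rewrite !scalerA mulrC. Qed.

Lemma word_fr_blowup M u c : 0 <= c -> word_fr M ->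
  word_fr (fun w => c * M (blowup u w)).
Proof.
move=> c0 Mfr k A e e0 Ak.
(* [c] may be 0, hence the division by [c + 1]. *)
have c1 : 0 < c + 1 by lra.
have [|w|x xM] := @Mfr (k * size u)%N [seq blowup u w | w <- A] (e / (c + 1)).
- by rewrite divr_gt0.
- by move=> /mapP[w' /Ak <- ->]; rewrite size_blowup.
- exists (fun j => c *: comb (fun i => x (j * size u + i)%N) u) => w wA.
  rewrite comb_scale -comb_blowup normrZ (ger0_norm c0) -mulrBr normrM ger0_norm //.
  apply: (@le_trans _ _ (c * (e / (c + 1)))).
    by rewrite ler_wpM2l // xM // map_f.
  rewrite mulrA ler_pdivrMr //; nra.
Qed.

Lemma word_fr_limit (I : Type) (U : set_system I) {UU : UltraFilter U}
    (M : I -> seq R -> R) C :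
  (forall i, word_norm (M i)) -> (forall i, M i [:: 1] <= C) ->
  (forall i, word_fr (M i)) -> word_fr (word_limit U M).
Proof.
move=> Mn MC Mfr k A e e0 Ak.
have e2 : 0 < e / 2 by lra.
have : \forall i \near U, forall w, w \in A ->
    `|M i w - word_limit U M w| <= e / 2.
  elim: A {Ak} => [|w A IH]; first by near=> i.
  apply: filterS2 (word_limitP Mn MC w e2) IH => i h1 h2 v.
  by rewrite inE => /orP[/eqP ->//|]; exact: h2.
move=> /filter_ex[i hi].
have [x xM] := Mfr i k A _ e2 Ak.
exists x => w wA.
have := xM w wA; have := hi w wA.
rewrite !ler_norml; lra.
Unshelve. all: by end_near. Qed.

Section iterated_limit.
Variables (U : set_system nat) (UU : UltraFilter U).
Variables (x : nat -> X) (x1 : forall n, `|x n| <= 1).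

(** The spreading model of [x], with iterated ultralimits in place of Ramsey's theorem: the limit
    over n1 of the limit over n2, and so on, of the norm of y + a1 x_n1 + a2 x_n2 + ... The offset
    [y] collects the terms whose index is already fixed. A letter 0 contributes the limit of a
    constant, which is why the result is spreading. *)
Fixpoint iter_limit w (y : X) : R :=
  if w is a :: w' then ulim U (fun n => iter_limit w' (y + a *: x n)) else `|y|.

Lemma iter_limit_bounded w y :
  `|iter_limit w y| <= `|y| + \sum_(a <- w) `|a|.
Proof.
elim: w y => [|a w IH] y /=; first by rewrite big_nil addr0 normr_id.
rewrite big_cons addrA.
have B : forall n, `|iter_limit w (y + a *: x n)| <=
    `|y| + `|a| + \sum_(a <- w) `|a|.
  move=> n; apply: le_trans (IH _) _; rewrite lerD2r.
  apply: le_trans (ler_normD _ _) _; rewrite lerD2l normrZ.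
  by rewrite ler_piMr.
by apply: ulim_bounded; near=> n.
Unshelve. all: by end_near. Qed.

Lemma iter_limit_near a w y : \forall n \near U,
  `|iter_limit w (y + a *: x n)| <= `|y| + `|a| + \sum_(a <- w) `|a|.
Proof.
near=> n; apply: le_trans (iter_limit_bounded _ _) _; rewrite lerD2r.
apply: le_trans (ler_normD _ _) _; rewrite lerD2l normrZ.
by rewrite ler_piMr.
Unshelve. all: by end_near. Qed.

Lemma iter_limitD u w y z : size u = size w ->
  iter_limit (wadd u w) (y + z) <= iter_limit u y + iter_limit w z.
Proof.
elim: u w y z => [|a u IH] [|b w] // y z; first by rewrite /= ler_normD.
move=> [uw]; rewrite wadd_cons /=.
apply: ulim_leD (iter_limit_near _ _ _) (iter_limit_near _ _ _)
  (iter_limit_near _ _ _) _.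
by near=> n; rewrite scalerDl addrACA; exact: IH.
Unshelve. all: by end_near. Qed.

Lemma iter_limitZ c w y : iter_limit (wscale c w) (c *: y) =
  `|c| * iter_limit w y.
Proof.
elim: w y => [|a w IH] y; first by rewrite /= normrZ.
rewrite wscale_cons /= -(ulimZ _ (iter_limit_near a w y)).
by congr ulim; apply/funext => n; rewrite -IH scalerDr scalerA.
Qed.

Lemma iter_limit0 u w y : iter_limit (u ++ 0 :: w) y = iter_limit (u ++ w) y.
Proof.
elim: u y => [|a u IH] y /=.
  by under [X in ulim _ X]eq_fun do rewrite scale0r addr0; rewrite ulim_cst.
by congr ulim; apply/funext => n; rewrite IH.
Qed.

Lemma word_norm_iter_limit : word_norm (iter_limit^~ 0).
Proof.
split=> [u w uw|c u|u w].
- by have := @iter_limitD u w 0 0 uw; rewrite addr0.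
- by rewrite -iter_limitZ scaler0.
- exact: iter_limit0.
Qed.

(** A single index of the outermost limit serves the whole finite set. It moves the first letter of
    each word into the offset, so the induction has to run over pairs of an offset and a word; the
    error is halved at each letter. *)
Lemma iter_limit_fr k (A : seq (X * seq R)) (e : R) : 0 < e ->
  (forall p, p \in A -> size p.2 = k) ->
  exists z : nat -> X, forall p, p \in A ->
    `| `|p.1 + comb z p.2| - iter_limit p.2 p.1| <= e.
Proof.
elim: k A e => [|k IH] A e e0 Ak.
  exists (fun=> 0) => p pA.
  by rewrite (size0nil (Ak _ pA)) comb_nil addr0 subrr normr0 ltW.
have e2 : 0 < e / 2 by lra.
have : \forall n \near U, forall p, p \in A ->
    `|iter_limit (behead p.2) (p.1 + head 0 p.2 *: x n) -
      ulim U (fun n => iter_limit (behead p.2) (p.1 + head 0 p.2 *: x n))|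
      <= e / 2.
  elim: A {Ak} => [|p A IHA]; first by near=> n.
  apply: filterS2 (ulim_near e2
    (iter_limit_near (head 0 p.2) (behead p.2) p.1)) IHA => n h1 h2 q.
  by rewrite inE => /orP[/eqP ->//|]; exact: h2.
move=> /filter_ex[n hn].
have [|z zP] := IH [seq (p.1 + head 0 p.2 *: x n, behead p.2) | p <- A] _ e2.
  by move=> _ /mapP[p /Ak pk ->]; rewrite size_behead pk.
exists (fun i => if i is i'.+1 then z i' else x n) => -[y [|a w]] pA.
  by have := Ak _ pA.
have := hn _ pA; have /= := zP _ (map_f _ pA).
rewrite /= comb_cons addrA.
have -> : (fun i => if i is i'.+1 then z i' else x n) \o succn = z by [].
by rewrite !ler_norml; lra.
Unshelve. all: by end_near. Qed.

Lemma word_fr_iter_limit : word_fr (iter_limit^~ 0).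
Proof.
move=> k A e e0 Ak.
have [|z zP] := @iter_limit_fr k [seq (0, w) | w <- A] e e0.
  by move=> _ /mapP[w /Ak wk ->].
exists z => w wA; have := zP _ (map_f _ wA).
by rewrite /= add0r.
Qed.

Lemma iter_limit_sub (d : R) : \oo `<=` U ->
  (forall n m, (n < m)%N -> d <= `|x n - x m|) ->
  d <= iter_limit [:: 1; -1] 0.
Proof.
move=> Uoo xd /=.
have B n : \forall m \near U, `|0 + 1 *: x n + -1 *: x m| <= 2.
  near=> m; apply: le_trans (ler_normD _ _) _.
  rewrite add0r scale1r scaleN1r normrN.
  have := x1 n; have := x1 m; lra.
apply: ulim_ge; first by near=> n; apply: ulim_bounded; near do rewrite normr_id;
  exact: B.
near=> n; apply: ulim_ge; first by near do rewrite normr_id; exact: B.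
(* The ultrafilter is free, so the inner index exceeds the outer one. *)
have : \forall m \near U, (n < m)%N.
  by apply: Uoo; exact: nbhs_infty_gt.
apply: filterS => m nm.
by rewrite add0r scale1r scaleN1r; exact: xd.
Unshelve. all: by end_near. Qed.

End iterated_limit.
End representable_words.

(** * An unconditional spreading norm *)

Section unconditionality.
Context {R : realType}.
Implicit Types (M : seq R -> R) (u v w : seq R) (a b : R).

Lemma ler_archimean (a b C : R) :
  (forall m : nat, m%:R * a <= m%:R * b + C) -> a <= b.
Proof.
move=> h; rewrite leNgt; apply/negP => ba.
have := h (Num.truncn (C / (a - b))).+1.
have : C / (a - b) < (Num.truncn (C / (a - b))).+1%:R.
  have := real_truncnS_gt (num_real (C / (a - b))).
  by [].
rewrite ltr_pdivrMr ?subr_gt0 //; lra.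
Qed.

(** Unconditionality with suppression constant 1. *)
Definition suppressive M := forall u a v, M (u ++ v) <= M (u ++ a :: v).

Definition alternating n : seq R := flatten (nseq n [:: 1; -1]).

Definition sign_word w := all (fun a => (a == 1) || (a == -1)) w.

Lemma suppressive_subseq M : suppressive M ->
  forall u v, subseq u v -> M u <= M v.
Proof.
move=> Ms u v.
suff H p : subseq u v -> M (p ++ u) <= M (p ++ v) by exact: (H [::]).
elim: v u p => [|b v IH] [|a u] p //=.
- by move=> _; apply: le_trans (Ms p b v); exact: IH (sub0seq v).
- case: eqP => [-> uv|_ uv].
    by rewrite -!cat_rcons; exact: IH.
  by apply: le_trans (Ms p b v); exact: IH.
Qed.

(** [M] is convex in each letter, and a = t b + s (- b) with t, s >= 0 and t + s = 1. *)
Lemma word_norm_convex M u v a b : word_norm M -> `|a| <= `|b| ->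
  M (u ++ a :: v) <= Num.max (M (u ++ b :: v)) (M (u ++ - b :: v)).
Proof.
move=> Mn ab; have [b0|b0] := eqVneq b 0.
  by move: ab; rewrite b0 normr0 normr_le0 => /eqP ->; rewrite oppr0 maxxx.
set t := (1 + a / b) / 2; set s := (1 - a / b) / 2.
have abb : `|a / b| <= 1 by rewrite normrM normfV ler_pdivrMr ?normr_gt0 // mul1r.
have t0 : 0 <= t by move: abb; rewrite ler_norml /t; lra.
have s0 : 0 <= s by move: abb; rewrite ler_norml /s; lra.
have st : t + s = 1 by rewrite /t /s; field.
have -> : u ++ a :: v = wadd (wscale t (u ++ b :: v)) (wscale s (u ++ - b :: v)).
  rewrite !wscale_cat !wscale_cons wadd_cat ?size_wscale // wadd_cons.
  rewrite !wadd_wscale st !wscale1; congr (_ ++ _ :: _).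
  by rewrite /t /s; field.
apply: le_trans (wnD Mn _) _; first by rewrite !size_wscale !size_cat.
rewrite !(wnZ Mn) !ger0_norm //.
set A := M (u ++ b :: v); set B := M (u ++ - b :: v).
have hA : A <= Num.max A B by rewrite le_max lexx.
have hB : B <= Num.max A B by rewrite le_max lexx orbT.
rewrite -[leRHS]mul1r -st mulrDl.
by rewrite lerD // ler_wpM2l.
Qed.

Lemma sign_invariant_monotone M : word_norm M ->
  (forall u a v, M (u ++ - a :: v) = M (u ++ a :: v)) -> word_monotone M.
Proof.
move=> Mn Ms u v.
suff H p : all2 (fun a b => `|a| <= `|b|) u v -> M (p ++ u) <= M (p ++ v).
  exact: (H [::]).
elim: u v p => [|a u IH] [|b v] p //=.
move=> /andP[ab uv].
apply: (@le_trans _ _ (M (p ++ b :: u))).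
  by have := word_norm_convex p u Mn ab; rewrite Ms maxxx.
by rewrite -!cat_rcons; exact: IH.
Qed.

(** A convex function on a cube is bounded by its values at the vertices; [p] collects the letters
    already moved to signs. *)
Lemma sign_words_bound M c : word_norm M ->
  (forall w, sign_word w -> M w <= c) ->
  forall w, all (fun a => `|a| <= 1) w -> M w <= c.
Proof.
move=> Mn Mc w.
suff H p : sign_word p -> all (fun a => `|a| <= 1) w -> M (p ++ w) <= c.
  exact: (H [::]).
elim: w p => [|a w IH] p ps /=; first by rewrite cats0 => _; exact: Mc.
move=> /andP[a1 w1].
rewrite -(@normr1 R) in a1.
apply: le_trans (word_norm_convex p w Mn a1) _.
rewrite ge_max -!cat_rcons !IH // /sign_word all_rcons -/(sign_word p) ps.
- by rewrite eqxx orbT.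
- by rewrite eqxx.
Qed.

(** As [M] is spreading, copies of [W1 ++ [:: a, - a & W2]] whose middle pair moves one step at a
    time all have the same norm, and m of them add up to m W1 and m W2 around a single pair. So m
    M(W1 W2) exceeds m M(W1 a -a W2) by at most a constant independent of m, and the constant
    disappears for large m. *)
Lemma differences_suppressive M : word_norm M ->
  suppressive (fun w => M (blowup [:: 1; -1] w)).
Proof.
move=> Mn u a v; rewrite !blowup_cat blowup_cons.
set W1 := blowup _ u; set W2 := blowup _ v.
rewrite /= mulr1 mulrN1.
have H m : M (wscale m%:R W1 ++ [:: a; - a] ++ wscale m%:R W2) <=
    m%:R * M (W1 ++ [:: a, - a & W2]) + M [:: a; - a].
  elim: m => [|m IH].
    by rewrite !wscale0 mul0r add0r (wn_mid Mn).
  (* Moving the pair [a, -a] one step to the right lets its inner entries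
     cancel in the sum. *)
  have -> : M (wscale m.+1%:R W1 ++ [:: a; - a] ++ wscale m.+1%:R W2) =
      M (wadd (wscale m%:R W1 ++ [:: a; - a; 0] ++ wscale m%:R W2)
              (W1 ++ [:: 0; a; - a] ++ W2)).
    rewrite !wadd_cat ?size_wscale //.
    have E w : wadd (wscale m%:R w) w = wscale m.+1%:R w.
      by rewrite -{2}(wscale1 w) wadd_wscale natr1.
    rewrite !E /wadd /= addr0 addNr add0r.
    by have := wn0 Mn (wscale m.+1%:R W1 ++ [:: a]) (- a :: wscale m.+1%:R W2);
       rewrite -!catA.
  apply: le_trans (wnD Mn _) _; first by rewrite !size_cat !size_wscale.
  have -> : M (wscale m%:R W1 ++ [:: a; - a; 0] ++ wscale m%:R W2) =
      M (wscale m%:R W1 ++ [:: a; - a] ++ wscale m%:R W2).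
    by have := wn0 Mn (wscale m%:R W1 ++ [:: a; - a]) (wscale m%:R W2);
       rewrite -!catA.
  by rewrite (wn0 Mn) -natr1 mulrDl mul1r; move: IH => /=; lra.
apply: (@ler_archimean _ _ (2 * M [:: a; - a])) => m.
rewrite -{1}(ger0_norm (ler0n R m)) -(wnZ Mn) wscale_cat.
have -> : M (wscale m%:R W1 ++ wscale m%:R W2) =
    M (wscale m%:R W1 ++ [:: 0; 0] ++ wscale m%:R W2).
  by rewrite /= !(wn0 Mn).
have -> : wscale m%:R W1 ++ [:: 0; 0] ++ wscale m%:R W2 =
  wadd (wscale m%:R W1 ++ [:: a; - a] ++ wscale m%:R W2)
   (nseq (size W1) 0 ++ wscale (-1) [:: a; - a] ++ nseq (size W2) 0).
  rewrite !wadd_cat ?size_wscale ?size_nseq //.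
  have E w : wadd (wscale m%:R w) (nseq (size w) 0) = wscale m%:R w.
    by rewrite -{1}(size_wscale m%:R w) waddw0.
  rewrite !E /wadd /=.
  by rewrite !mulN1r opprK subrr addNr.
apply: le_trans (wnD Mn _) _; first by rewrite !size_cat !size_nseq !size_wscale.
have -> : M (nseq (size W1) 0 ++ wscale (-1) [:: a; - a] ++ nseq (size W2) 0) =
    M [:: a; - a].
  by rewrite (wn_mid Mn) (wnN Mn).
by have := H m; rewrite /=; lra.
Qed.

End unconditionality.

Section unconditional_model.
Context {R : realType}.
Implicit Types (M : seq R -> R) (u v w : seq R) (a b : R).

Definition word_max w : R := \big[Num.max/0]_(a <- w) `|a|.

Lemma word_max_monotone : word_monotone word_max.
Proof.
elim=> [|a u IH] [|b v] //= /andP[ab uv].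
rewrite /word_max !big_cons ge_max !le_max ab /=.
by rewrite (IH v uv) orbT.
Qed.

Lemma word_max_ge0 w : 0 <= word_max w.
Proof.
by rewrite /word_max; elim/big_ind: _ => // x y x0 y0; rewrite le_max x0.
Qed.

Lemma word_max_ub w : all (fun a => `|a| <= word_max w) w.
Proof.
elim: w => //= a w IH; rewrite {1}/word_max big_cons le_max lexx /=.
apply: sub_all IH => b /le_trans; apply.
by rewrite {2}/word_max big_cons le_max lexx orbT.
Qed.

Lemma word_max_le w c : 0 <= c -> all (fun a => `|a| <= c) w -> word_max w <= c.
Proof.
move=> c0; elim: w => [|a w IH] /=; first by rewrite /word_max big_nil.
by move=> /andP[ac wc]; rewrite /word_max big_cons ge_max ac IH.
Qed.

(** Divided by its largest absolute value, a word lies in the cube whose vertices are the sign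
    words. Conversely, each letter survives the deletion of all the others. *)
Lemma suppressive_sign_max M : word_norm M -> M [:: 1] = 1 -> suppressive M ->
  (forall w, sign_word w -> M w <= 1) -> forall w, M w = word_max w.
Proof.
move=> Mn M1 Ms Mw w; apply/eqP; rewrite eq_le; apply/andP; split.
  have [w0|w0] := eqVneq (word_max w) 0.
    apply: le_trans (wn_bound Mn w) _.
    suff -> : \sum_(a <- w) `|a| = 0 by rewrite mul0r word_max_ge0.
    apply/eqP; rewrite psumr_eq0 //; apply: sub_all (word_max_ub w) => a.
    by rewrite w0 normr_le0 normr_eq0.
  have c0 : 0 < word_max w by rewrite lt_neqAle eq_sym w0 word_max_ge0.
  have -> : M w = M (wscale (word_max w) (wscale (word_max w)^-1 w)).
    by rewrite wscaleA mulfV // wscale1.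
  rewrite (wnZ Mn) gtr0_norm // -[leRHS]mulr1 ler_wpM2l ?(ltW c0) //.
   apply: (sign_words_bound Mn Mw); rewrite all_map.
  apply: sub_all (word_max_ub w) => a /=.
  by rewrite normrM normfV (gtr0_norm c0) mulrC ler_pdivrMr // mul1r.
apply: word_max_le; first exact: wn_ge0 Mn _.
apply/allP => a aw; rewrite -[leLHS]mulr1 -M1 -(wn1 Mn).
by apply: (suppressive_subseq Ms); rewrite sub1seq.
Qed.

Lemma alternatingS n : alternating n.+1 = [:: 1, -1 & alternating n] :> seq R.
Proof. by []. Qed.

Lemma sign_word_alternating n : sign_word (alternating n : seq R).
Proof. by elim: n => //= n ->; rewrite !eqxx orbT. Qed.

(** Each sign is found in its own pair [[:: 1; -1]]. For a suppressive norm, the alternating words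
    therefore dominate all sign words. *)
Lemma sign_word_subseq w : sign_word w -> subseq w (alternating (size w)).
Proof.
elim: w => // a w IH; rewrite [sign_word _]/= => /andP[a1 ws].
rewrite -cat1s -[alternating _]/([:: 1; -1] ++ alternating (size w)).
apply: cat_subseq; last exact: IH.
by rewrite sub1seq !inE.
Qed.

Lemma sign_word_blowup u w : sign_word u -> sign_word w ->
  sign_word (blowup u w).
Proof.
move=> us; elim: w => // a w IH; rewrite [sign_word _]/= => /andP[a1 ws].
rewrite blowup_cons /sign_word all_cat -!/(sign_word _) IH // andbT.
rewrite /sign_word all_map; apply: sub_all us => b /=.
by case/orP: a1 => /eqP -> /orP[]/eqP ->;
  rewrite ?mulrNN ?mulN1r ?mul1r ?opprK eqxx ?orbT.
Qed.

Lemma suppressive_blowup M u : suppressive M ->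
  suppressive (fun w => M (blowup u w)).
Proof.
move=> Ms v a w; rewrite !blowup_cat blowup_cons.
elim: (wscale a u) => //= b t IH.
by apply: le_trans IH _; exact: Ms.
Qed.

(* The difference telescopes to two letters, as in
   [0, -a, a, -a, a] - [a, -a, a, -a, 0] = [-a, 0, 0, 0, -(-a)]. *)
Lemma alternating_sign_change M u v n a : word_norm M ->
  `|M (u ++ wscale (- a) (alternating n) ++ v) -
    M (u ++ wscale a (alternating n) ++ v)| <= 2 * `|a| * M [:: 1].
Proof.
move=> Mn.
pose p := 0 :: wscale (- a) (alternating n).
pose q := rcons (wscale a (alternating n)) 0.
have pq : size p = size q by rewrite size_rcons /= !size_wscale.
have -> : M (u ++ wscale (- a) (alternating n) ++ v) = M (u ++ p ++ v).
  by rewrite /p cat_cons (wn0 Mn).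
have -> : M (u ++ wscale a (alternating n) ++ v) = M (u ++ q ++ v).
  by rewrite /q cat_rcons [in RHS]catA (wn0 Mn) -catA.
apply: le_trans (wn_dist_mid Mn u v pq) _.
have H : forall k b, wadd (b :: wscale (- a) (alternating k))
    (wscale (-1) (rcons (wscale a (alternating k)) 0)) =
    if k is 0%N then [:: b] else (b - a) :: nseq k.*2.-1 0 ++ [:: a].
  elim=> [|k IH] b; first by rewrite /wadd /= mulr0 addr0.
  rewrite alternatingS !(wscale_cons, rcons_cons, wadd_cons) IH !mulr1 !mulN1r.
  rewrite !mulrN1 !opprK addNr.
  by case: k {IH} => [|k] //=; rewrite subrr.
rewrite /p /q H.
case: n {p q pq H} => [|n].
  by rewrite wn1 // normr0 mul0r mulr_ge0 ?mulr_ge0 // (wn_ge0 Mn).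
have := wn_nseq0 Mn [:: 0 - a] n.+1.*2.-1 [:: a]; rewrite cat_cons cat0s => ->.
apply: le_trans (wn_bound Mn _) _.
rewrite /= !big_cons big_nil addr0 add0r normrN.
by rewrite -mulr2n mulr_natl.
Qed.

(** The differences [D] are suppression unconditional, and blocks along alternating words are
    normalised by their norms [A]. If [A] is bounded, the limit is the norm of c_0. If it is
    unbounded, the change of sign of one block costs a bounded amount before normalisation, hence
    nothing in the limit. *)
Lemma unconditional_model (X : normedModType R) N :
  word_norm N -> word_fr X N -> 0 < N [:: 1; -1] ->
  exists M, [/\ word_norm M, word_fr X M, word_monotone M & M [:: 1] = 1].
Proof.
move=> Nn Nfr N1.
have [U [UU Uoo]] := free_ultrafilter.
pose D w := N (blowup [:: 1; -1] w).
have Dn : word_norm D.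
  have := word_norm_blowup Nn [:: 1; -1] ler01.
  by congr word_norm; apply/funext => w; rewrite mul1r.
have Dfr : word_fr X D.
  have := word_fr_blowup [:: 1; -1] ler01 Nfr.
  by congr (word_fr X _); apply/funext => w; rewrite mul1r.
have Ds : suppressive D := differences_suppressive Nn.
have D1 : 0 < D [:: 1] by rewrite /D /blowup /= !mul1r.
pose A n := D (alternating n).
have A_mono n m : (n <= m)%N -> A n <= A m.
  move=> /subnKC <-; rewrite /A /alternating nseqD flatten_cat.
  exact: (suppressive_subseq Ds (prefix_subseq _ _)).
have A0 n : 0 < A n.+1.
  apply: lt_le_trans D1 _; apply: (suppressive_subseq Ds).
  by rewrite sub1seq inE eqxx.
(* The index [n.+1] avoids the empty alternating word, whose norm is 0. *)
pose M n w := (A n.+1)^-1 * D (blowup (alternating n.+1) w).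
have iA0 n : 0 <= (A n.+1)^-1 by rewrite invr_ge0 ltW.
have Mn n : word_norm (M n) := word_norm_blowup Dn _ (iA0 n).
have M1 n : M n [:: 1] = 1.
  by rewrite /M blowup_cons cats0 wscale1 mulVf // gt_eqF.
have M1' n : M n [:: 1] <= 1 by rewrite M1.
have Mfr n : word_fr X (M n) := word_fr_blowup _ (iA0 n) Dfr.
exists (word_limit U M).
have L1 : word_limit U M [:: 1] = 1.
  by rewrite /word_limit -[RHS](ulim_cst (U := U)); congr ulim; apply/funext.
split=> //; [exact: word_limit_norm Mn M1'|exact: word_fr_limit Mn M1' Mfr|].
have Ln := word_limit_norm (UU := UU) Mn M1'.
have [[C AC]|Aunb] := pselect (exists C, forall n, A n <= C).
  pose s := sup (range A).
  have As : has_sup (range A) by split; [exists (A 0%N); exists 0%N|exists C => _ [n _ <-]].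
  have As_ub n : A n <= s by apply: sup_upper_bound As _ _; exists n.
  have s0 : 0 < s := lt_le_trans (A0 0%N) (As_ub 1%N).
  have -> : word_limit U M = word_max; last exact: word_max_monotone.
  apply/funext; apply: suppressive_sign_max => //.
    move=> u a v; apply: (word_limit_le Mn M1').
    by near=> n; rewrite ler_wpM2l //; exact: (suppressive_blowup _ Ds).
  move=> w ws; apply/ler_addgt0Pr => e e0.
  (* A sign word blown up along [alternating n.+1] is again a sign word, of norm at most [s]; once
     [A] exceeds s / (1 + e), its normalised norm is at most 1 + e. *)
  have [_ [N0 _ <-] sN] : exists2 x, range A x & s / (1 + e) < x.
    have /sup_adherent : 0 < s - s / (1 + e).
      rewrite subr_gt0 ltr_pdivrMr; last by lra.
      by rewrite ltr_pMr // ltrDl.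
    by move=> /(_ _ As)[x Ax]; rewrite opprB addrC subrK; exists x.
  apply: (word_limit_ub Mn M1').
  have : \forall n \near U, (N0 <= n)%N by apply: Uoo; exact: nbhs_infty_ge.
  apply: filterS => n Nn0; rewrite /M mulrC ler_pdivrMr //.
  apply: (@le_trans _ _ s).
    apply: le_trans (As_ub (size (blowup (alternating n.+1) w))).
    apply: (suppressive_subseq Ds); apply: sign_word_subseq.
    by apply: sign_word_blowup ws; exact: sign_word_alternating.
  rewrite -ler_pdivrMl; last by lra.
  rewrite mulrC; apply: (le_trans (ltW sN)); apply: A_mono.
  exact: leq_trans Nn0 (leqnSn n).
apply: (sign_invariant_monotone Ln) => u a v.
apply/eqP; rewrite eq_sym -subr_eq0 -normr_le0; apply/ler_addgt0Pr => e e0.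
rewrite add0r.
have e3 : 0 < e / 3 by lra.
(* The bound of [alternating_sign_change], independent of [n]. *)
pose K := 2 * `|a| * D [:: 1].
have h3 : \forall n \near U, K / (e / 3) <= A n.+1.
  have [N0 AN0] : exists n, K / (e / 3) <= A n.
    apply: contrapT => /forallNP H; apply: Aunb; exists (K / (e / 3)) => n.
    by have /negP := H n; rewrite -ltNge => /ltW.
  have : \forall n \near U, (N0 <= n)%N by apply: Uoo; exact: nbhs_infty_ge.
  apply: filterS => n Nn0; apply: (le_trans AN0); apply: A_mono.
  exact: leq_trans Nn0 (leqnSn n).
have h1 := word_limitP (UU := UU) Mn M1' (u ++ - a :: v) e3.
have h2 := word_limitP (UU := UU) Mn M1' (u ++ a :: v) e3.
have [n [{}h1 {}h2 {}h3]] : exists n,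
    [/\ `|M n (u ++ - a :: v) - word_limit U M (u ++ - a :: v)| <= e / 3,
        `|M n (u ++ a :: v) - word_limit U M (u ++ a :: v)| <= e / 3 &
        K / (e / 3) <= A n.+1].
  by apply: (@filter_ex _ U); apply: filterS3 h1 h2 h3 => n.
have : `|M n (u ++ - a :: v) - M n (u ++ a :: v)| <= e / 3.
  rewrite /M -mulrBr normrM ger0_norm // mulrC ler_pdivrMr //.
  rewrite !blowup_cat !blowup_cons.
  apply: le_trans (alternating_sign_change _ _ _ _ Dn) _.
  by rewrite -ler_pdivrMl // mulrC.
by move: h1 h2; rewrite !ler_norml; lra.
Unshelve. all: by end_near. Qed.

End unconditional_model.

(** * Approximate eigenvectors of the dilations *)

Section grid_functions.
Context {R : realType}.
Variables (M : seq R -> R) (Mn : word_norm M) (Mm : word_monotone M).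
Implicit Types (f g h : rat -> R) (d e n m : nat).

(* A vector of d entries is encoded as a 1-periodic function on rat vanishing
   outside the multiples of 1/d; then [dilate n], which places n shrunk copies of
   the vector side by side, is a mere composition, and the dilations commute. *)
Definition grid d : seq rat := [seq i%:R / d%:R | i <- iota 0 d].

Definition on_grid d f := [/\ (0 < d)%N, forall q, f (q + 1) = f q &
  forall q, f q != 0 -> q * d%:R \is a Num.int].

Definition gridded f := exists d, on_grid d f.

Definition dilate n f : rat -> R := fun q => f (n%:R * q).

(** Any grid carrying [f] gives the same value, as a refinement only inserts zeros ([grid_normE]).
    If there is none, the default 0 yields the empty word. *)
Definition grid_norm f : R := M (map f (grid (xget 0%N [set d | on_grid d f]))).

Lemma grid_mul d e : (0 < d)%N -> (0 < e)%N ->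
  grid (d * e) = flatten [seq [seq i%:R / d%:R + j%:R / (d * e)%:R | j <- iota 0 e]
    | i <- iota 0 d].
Proof.
move=> d0 e0; rewrite /grid.
have -> : iota 0 (d * e) =
    flatten [seq [seq (i * e + j)%N | j <- iota 0 e] | i <- iota 0 d].
  elim: {d0} d => // d IH.
  rewrite -{2}addn1 iotaD map_cat flatten_cat -IH /= cats0 add0n.
  by rewrite mulSn addnC iotaD add0n -iotaDl addn0.
rewrite map_flatten -map_comp; congr flatten; apply: eq_map => i /=.
rewrite -map_comp; apply: eq_map => j /=.
by rewrite natrD !natrM; field; rewrite !pnatr_eq0 -!lt0n d0 e0.
Qed.

Definition stretch k (w : seq R) := flatten [seq a :: nseq k 0 | a <- w].

Lemma wn_stretch k u w v : M (u ++ stretch k w ++ v) = M (u ++ w ++ v).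
Proof.
elim: w u => //= a w IH u.
have := wn_nseq0 Mn (rcons u a) k (stretch k w ++ v).
by rewrite -!cat_rcons -catA => ->; exact: IH.
Qed.

Lemma wscale_stretch k c w : wscale c (stretch k w) = stretch k (wscale c w).
Proof.
elim: w => // a w IH.
rewrite -[stretch k (a :: w)]/((a :: nseq k 0) ++ stretch k w) wscale_cat IH.
by rewrite wscale_cons wscale_nseq mulr0.
Qed.

Lemma on_grid_mul d e f : (0 < e)%N -> on_grid d f -> on_grid (d * e) f.
Proof.
move=> e0 [d0 fp fd]; split=> //; first by rewrite muln_gt0 d0.
by move=> q /fd qd; rewrite natrM mulrA rpredM ?rpred_nat.
Qed.

Lemma map_grid_mul d e f : (0 < e)%N -> on_grid d f ->
  map f (grid (d * e)) = stretch e.-1 (map f (grid d)).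
Proof.
move=> e0 [d0 fp fd]; rewrite grid_mul // /stretch /grid -!map_comp.
rewrite map_flatten -map_comp; congr flatten; apply: eq_map => i /=.
case: e e0 => // e _; rewrite /= mul0r addr0; congr cons.
rewrite -map_comp; apply: (@eq_from_nth _ 0) => [|j].
  by rewrite size_map size_iota size_nseq.
rewrite size_map size_iota => je.
rewrite (nth_map 0%N) ?size_iota // nth_nseq je nth_iota //=.
(* A nonzero value would make (1 + j) / (e + 1) an integer, yet it lies strictly between 0 and 1. *)
apply/eqP/negPn/negP => /fd.
have -> : (i%:R / d%:R + (1 + j)%:R / (d * e.+1)%:R) * d%:R =
    i%:R + (1 + j)%:R / e.+1%:R :> rat.
  have D0 : d%:R != 0 :> rat by rewrite pnatr_eq0 -lt0n.
  have E0 : e.+1%:R != 0 :> rat by rewrite pnatr_eq0.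
  move: D0 E0; rewrite natrM.
  move: (d%:R) (e.+1%:R) (i%:R) ((1 + j)%:R) => D E i' j' D0 E0.
  by field; apply/andP.
rewrite rpredDl ?rpred_nat // => /intrP[k] /(congr1 (fun x => x * e.+1%:R)).
rewrite divfK ?pnatr_eq0 // => /eqP.
rewrite -[(1 + j)%:R]/((1 + j)%:Z%:~R) -[e.+1%:R]/(e.+1%:Z%:~R) -intrM eqr_int.
move=> /eqP H; have : (1 + j)%N%:Z < 1 * e.+1%:Z by rewrite mul1r ltz_nat.
rewrite H ltr_pM2r ?ltz_nat // => k1.
have : (0:int) < k * e.+1%:Z by rewrite -H ltz_nat.
by rewrite pmulr_lgt0 ?ltz_nat //; lia.
Qed.

Lemma norm_grid_mul d e f : (0 < e)%N -> on_grid d f ->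
  M (map f (grid (d * e))) = M (map f (grid d)).
Proof.
move=> e0 fd; rewrite map_grid_mul //.
by have := wn_stretch e.-1 [::] (map f (grid d)) [::]; rewrite !cats0.
Qed.

Lemma grid_normE d f : on_grid d f -> grid_norm f = M (map f (grid d)).
Proof.
move=> fd; rewrite /grid_norm; case: xgetP => [e _ fe|/(_ d)//].
have [e0 _ _] := fe; have [d0 _ _] := fd.
by rewrite -(norm_grid_mul d0 fe) mulnC (norm_grid_mul e0 fd).
Qed.

Lemma on_gridD d f g (a b : R) : on_grid d f -> on_grid d g ->
  on_grid d (fun q => a * f q + b * g q).
Proof.
move=> [d0 fp fd] [_ gp gd]; split=> // q; first by rewrite fp gp.
have [->|/fd//] := eqVneq (f q) 0.
have [->|/gd//] := eqVneq (g q) 0.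
by rewrite !mulr0 addr0 eqxx.
Qed.

Lemma common_grid f g : gridded f -> gridded g ->
  exists d, on_grid d f /\ on_grid d g.
Proof.
move=> [d fd] [e ge]; exists (d * e)%N.
have [e0 _ _] := ge; have [d0 _ _] := fd.
by split; [exact: on_grid_mul|rewrite mulnC; exact: on_grid_mul].
Qed.

Lemma griddedD f g (a b : R) : gridded f -> gridded g ->
  gridded (fun q => a * f q + b * g q).
Proof.
by move=> /common_grid/[apply] -[d [fd gd]]; exists d; exact: on_gridD.
Qed.

Lemma grid_norm_ge0 f : 0 <= grid_norm f.
Proof. exact: wn_ge0. Qed.

Lemma grid_normD f g (a b : R) : gridded f -> gridded g ->
  grid_norm (fun q => a * f q + b * g q) <=
    `|a| * grid_norm f + `|b| * grid_norm g.
Proof.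
move=> /common_grid/[apply] -[d [fd gd]].
rewrite (grid_normE fd) (grid_normE gd) (grid_normE (on_gridD a b fd gd)).
rewrite -!(wnZ Mn) -wadd_map.
have E (c : R) h : [seq c * h i | i <- grid d] = wscale c (map h (grid d)).
  exact: (map_comp ( *%R c) h).
by rewrite !E; apply: (wnD Mn); rewrite !size_wscale !size_map.
Qed.

Lemma grid_norm_monotone f g : gridded f -> gridded g ->
  (forall q, `|f q| <= `|g q|) -> grid_norm f <= grid_norm g.
Proof.
move=> /common_grid/[apply] -[d [fd gd]] fg.
rewrite (grid_normE fd) (grid_normE gd); apply: Mm.
by elim: (grid d) => //= q s ->; rewrite fg.
Qed.

Lemma griddedZ f (a : R) : gridded f -> gridded (fun q => a * f q).
Proof.
move=> gf; have -> : (fun q => a * f q) = (fun q => a * f q + 0 * f q).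
  by apply/funext => q; rewrite mul0r addr0.
exact: griddedD.
Qed.

Lemma grid_normZ f (a : R) : gridded f ->
  grid_norm (fun q => a * f q) = `|a| * grid_norm f.
Proof.
move=> gf; have [e' [fe afe']] := common_grid gf (griddedZ a gf).
rewrite (grid_normE fe) (grid_normE afe') -(wnZ Mn); congr M.
exact: (map_comp ( *%R a) f).
Qed.

Lemma gridded0 : gridded (fun=> 0).
Proof. by exists 1%N; split=> // q; rewrite eqxx. Qed.

Lemma grid_norm_sum k (v : nat -> R) (g : nat -> rat -> R) :
  (forall i, gridded (g i)) ->
  gridded (fun q => \sum_(i < k) v i * g i q) /\
  grid_norm (fun q => \sum_(i < k) v i * g i q) <=
    \sum_(i < k) `|v i| * grid_norm (g i).
Proof.
move=> gg; elim: k => [|k [IH1 IH2]].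
  under [X in gridded X]eq_fun do rewrite big_ord0.
  under [X in grid_norm X]eq_fun do rewrite big_ord0.
  split; first exact: gridded0.
  rewrite big_ord0; have := grid_normD 0 0 gridded0 gridded0.
  by rewrite !normr0 !mul0r addr0.
have E : (fun q => \sum_(i < k.+1) v i * g i q) =
    (fun q => 1 * (\sum_(i < k) v i * g i q) + v k * g k q).
  by apply/funext => q; rewrite big_ord_recr mul1r.
rewrite E big_ord_recr /=; split; first exact: griddedD.
by apply: le_trans (grid_normD _ _ IH1 (gg k)) _; rewrite normr1 mul1r lerD2r.
Qed.

Lemma on_grid_dilate n d f : (0 < n)%N -> on_grid d f ->
  on_grid (n * d) (dilate n f).
Proof.
move=> n0 [d0 fp fd]; split; first by rewrite muln_gt0 n0.
  move=> q; rewrite /dilate mulrDr mulr1.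
  move: (n%:R * q) => p; elim: {n0} n => [|k IH]; first by rewrite addr0.
  by rewrite -natr1 addrA fp IH.
by move=> q /fd; rewrite natrM mulrA [q * _]mulrC.
Qed.

Lemma gridded_dilate n f : (0 < n)%N -> gridded f -> gridded (dilate n f).
Proof. by move=> n0 [d fd]; exists (n * d)%N; exact: on_grid_dilate. Qed.

Lemma map_dilate n d f : (0 < n)%N -> on_grid d f ->
  map (dilate n f) (grid (n * d)) = flatten (nseq n (map f (grid d))).
Proof.
move=> n0 [d0 fp fd]; rewrite grid_mul // map_flatten -map_comp.
have -> : nseq n (map f (grid d)) = [seq map f (grid d) | i <- iota 0 n].
  by move: 0%N; elim: {n0} n => // k IH j /=; rewrite -IH.
congr flatten; apply: eq_map => i /=.
rewrite /grid -!map_comp; apply: eq_map => j /=; rewrite /dilate.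
have -> : n%:R * (i%:R / n%:R + j%:R / (n * d)%:R) = j%:R / d%:R + i%:R :> rat.
  by rewrite natrM; field; rewrite !pnatr_eq0 -!lt0n d0 n0.
move: (j%:R / d%:R) => p; elim: i => [|k IH]; first by rewrite addr0.
by rewrite -natr1 addrA fp IH.
Qed.

Lemma grid_norm_dilate_le n f : (0 < n)%N -> gridded f ->
  grid_norm (dilate n f) <= n%:R * grid_norm f.
Proof.
move=> n0 [d fd]; rewrite (grid_normE fd) (grid_normE (on_grid_dilate n0 fd)).
rewrite map_dilate //; elim: {n0} n => [|n IH] /=; first by rewrite mul0r wn_nil.
by apply: le_trans (wn_cat Mn _ _) _; rewrite -natr1 mulrDl mul1r addrC lerD2r.
Qed.

Lemma grid_norm_dilate_ge n f : (0 < n)%N -> gridded f ->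
  grid_norm f <= grid_norm (dilate n f).
Proof.
move=> n0 [d fd]; rewrite (grid_normE fd) (grid_normE (on_grid_dilate n0 fd)).
rewrite map_dilate //; case: n n0 => // n _ /=.
move: (map f _) (flatten _) => u v.
have <- : M (u ++ nseq (size v) 0) = M u.
  by have := wn_nseq0 Mn u (size v) [::]; rewrite !cats0.
apply: Mm; elim: u => [|a u IH] /=; last by rewrite lexx.
by elim: v => //= a v ->; rewrite normr0 normr_ge0.
Qed.

Lemma dilateM n m f : dilate n (dilate m f) = dilate (m * n) f.
Proof. by apply/funext => q; rewrite /dilate natrM mulrA. Qed.

Lemma dilateC n m f : dilate n (dilate m f) = dilate m (dilate n f).
Proof. by rewrite !dilateM mulnC. Qed.

End grid_functions.

Section approximate_eigenvectors.
Context {R : realType}.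

Lemma bernoulli_le (x : R) n : 0 <= x -> 1 + x *+ n <= (1 + x) ^+ n.
Proof.
move=> x0; elim: n => [|n IH]; first by rewrite mulr0n addr0.
rewrite exprS; apply: (@le_trans _ _ ((1 + x) * (1 + x *+ n))); last first.
  by rewrite ler_wpM2l // addr_ge0.
have xn : 0 <= x *+ n by rewrite mulrn_wge0.
by rewrite mulrS; nra.
Qed.

Lemma expr_unbounded (x C : R) : 1 < x -> exists n, C <= x ^+ n.
Proof.
move=> x1; have x0 : 0 < x - 1 by rewrite subr_gt0.
exists (Num.truncn (C / (x - 1))).+1.
have -> : x = 1 + (x - 1) by rewrite addrC subrK.
apply: le_trans _ (bernoulli_le _ (ltW x0)).
have := real_truncnS_gt (num_real (C / (x - 1))).
rewrite [in 1 + (x - 1)]addrC subrK ltr_pdivrMr // mulrC mulr_natr; lra.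
Qed.

(** Applied at each point with [c k] the value of T^k f, this estimates T y - r y for y = sum_k v_k
    T^k f. The coefficient of c_(k+1) is v_k - r v_(k+1), small relative to v_(k+1); the two ends
    leave r c_0 and v_p c_(p+1). *)
Lemma two_slope_sum (v c : nat -> R) (r d : R) p :
  v 0%N = 1 -> (forall k, 0 <= v k) -> (forall k, 0 <= c k) -> 0 <= r -> 0 <= d ->
  (forall k, `|v k - r * v k.+1| <= d * v k.+1) ->
  `|\sum_(k < p.+1) v k * c k.+1 - r * \sum_(k < p.+1) v k * c k| <=
    d * \sum_(k < p.+1) v k * c k + r * c 0%N + v p * c p.+1.
Proof.
move=> v0 vp cp r0 d0 vd.
rewrite big_ord_recr [\sum_(k < p.+1) v k * c k]big_ord_recl /= v0 mul1r.
rewrite !mulrDr !mulr_sumr.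
set S1 := \sum_(k < p) _ ; set S2 := \sum_(k < p) _; set S3 := \sum_(k < p) _.
have H : `|S1 - S2| <= S3.
  rewrite /S1 /S2 /S3 -sumrB; apply: le_trans (ler_norm_sum _ _ _) _.
  apply: ler_sum => k _; rewrite /bump /= add1n !mulrA -mulrBl normrM.
  by rewrite (ger0_norm (cp _)) ler_wpM2r.
have h0 : 0 <= r * c 0%N by rewrite mulr_ge0.
have h1 : 0 <= d * c 0%N by rewrite mulr_ge0.
have h2 : 0 <= v p * c p.+1 by rewrite mulr_ge0.
by move: H; rewrite !ler_norml; lra.
Qed.

Variables (M : seq R -> R) (Mn : word_norm M) (Mm : word_monotone M).
Implicit Types (f g : rat -> R) (S : seq nat) (lam : nat -> R).
Notation nm := (grid_norm M).

(** Nonnegativity excludes cancellation: the norm of a sum with positive weights dominates the norm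
    of each of its terms. *)
Definition approx_eigen S lam (d : R) f :=
  [/\ gridded f, forall q, 0 <= f q, 0 < nm f &
    forall n, n \in S -> nm (fun q => dilate n f q - lam n * f q) <= d * nm f].

(** Dilations commute, so the defect of [dilate p f] is the dilated defect of [f]. Dilation by [p]
    multiplies it by at most [p] and does not decrease the norm of [f]. *)
Lemma approx_eigen_dilate S lam d f p : all (ltn 0) S -> (0 < p)%N -> 0 <= d ->
  approx_eigen S lam d f -> approx_eigen S lam (p%:R * d) (dilate p f).
Proof.
move=> /allP S0 p0 d0 [fg f0 fpos fe]; split.
- exact: gridded_dilate.
- by move=> q; exact: f0.
- exact: lt_le_trans fpos (grid_norm_dilate_ge Mn Mm p0 fg).
move=> n nS.
have -> : (fun q => dilate n (dilate p f) q - lam n * dilate p f q) =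
    dilate p (fun q => dilate n f q - lam n * f q).
  by rewrite dilateC.
have gg : gridded (fun q => dilate n f q - lam n * f q).
  have := griddedD 1 (- lam n) (gridded_dilate (S0 _ nS) fg) fg.
  by under [X in gridded X]eq_fun do rewrite mul1r mulNr.
apply: le_trans (grid_norm_dilate_le Mn p0 gg) _.
rewrite -mulrA ler_wpM2l //; apply: le_trans (fe n nS) _.
by rewrite ler_wpM2l // grid_norm_dilate_ge.
Qed.

Lemma approx_eigen_le S lam d d' f : d <= d' -> approx_eigen S lam d f ->
  approx_eigen S lam d' f.
Proof.
move=> dd' [fg f0 fpos fe]; split=> // n nS.
by apply: le_trans (fe n nS) _; rewrite ler_wpM2r // ltW.
Qed.

(* [r] is the growth rate of the powers of the dilation by m on the vectors that
   are nearly eigen for the dilations in S.  On y = sum_k v_k T^k f with weights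
   of slope slightly above 1/r up to K and slightly below afterwards, T acts
   almost as r. *)
Lemma approx_eigen_step S lam m : all (ltn 0) S -> (0 < m)%N ->
  (forall d, 0 < d -> exists f, approx_eigen S lam d f) ->
  exists r, forall d, 0 < d -> exists2 f, approx_eigen S lam d f &
    nm (fun q => dilate m f q - r * f q) <= d * nm f.
Proof.
move=> S0 m0 SE.
pose t k f := dilate (m ^ k) f.
have tg k f : gridded f -> gridded (t k f).
  by apply: gridded_dilate; rewrite expn_gt0 m0.
have tE k d f : 0 <= d -> approx_eigen S lam d f ->
    approx_eigen S lam (m%:R ^+ k * d) (t k f).
  move=> d0 fE; rewrite -natrX; apply: approx_eigen_dilate => //.
  by rewrite expn_gt0 m0.
have tS k f : dilate m (t k f) = t k.+1 f by rewrite /t dilateM expnSr.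
have m1 : 1 <= m%:R :> R by rewrite ler1n.
(* The eigenvector may depend on [k] and [d]. Hence the failure of a rate above the supremum yields
   one exponent and one tolerance for which all eigenvectors grow more slowly. *)
pose B := [set mu : R | 0 < mu /\ forall k d, 0 < d ->
  exists2 f, approx_eigen S lam d f & mu ^+ k * nm f <= nm (t k f)].
have B1 : B 1.
  split=> // k d /SE[f fE]; exists f => //; rewrite expr1n mul1r.
  by apply: grid_norm_dilate_ge => //; [rewrite expn_gt0 m0|case: fE].
have Bm : ubound B m%:R.
  move=> mu [mu0 /(_ 1%N 1 ltr01)[f [fg f0 fpos _]]]; rewrite expr1 /t expn1 => h.
  by have := le_trans h (grid_norm_dilate_le Mn m0 fg); rewrite ler_pM2r.
have Bs : has_sup B by split; [exists 1|exists m%:R].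
pose r := sup B.
have r1 : 1 <= r by apply: sup_upper_bound.
have rm : r <= m%:R by apply: ge_sup => //; exists 1.
exists r => d0 d0p.
(* The final estimate has three error terms, each at most m d times the norm of [y] because r <= m.
   The minimum with 1 keeps 1 - d positive. *)
pose d := Num.min d0 1 / (3 * m%:R).
have dp : 0 < d.
  by rewrite divr_gt0 ?mulr_gt0 ?(lt_le_trans ltr01 m1) // lt_min d0p ltr01.
have d3 : 3 * m%:R * d <= d0.
  rewrite /d mulrC divfK ?ge_min ?lexx //.
  by rewrite mulf_neq0 // gt_eqF // (lt_le_trans ltr01 m1).
have d1 : d <= 1 / 3.
  rewrite /d ler_pdivrMr; last by rewrite mulr_gt0 // (lt_le_trans ltr01 m1).
  have : Num.min d0 1 <= 1 by rewrite ge_min lexx orbT.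
  by move: m1; lra.
have r0 : 0 < r by apply: lt_le_trans ltr01 r1.
pose a := r * (1 - d); pose b := r * (1 + d).
have a0 : 0 < a by rewrite /a mulr_gt0 //; lra.
have b0 : 0 < b by rewrite /b mulr_gt0 //; lra.
(* As [mu] is above [a], there are eigenvectors growing faster than the powers of [a]; for [K]
   large, the term v_K T^K f outweighs [f] by the factor 1 / d. *)
have [mu [mu0 muB] muS] : exists2 mu, B mu & r * (1 - d / 2) < mu.
  have /sup_adherent : 0 < r * (d / 2) by rewrite mulr_gt0 //; lra.
  move=> /(_ _ Bs)[x Bx xr]; exists x => //.
  by move: xr; rewrite -/r; lra.
have [K Kd] : exists K, d^-1 <= (mu / a) ^+ K.
  apply: expr_unbounded; rewrite ltr_pdivlMr // mul1r; apply: lt_trans muS.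
  by rewrite /a ltr_pM2l //; lra.
(* Strictly between [r] and [b]: too large to lie in [B], yet small enough to be beaten by the
   weights after [K]. *)
pose mu' := r * (1 + d / 2).
have mu'0 : 0 < mu' by rewrite /mu' mulr_gt0 //; lra.
have [k0 [d1' [d1p mu'B]]] : exists k d, 0 < d /\ forall f, approx_eigen S lam d f ->
    nm (t k f) < mu' ^+ k * nm f.
  apply: contrapT => /forallNP H.
  have : B mu'.
    split=> // k e e0; apply: contrapT => H'; apply: (H k); exists e; split=> //.
    move=> f fE; rewrite ltNge; apply/negP => h; apply: H'; by exists f.
  move=> /(sup_upper_bound Bs); rewrite -/r /mu' leNgt => /negP; apply.
  by rewrite ltr_pMr // ltrDl; lra.
have k0p : (0 < k0)%N.
  rewrite lt0n; apply/eqP => k00; move: mu'B; rewrite k00.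
  have [f fE] := SE _ d1p; move=> /(_ f fE).
  by rewrite expr0 mul1r (_ : t 0%N f = f) ?ltxx // /t /dilate;
    apply/funext => q; rewrite expn0 mul1r.
have mX j : 0 < m%:R ^+ j :> R by rewrite exprn_gt0 // ltr0n.
(* The bound for [k0] is applied [j] times. T^(k0 i) f must still be an eigenvector up to [d1'] at
   each stage, hence the stricter tolerance on [f]. *)
have iter_mu' j f : approx_eigen S lam (d1' / m%:R ^+ (k0 * j)) f ->
    nm (t (k0 * j)%N f) <= mu' ^+ (k0 * j) * nm f.
  elim: j => [|j IH] fE.
    rewrite muln0 expr0 mul1r (_ : t 0%N f = f) // /t /dilate.
    by apply/funext => q; rewrite expn0 mul1r.
  have fE' : approx_eigen S lam (d1' / m%:R ^+ (k0 * j)) f.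
    apply: approx_eigen_le fE; rewrite ler_pM2l // lef_pV2 ?posrE //.
    by rewrite ler_weXn2l // mulnS leq_addl.
  have : approx_eigen S lam d1' (t (k0 * j)%N f).
    apply: approx_eigen_le (tE (k0 * j)%N _ _ _ fE').
      by rewrite mulrC divfK // gt_eqF.
    by rewrite divr_ge0 // ltW.
  move=> /mu'B; rewrite (_ : t k0 _ = t (k0 * j.+1)%N f); last first.
    by rewrite /t dilateM -expnD addnC mulnS.
  move=> /ltW /le_trans; apply; rewrite mulnS exprD -mulrA ler_wpM2l //.
    by rewrite exprn_ge0 // ltW.
  exact: IH.
(* The ratio v_k / v_(k+1) is [a] before [K] and [b] from there on. *)
pose v k := (a ^+ minn k K * b ^+ (k - K))^-1.
have v00 : v 0%N = 1 by rewrite /v min0n sub0n !expr0 mul1r invr1.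
have vp k : 0 < v k by rewrite invr_gt0 mulr_gt0 // exprn_gt0.
have vd k : `|v k - r * v k.+1| <= r * d * v k.+1.
  have [kK|Kk] := ltnP k K.
    have -> : v k = a * v k.+1.
      rewrite /v (minn_idPl (ltnW kK)) (minn_idPl kK) exprS.
      have /eqP -> : (k - K == 0)%N by rewrite subn_eq0 ltnW.
      have /eqP -> : (k.+1 - K == 0)%N by rewrite subn_eq0.
      by rewrite !mulr1 invfM mulrA mulfV ?mul1r // gt_eqF.
    rewrite -mulrBl normrM (gtr0_norm (vp _)) ler_wpM2r ?(ltW (vp _)) //.
    by rewrite /a ler_norml; nra.
  have -> : v k = b * v k.+1.
    rewrite /v (minn_idPr Kk) (minn_idPr (leqW Kk)) subSn // exprS.
    by rewrite [in RHS]mulrCA [in RHS]invfM mulrA mulfV ?mul1r // gt_eqF.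
  rewrite -mulrBl normrM (gtr0_norm (vp _)) ler_wpM2r ?(ltW (vp _)) //.
  by rewrite /b ler_norml; nra.
have bmu' : 1 < b / mu'.
  by rewrite ltr_pdivlMr // mul1r /b /mu' ltr_pM2l //; lra.
(* A power of b / mu' absorbs the constant b^(K+1) / a^K, which makes the boundary term v_p T^P f
   small. [P] is a multiple of [k0], as [iter_mu'] requires. *)
have [j jd] := expr_unbounded (b ^+ K.+1 / a ^+ K / d) bmu'.
pose P := (k0 * (K.+1 + j))%N.
have KP : (K < P)%N by rewrite (leq_trans _ (leq_pmull _ k0p)) // leq_addr.
have [p Pp] : exists p, P = p.+1 by case: P KP => // p; exists p.
have vP : v p * mu' ^+ P <= d.
  have -> : v p = b ^+ K.+1 / a ^+ K / b ^+ P.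
    have Kp : (K <= p)%N by rewrite -ltnS -Pp.
    rewrite /v (minn_idPr Kp) Pp -{2}(subnK Kp) -addnS exprD.
    have : a ^+ K != 0 by rewrite expf_neq0 // gt_eqF.
    have : b ^+ K.+1 != 0 by rewrite expf_neq0 // gt_eqF.
    have : b ^+ (p - K) != 0 by rewrite expf_neq0 // gt_eqF.
    move: (b ^+ (p - K)) (b ^+ K.+1) (a ^+ K) => x z w x0 z0 w0.
    by field; rewrite x0 z0.
  rewrite (_ : _ * mu' ^+ P = (b ^+ K.+1 / a ^+ K) / (b / mu') ^+ P); last first.
    by rewrite expr_div_n invfM invrK mulrA.
  rewrite ler_pdivrMr ?exprn_gt0 ?(lt_trans ltr01 bmu') //.
  rewrite -ler_pdivrMl // mulrC; apply: le_trans jd _.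
  apply: ler_weXn2l; first exact: ltW.
  apply: leq_trans (leq_addl K.+1 j) _.
  by rewrite /P leq_pmull.
(* T^k multiplies the defect of [f] by at most m^k, so [V] is the resulting factor for [y]. *)
pose V := \sum_(k < P) v k * m%:R ^+ k.
have V0 : 0 < V.
  rewrite /V Pp big_ord_recl /= v00 expr0 mulr1 ltr_wpDr // sumr_ge0 // => k _.
  by rewrite mulr_ge0 // ltW.
have [f fE fK] := muB K (Num.min (d1' / m%:R ^+ P) (d0 / V))
  (ltac:(by rewrite lt_min !divr_gt0)).
have fE1 : approx_eigen S lam (d1' / m%:R ^+ P) f.
  by apply: approx_eigen_le fE; rewrite ge_min lexx.
have fE2 : approx_eigen S lam (d0 / V) f.
  by apply: approx_eigen_le fE; rewrite ge_min lexx orbT.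
have [fg f0 fpos fe] := fE2.
pose y q := \sum_(k < P) v k * t k f q.
have [yg _] := grid_norm_sum Mn P v (fun k => tg k f fg).
have t0 k q : 0 <= t k f q by exact: f0.
have y0 q : 0 <= y q by apply: sumr_ge0 => k _; rewrite mulr_ge0 // ltW.
have y_ge k : (k < P)%N -> v k * nm (t k f) <= nm y.
  move=> kP; rewrite -{1}(gtr0_norm (vp k)) -(grid_normZ Mn _ (tg k f fg)).
  apply: grid_norm_monotone => //; first exact: griddedZ (tg _ _ fg).
  move=> q; rewrite !ger0_norm ?mulr_ge0 ?(ltW (vp _)) //.
  rewrite /y (bigD1 (Ordinal kP)) //= lerDl sumr_ge0 // => i _.
  by rewrite mulr_ge0 // ltW.
have tf0 : t 0%N f = f.
  by rewrite /t /dilate; apply/funext => q; rewrite expn0 mul1r.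
have fy : nm f <= nm y.
  have := y_ge 0%N; rewrite v00 mul1r tf0; apply.
  by rewrite Pp.
have fy2 : nm f <= d * nm y.
  rewrite -ler_pdivrMl //; apply: le_trans (y_ge K KP).
  apply: le_trans (ler_wpM2r (grid_norm_ge0 Mn f) Kd) _.
  rewrite expr_div_n mulrAC mulrC /v minnn subnn expr0 mulr1.
  by rewrite ler_wpM2l // invr_ge0 exprn_ge0 // ltW.
have ypos : 0 < nm y := lt_le_trans fpos fy.
exists y.
  split=> // n nS; have n0 : (0 < n)%N := allP S0 _ nS.
  pose g q := dilate n f q - lam n * f q.
  have gg : gridded g.
    have := griddedD 1 (- lam n) (gridded_dilate n0 fg) fg.
    by under [X in gridded X]eq_fun do rewrite mul1r mulNr.
  have -> : (fun q => dilate n y q - lam n * y q) =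
      (fun q => \sum_(k < P) v k * t k g q).
    apply/funext => q; rewrite /dilate /y mulr_sumr -sumrB.
    apply: eq_bigr => k _; rewrite mulrCA -mulrBr; congr (_ * _).
    by rewrite /g /t /dilate; congr (f _ - _); rewrite mulrCA.
  have [_ /le_trans] := grid_norm_sum Mn P v (fun k => tg k g gg); apply.
  apply: (@le_trans _ _ (\sum_(k < P) v k * m%:R ^+ k * (d0 / V * nm y))).
    apply: ler_sum => k _; rewrite gtr0_norm // -mulrA ler_wpM2l ?(ltW (vp k)) //.
    have mk0 : (0 < m ^ k)%N by rewrite expn_gt0 m0.
    apply: le_trans (grid_norm_dilate_le Mn mk0 gg) _.
    rewrite natrX ler_wpM2l ?(ltW (mX k)) //; apply: le_trans (fe n nS) _.
    by rewrite ler_wpM2l // divr_ge0 // ltW.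
  by rewrite -mulr_suml -/V mulrA [V * _]mulrC divfK // gt_eqF.
(* The pointwise majorant of T y - r y given by [two_slope_sum]. *)
pose h q := 1 * (r * d * y q + r * f q) + v p * t P f q.
have hg1 : gridded (fun q => r * d * y q + r * f q) by exact: griddedD.
apply: (@le_trans _ _ (nm h)).
  apply: grid_norm_monotone => //.
  - have := griddedD 1 (- r) (gridded_dilate m0 yg) yg.
    by under [X in gridded X]eq_fun do rewrite mul1r mulNr.
  - by apply: griddedD => //; exact: tg.
  move=> q; rewrite [leRHS]ger0_norm; last first.
    have rd0 : 0 <= r * d := mulr_ge0 (ltW r0) (ltW dp).
    rewrite /h mul1r; apply: addr_ge0; last exact: mulr_ge0 (ltW (vp p)) (t0 P q).
    by apply: addr_ge0; apply: mulr_ge0 => //; exact: ltW.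
  have := @two_slope_sum v (fun k => t k f q) r (r * d) p v00
    (fun k => ltW (vp k)) (fun k => t0 k q) (ltW r0)
    (mulr_ge0 (ltW r0) (ltW dp)) vd.
  rewrite tf0 /h mul1r /y Pp; congr (`|_ - _| <= _).
  rewrite /dilate; apply: eq_bigr => k _; congr (_ * _).
  by rewrite -tS.
apply: le_trans (grid_normD Mn _ _ hg1 (tg P f fg)) _.
rewrite normr1 mul1r (gtr0_norm (vp p)).
have h1 := grid_normD Mn (r * d) r yg fg.
rewrite (gtr0_norm r0) (gtr0_norm (mulr_gt0 r0 dp)) in h1.
have h2 : v p * nm (t P f) <= d * nm y.
  apply: (@le_trans _ _ (v p * (mu' ^+ P * nm f))).
    by rewrite ler_wpM2l ?(ltW (vp p)) // iter_mu'.
  by rewrite mulrA; apply: ler_pM => //; rewrite ?mulr_ge0 ?exprn_ge0 ?ltW.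
have h3 : r * nm f <= m%:R * (d * nm y).
  by apply: ler_pM => //; rewrite ltW.
have h4 : r * d * nm y <= m%:R * (d * nm y).
  by rewrite -mulrA ler_wpM2r // mulr_ge0 // ltW.
have h5 : d * nm y <= m%:R * (d * nm y).
  by rewrite ler_peMl // mulr_ge0 // ltW.
have h6 : 3 * m%:R * d * nm y <= d0 * nm y by rewrite ler_wpM2r // ltW.
by move: h1 h2 h3 h4 h5 h6; lra.
Qed.

End approximate_eigenvectors.

(** * Blocks along common approximate eigenvectors *)

Section block_model.
Context {R : realType}.
Implicit Types (M : seq R -> R) (u v w : seq R) (a b : R).

Lemma wn_normr M u a v : word_monotone M -> M (u ++ `|a| :: v) = M (u ++ a :: v).
Proof.
move=> Mm; apply/eqP; rewrite eq_le !Mm //.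
  by elim: u => [|b u IH] /=; rewrite ?normr_id lexx //=;
     elim: v => //= b v ->; rewrite lexx.
by elim: u => [|b u IH] /=; rewrite ?normr_id lexx //=;
     elim: v => //= b v ->; rewrite lexx.
Qed.

Lemma wn_dist1 M u a b v : word_norm M -> M [:: 1] = 1 ->
  `|M (u ++ a :: v) - M (u ++ b :: v)| <= `|a - b|.
Proof.
move=> Mn M1; have := @wn_dist_mid _ _ Mn u v [:: a] [:: b] erefl.
by rewrite wadd_cons mulN1r (wn1 Mn) M1 mulr1.
Qed.

Lemma all2_cat (r : rel R) s1 s2 t1 t2 : size s1 = size t1 ->
  all2 r (s1 ++ s2) (t1 ++ t2) = all2 r s1 t1 && all2 r s2 t2.
Proof. by elim: s1 t1 => [|x s1 IH] [|y t1] //= [st]; rewrite IH // andbA. Qed.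

Lemma word_monotone_blowup M x (c : R) : 0 <= c -> word_monotone M ->
  word_monotone (fun w => c * M (blowup x w)).
Proof.
move=> c0 Mm u v uv; rewrite ler_wpM2l //; apply: Mm.
elim: u v uv => [|a u IH] [|b v] //= /andP[ab uv].
rewrite !blowup_cons all2_cat ?size_wscale // IH // andbT.
by elim: x {IH} => //= p x ->; rewrite !normrM ler_wpM2r.
Qed.

Variables (M : seq R -> R) (Mn : word_norm M) (Mm : word_monotone M).
Hypothesis M1 : M [:: 1] = 1.

Lemma approx_eigen_exists N : exists lam, forall d, 0 < d ->
  exists f, approx_eigen M (iota 1 N) lam d f.
Proof.
elim: N => [|N [lam lamP]].
  (* No dilation is tested yet; the indicator of the integers encodes the one-letter word. *)
  exists (fun=> 0) => d d0; pose f (q : rat) : R := (q \is a Num.int)%:R.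
  have f1 : on_grid 1 f.
    split=> // q; first by rewrite /f rpredDr // rpred1.
    by rewrite /f mulr1; case: (q \is a Num.int) => //; rewrite eqxx.
  exists f; split=> //; first by exists 1%N.
  rewrite (grid_normE Mn f1) /grid /= mul0r.
  by rewrite /f rpred0 M1 ltr01.
have S0 : all (ltn 0) (iota 1 N).
  by apply/allP => n; rewrite mem_iota => /andP[].
have [r rP] := approx_eigen_step Mn Mm S0 (ltn0Sn N) lamP.
exists (fun n => if n == N.+1 then r else lam n) => d /rP[f [fg f0 fpos fe] fr].
exists f; split=> // n; rewrite -[X in iota _ X]addn1 iotaD mem_cat add1n inE.
case: eqP => [-> _|_]; first exact: fr.
by rewrite orbF; exact: fe.
Qed.

(** Along the block [x] read off from [f], the word [nseq n a] becomes [a] times [dilate n f], and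
    the letter [lam n * a] becomes that multiple of [f], spread by zeros over the same finer grid.
    The difference is [a] times the defect of the eigenvector. *)
Lemma approx_eigen_word S lam d f : all (ltn 0) S -> approx_eigen M S lam d f ->
  exists x c, [/\ 0 <= c, c * M (blowup x [:: 1]) = 1 &
    forall n u a v, n \in S ->
    `|c * M (blowup x (u ++ nseq n a ++ v)) - c * M (blowup x (u ++ lam n * a :: v))|
       <= d * `|a|].
Proof.
move=> S0 [[e fe] f0 fpos fS].
exists (map f (grid e)), (grid_norm M f)^-1.
have c0 : 0 <= (grid_norm M f)^-1 by rewrite invr_ge0 ltW.
split=> // [|n u a v nS].
  by rewrite blowup_cons cats0 wscale1 -(grid_normE Mn fe) mulVf // gt_eqF.
have n0 : (0 < n)%N := allP S0 _ nS.
rewrite !blowup_cat blowup_cons -mulrBr normrM (ger0_norm c0).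
rewrite ler_pdivrMl //.
set U := blowup _ u; set V := blowup _ v; set w := map f _.
have -> : blowup w (nseq n a) = wscale a (map (dilate n f) (grid (n * e))).
  rewrite (map_dilate n0 fe).
  elim: {n0 nS} n => // n IH; rewrite [nseq _ _]/= blowup_cons IH.
  by rewrite [nseq n.+1 _]/= -[flatten (_ :: _)]/(w ++ _) wscale_cat.
have -> : M (U ++ wscale (lam n * a) w ++ V) =
    M (U ++ wscale (lam n * a) (map f (grid (n * e))) ++ V).
  rewrite mulnC (map_grid_mul n0 fe) wscale_stretch.
  by rewrite (wn_stretch Mn).
have sz : size (wscale a (map (dilate n f) (grid (n * e)))) =
    size (wscale (lam n * a) (map f (grid (n * e)))).
  by rewrite !size_wscale !size_map.
apply: le_trans (wn_dist_mid Mn U V sz) _.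
pose g q := dilate n f q - lam n * f q.
have eg : on_grid (n * e) g.
  have fne : on_grid (n * e) f by rewrite mulnC; exact: on_grid_mul.
  have := on_gridD 1 (- lam n) (on_grid_dilate n0 fe) fne.
  by under [X in on_grid _ X]eq_fun do rewrite mul1r mulNr.
have -> : wadd (wscale a (map (dilate n f) (grid (n * e))))
    (wscale (-1) (wscale (lam n * a) (map f (grid (n * e))))) =
    wscale a (map g (grid (n * e))).
  rewrite wscaleA (_ : -1 * (lam n * a) = a * - lam n); last by ring.
  rewrite -wscaleA -wscale_wadd; congr wscale.
  rewrite -[wscale (- lam n) _](map_comp ( *%R (- lam n)) f) wadd_map.
  apply: eq_map => q /=.
  by rewrite /g mulNr.
rewrite (wnZ Mn) -(grid_normE Mn eg).
have := ler_wpM2l (normr_ge0 a) (fS n nS); congr (_ <= _).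
by rewrite mulrC mulrAC mulrC mulrA.
Qed.

(** The N-th norm uses blocks along an eigenvector for the first N dilations with tolerance 1 / (N +
    1). Its eigenvalues depend on N and are not known to converge beforehand; the approximate
    relation on the word [nseq n 1] itself forces their absolute values towards [K (nseq n 1)]. *)
Lemma block_model (X : normedModType R) : word_fr X M ->
  exists K, [/\ word_norm K, word_fr X K, word_monotone K, K [:: 1] = 1 &
    forall u n a v, K (u ++ nseq n a ++ v) = K (u ++ K (nseq n 1) * a :: v)].
Proof.
move=> Mfr; have [U [UU Uoo]] := free_ultrafilter.
have H N : exists (xc : seq R * R) (lam : nat -> R), [/\ 0 <= xc.2,
    xc.2 * M (blowup xc.1 [:: 1]) = 1 &
    forall n u a v, n \in iota 1 N ->
    `|xc.2 * M (blowup xc.1 (u ++ nseq n a ++ v)) -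
      xc.2 * M (blowup xc.1 (u ++ lam n * a :: v))| <= N.+1%:R^-1 * `|a|].
  have [lam lamP] := approx_eigen_exists N.
  have [|f fP] := lamP N.+1%:R^-1; first by rewrite invr_gt0.
  have S0 : all (ltn 0) (iota 1 N).
    by apply/allP => n; rewrite mem_iota => /andP[].
  have [x [c [c0 c1 cP]]] := approx_eigen_word S0 fP.
  by exists (x, c), lam.
have [xc /choice[lam xcP]] := choice H.
pose L N w := (xc N).2 * M (blowup (xc N).1 w).
have c0 N : 0 <= (xc N).2 by have [] := xcP N.
have Ln N : word_norm (L N) := word_norm_blowup Mn _ (c0 N).
have L1 N : L N [:: 1] = 1 by have [] := xcP N.
have Lm N : word_monotone (L N) := word_monotone_blowup _ (c0 N) Mm.
have Lfr N : word_fr X (L N) := word_fr_blowup _ (c0 N) Mfr.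
have L1' N : L N [:: 1] <= 1 by rewrite L1.
have Llam N n u a v : (0 < n <= N)%N ->
    `|L N (u ++ nseq n a ++ v) - L N (u ++ lam N n * a :: v)| <= N.+1%:R^-1 * `|a|.
  by move=> nN; have [_ _] := xcP N; apply; rewrite mem_iota add1n ltnS.
exists (word_limit U L).
have Kn := word_limit_norm (UU := UU) Ln L1'.
have K1 : word_limit U L [:: 1] = 1.
  by rewrite /word_limit -[RHS](ulim_cst (U := U)); congr ulim; apply/funext.
split=> //; first exact: word_fr_limit Ln L1' Lfr.
  move=> u v uv; apply: (word_limit_le Ln L1'); near=> N; exact: Lm.
move=> u [|n] a v.
  by rewrite /= (wn_nil Kn) mul0r (wn0 Kn).
set phi := word_limit U L (nseq n.+1 1).
have phi0 : 0 <= phi by exact: wn_ge0 Kn _.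
apply/eqP; rewrite -subr_eq0 -normr_le0; apply/ler_addgt0Pr => e e0.
rewrite add0r.
have [e' e'0 e'E] : exists2 e', 0 < e' & 4 * e' + 4 * (e' * `|a|) = e.
  have a1 : 0 < 1 + `|a| by apply: ltr_wpDr.
  exists (e / (4 * (1 + `|a|))); first by rewrite divr_gt0 // mulr_gt0.
  by field; rewrite gt_eqF.
have h1 := word_limitP (UU := UU) Ln L1' (u ++ nseq n.+1 a ++ v) e'0.
have h2 := word_limitP (UU := UU) Ln L1' (u ++ phi * a :: v) e'0.
have h3 := word_limitP (UU := UU) Ln L1' (nseq n.+1 1) e'0.
have h4 : \forall N \near U, (n < N)%N by apply: Uoo; exact: nbhs_infty_gt.
have h5 : \forall N \near U, N.+1%:R^-1 <= e'.
  by apply: Uoo; apply: filterS (near_infty_natSinv_lt (PosNum e'0)) => N /ltW.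
have [N [{}h1 {}h2 {}h3 nN Ne]] : exists N,
    [/\ `|L N (u ++ nseq n.+1 a ++ v) - word_limit U L (u ++ nseq n.+1 a ++ v)| <= e',
        `|L N (u ++ phi * a :: v) - word_limit U L (u ++ phi * a :: v)| <= e',
        `|L N (nseq n.+1 1) - phi| <= e', (n < N)%N & N.+1%:R^-1 <= e'].
  apply: (@filter_ex _ U).
  by near=> N; split; near: N.
have nN' : (0 < n.+1 <= N)%N by [].
have g1 := Llam N n.+1 u a v nN'.
have g2 := Llam N n.+1 [::] 1 [::] nN'.
rewrite !cat0s cats0 mulr1 (wn1 (Ln N)) L1 mulr1 normr1 mulr1 in g2.
(* Only the absolute value of the eigenvalue is controlled by [g2]; monotonicity allows its sign to
   be dropped. *)
have g3 : L N (u ++ lam N n.+1 * a :: v) = L N (u ++ `|lam N n.+1| * a :: v).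
  by rewrite -(wn_normr _ (lam N n.+1 * a)) // -(wn_normr _ (_ * a)) // !normrM normr_id.
have g4 := wn_dist1 u (`|lam N n.+1| * a) (phi * a) v (Ln N) (L1 N).
rewrite -mulrBl normrM -g3 in g4.
have g5 : `| `|lam N n.+1| - phi| <= 2 * e'.
  by move: g2 h3 Ne; rewrite !ler_norml; move: (_^-1) => i; lra.
have g6 : `| `|lam N n.+1| - phi| * `|a| <= 2 * e' * `|a| by rewrite ler_wpM2r.
have g7 : N.+1%:R^-1 * `|a| <= e' * `|a| by rewrite ler_wpM2r.
have ea : 0 <= e' * `|a| by rewrite mulr_ge0 // ltW.
move: h1 h2 g1 g4 g6 g7 e'E; rewrite !ler_norml; move: (_^-1) => i.
by lra.
Unshelve. all: by end_near. Qed.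

End block_model.

(** * Identification of the norm *)

Section lp_model.
Context {R : realType}.
Variables (K : seq R -> R) (Kn : word_norm K) (Km : word_monotone K).
Hypothesis K1 : K [:: 1] = 1.
Let phi n := K (nseq n 1).
Hypothesis KP : forall u n a v,
  K (u ++ nseq n a ++ v) = K (u ++ phi n * a :: v).
Implicit Types (u v w : seq R) (a b : R).

Lemma phi_ge0 n : 0 <= phi n.
Proof. exact: wn_ge0. Qed.

Lemma phi0 : phi 0 = 0.
Proof. exact: wn_nil. Qed.

Lemma K_nseq n a : 0 <= a -> K (nseq n a) = phi n * a.
Proof.
move=> a0; have := KP [::] n a [::]; rewrite cats0 !cat0s => ->.
by rewrite (wn1 Kn) K1 mulr1 ger0_norm // mulr_ge0 // phi_ge0.
Qed.

Lemma K_flatten (s : seq (nat * R)) u :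
  K (u ++ flatten [seq nseq p.1 p.2 | p <- s]) =
  K (u ++ [seq phi p.1 * p.2 | p <- s]).
Proof.
by elim: s u => //= p s IH u; rewrite KP -!cat_rcons IH.
Qed.

Lemma phiM n m : phi (n * m) = phi n * phi m.
Proof.
rewrite -(K_nseq n (phi_ge0 m)) /phi.
have := K_flatten (nseq n (m, 1)) [::].
rewrite /= !map_nseq /= mulr1 => <-; congr K.
elim: n => // n IH; by rewrite mulSn nseqD IH.
Qed.

Lemma phiX n k : phi (n ^ k) = phi n ^+ k.
Proof. by elim: k => [|k IH]; rewrite ?expn0 // expnS phiM IH exprS. Qed.

Lemma phi_le n m : (n <= m)%N -> phi n <= phi m.
Proof.
move=> nm; rewrite /phi -(subnKC nm) nseqD.
have <- : K (nseq n 1 ++ nseq (m - n) 0) = K (nseq n 1).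
  by have := wn_nseq0 Kn (nseq n 1) (m - n) [::]; rewrite !cats0.
apply: Km; move: (m - n)%N => k {nm}; elim: n => [|n IH] /=; last by rewrite lexx.
by elim: k => //= k ->; rewrite normr0 normr1 ler01.
Qed.

Lemma phi_ge1 n : (0 < n)%N -> 1 <= phi n.
Proof. by rewrite -[leLHS]K1 => n0; exact: (@phi_le 1). Qed.

Lemma phi_le_nat n : phi n <= n%:R.
Proof.
apply: le_trans (wn_bound Kn _) _; rewrite K1 mulr1.
elim: n => [|n IH]; first by rewrite big_nil.
by rewrite /= big_cons normr1 -natr1 addrC lerD2r.
Qed.

(** The exponent is read off at 2, and 1 <= phi 2 <= 2 places it in [0, 1]. *)
Lemma phi_powR : exists2 alpha : R, 0 <= alpha <= 1 &
  forall n, (0 < n)%N -> phi n = n%:R `^ alpha.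
Proof.
have ln2 : 0 < ln (2 : R) by rewrite ln_gt0 // ltr1n.
have p2 : 1 <= phi 2 by exact: phi_ge1.
have p20 : 0 < phi 2 := lt_le_trans ltr01 p2.
exists (ln (phi 2) / ln 2).
  apply/andP; split; first by rewrite divr_ge0 ?(ltW ln2) // ln_ge0.
  rewrite ler_pdivrMr // mul1r.
  by rewrite ler_ln ?posrE //; exact: phi_le_nat.
move=> n n0; set alpha := _ / _.
have al2 : alpha * ln 2 = ln (phi 2) by rewrite /alpha divfK // gt_eqF.
have a0 : 0 <= alpha by rewrite divr_ge0 ?(ltW ln2) // ln_ge0.
have n0' : 0 < n%:R :> R by rewrite ltr0n.
have pn0 : 0 < phi n := lt_le_trans ltr01 (phi_ge1 n0).
apply: ln_inj; rewrite ?posrE ?powR_gt0 // ln_powR.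
apply/eqP; rewrite -subr_eq0 -normr_le0.
(* Locate n ^ k between consecutive powers of 2. *)
apply: (@ler_archimean _ _ _ (ln (phi 2))) => k.
rewrite mulr0 add0r -(ger0_norm (ler0n R k)) -normrM mulrBr.
have nk : (0 < n ^ k)%N by rewrite expn_gt0 n0.
have /andP[] := trunc_log_bounds (isT : (1 < 2)%N) nk.
set j := trunc_log 2 _ => jn nj.
have lnat m i : (0 < m)%N -> ln ((m ^ i)%:R : R) = i%:R * ln m%:R.
  by move=> m0; rewrite natrX lnXn ?ltr0n // mulr_natl.
have lphi m i : (0 < m)%N -> ln (phi (m ^ i)) = i%:R * ln (phi m).
  move=> m0; rewrite phiX lnXn ?mulr_natl //.
  exact: lt_le_trans ltr01 (phi_ge1 m0).
have ln_mono (x y : R) : 1 <= x -> x <= y -> ln x <= ln y.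
  move=> x1 xy; have x0 := lt_le_trans ltr01 x1.
  by rewrite ler_ln ?posrE // (lt_le_trans x0).
have X2 i : (0 < 2 ^ i)%N by rewrite expn_gt0.
have h1 : j%:R * ln (phi 2) <= k%:R * ln (phi n).
  by rewrite -!lphi //; apply: ln_mono; [exact: phi_ge1|exact: phi_le].
have h2 : k%:R * ln (phi n) <= j.+1%:R * ln (phi 2).
  by rewrite -!lphi //; apply: ln_mono; [exact: phi_ge1|exact: phi_le (ltnW nj)].
have h3 : j%:R * ln 2 <= k%:R * ln n%:R :> R.
  by rewrite -!lnat //; apply: ln_mono; rewrite ?ler1n // ler_nat.
have h4 : k%:R * ln n%:R <= j.+1%:R * ln 2 :> R.
  by rewrite -!lnat //; apply: ln_mono; rewrite ?ler1n // ler_nat ltnW.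
have h5 := ler_wpM2l a0 h3; have h6 := ler_wpM2l a0 h4.
rewrite ![alpha * (_ * ln 2)]mulrCA al2 in h5 h6.
rewrite (mulrCA alpha) in h5; rewrite (mulrCA alpha) in h6.
rewrite -natr1 mulrDl mul1r in h2 h6.
by rewrite ler_norml; move: h1 h2 h5 h6; lra.
Qed.

Lemma K_letter_le u a v : `|a| <= K (u ++ a :: v).
Proof.
have -> : `|a| = K [:: a] by rewrite (wn1 Kn) K1 mulr1.
rewrite -(wn_mid Kn u [:: a] v); apply: Km.
elim: u => [|b u IH] /=; last by rewrite normr0 normr_ge0.
by rewrite lexx /=; elim: v => //= b v ->; rewrite normr0 normr_ge0.
Qed.

Lemma K_flat_max : (forall n, phi n <= 1) -> forall w, K w = word_max w.
Proof.
move=> phi1 w; apply/eqP; rewrite eq_le; apply/andP; split.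
  apply: (@le_trans _ _ (K (nseq (size w) (word_max w)))).
    apply: Km; have := word_max_ub w; have := word_max_ge0 w.
    move: (word_max w) => c c0; elim: w => //= a w IH /andP[ac wc].
    by rewrite (ger0_norm c0) ac IH.
  by rewrite K_nseq ?word_max_ge0 // ler_piMl // word_max_ge0.
apply: word_max_le; first exact: wn_ge0.
apply/allP => a /splitPr[u v]; exact: K_letter_le.
Qed.

(** A letter phi(m) D^(-alpha) stands for a run of m letters D^(-alpha). On words of such letters
    the norm is that of a constant word, and its p-th power is the total of the m divided by D.
    Rounding each D |a|^p down and up to integers encloses an arbitrary word between two of these,
    whose p-th powers differ by size w / D. *)
Lemma K_power_sum (alpha : R) : 0 < alpha ->
  (forall n, (0 < n)%N -> phi n = n%:R `^ alpha) ->
  forall w, K w = (\sum_(a <- w) `|a| `^ alpha^-1) `^ alpha.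
Proof.
move=> a0 phiE w; set p := alpha^-1; set S := \sum_(a <- w) _.
have p0 : 0 < p by rewrite invr_gt0.
have ap : alpha * p = 1 by rewrite mulfV // gt_eqF.
have pa : p * alpha = 1 by rewrite mulVf // gt_eqF.
have phiE' n : phi n = n%:R `^ alpha.
  by case: n => [|n]; [rewrite phi0 powR0 // gt_eqF|exact: phiE].
have S0 : 0 <= S by rewrite sumr_ge0 // => a _; exact: powR_ge0.
have pw x y : 0 <= x -> x <= y -> x `^ p <= y `^ p.
  move=> x0 xy; apply: ge0_ler_powR => //; rewrite ?nnegrE ?(ltW p0) //.
  exact: le_trans xy.
have aw x y : 0 <= x -> x <= y -> x `^ alpha <= y `^ alpha.
  move=> x0 xy; apply: ge0_ler_powR => //; rewrite ?nnegrE ?(ltW a0) //.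
  exact: le_trans xy.
suff : K w `^ p = S by move=> <-; rewrite -powRrM pa powRr1 // (wn_ge0 Kn).
have step (D : nat) (m : R -> nat) : (0 < D)%N ->
    K [seq phi (m a) * D%:R `^ (- alpha) | a <- w] `^ p =
    (\sum_(a <- w) (m a)%:R) / D%:R.
  move=> D0; have := K_flatten [seq (m a, D%:R `^ (- alpha)) | a <- w] [::].
  rewrite !cat0s -!map_comp /comp /= => <-.
  have -> : flatten [seq nseq (m a) (D%:R `^ (- alpha)) | a <- w] =
      nseq (\sum_(a <- w) m a) (D%:R `^ (- alpha)).
    by elim: w {S S0} => [|a w IH] /=; rewrite ?big_nil // big_cons nseqD IH.
  rewrite K_nseq ?powR_ge0 // phiE' powRM ?powR_ge0 // -!powRrM ap.
  by rewrite mulNr ap powRr1 ?ler0n // powR_inv1 // natr_sum.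
have D_bound (D : nat) : D%:R * `|K w `^ p - S| <= (size w)%:R.
  have [->|] := posnP D; first by rewrite mul0r.
  move=> D0; have D0' : 0 < D%:R :> R by rewrite ltr0n.
  pose m a := Num.truncn (D%:R * `|a| `^ p).
  have ma a : (m a)%:R <= D%:R * `|a| `^ p < (m a).+1%:R.
    by apply: truncn_itv; rewrite mulr_ge0 // powR_ge0.
  have DaE a : (D%:R * `|a| `^ p) `^ alpha = D%:R `^ alpha * `|a|.
    by rewrite powRM ?powR_ge0 // -powRrM pa powRr1.
  have DN : D%:R `^ alpha * D%:R `^ (- alpha) = 1 :> R.
    by rewrite powRN mulfV // gt_eqF // powR_gt0.
  have DNa a : D%:R `^ alpha * a * D%:R `^ (- alpha) = a.
    by rewrite mulrAC DN mul1r.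
  have lo : (\sum_(a <- w) (m a)%:R) / D%:R <= K w `^ p.
    rewrite -step //; apply: pw; first exact: wn_ge0.
    apply: Km; elim: w {S S0 step} => //= a w ->; rewrite andbT.
    rewrite ger0_norm ?mulr_ge0 ?phi_ge0 ?powR_ge0 // phiE'.
    rewrite -[`|a|]DNa ler_wpM2r ?powR_ge0 // -DaE.
    by apply: aw => //; case/andP: (ma a).
  have hi : K w `^ p <= (\sum_(a <- w) (m a).+1%:R) / D%:R.
    rewrite -(step D (fun a => (m a).+1)) //; apply: pw; first exact: wn_ge0.
    apply: Km; elim: w {S S0 step lo} => //= a w ->; rewrite andbT.
    rewrite [leRHS]ger0_norm ?mulr_ge0 ?phi_ge0 ?powR_ge0 // phiE'.
    rewrite -[`|a|]DNa ler_wpM2r ?powR_ge0 // -DaE.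
    by apply: aw; rewrite ?mulr_ge0 ?powR_ge0 // ltW //; case/andP: (ma a).
  have lo' : \sum_(a <- w) (m a)%:R <= D%:R * S.
    by rewrite mulr_sumr; apply: ler_sum => a _; case/andP: (ma a).
  have hi' : D%:R * S <= \sum_(a <- w) (m a).+1%:R.
    by rewrite mulr_sumr; apply: ler_sum => a _; apply: ltW; case/andP: (ma a).
  have sz : \sum_(a <- w) (m a).+1%:R = \sum_(a <- w) (m a)%:R + (size w)%:R :> R.
    under eq_bigr do rewrite -natr1; rewrite big_split /=; congr (_ + _).
    by rewrite big_const_seq count_predT iter_addr_0.
  rewrite ler_pdivrMr // in lo; rewrite ler_pdivlMr // in hi.
  rewrite -[X in X * _](gtr0_norm D0') -normrM mulrBr.
  by move: lo hi lo' hi'; rewrite sz ler_norml; lra.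
apply/eqP; rewrite -subr_eq0 -normr_le0.
by apply: (@ler_archimean _ _ _ (size w)%:R) => D; rewrite mulr0 add0r.
Qed.

Lemma c0_or_lp_model :
  (forall w, K w = word_max w) \/
  exists2 p : R, 1 <= p & forall w, K w = (\sum_(a <- w) `|a| `^ p) `^ p^-1.
Proof.
have [alpha /andP[a0 a1] phiE] := phi_powR.
have [a00|a00] := eqVneq alpha 0.
  left; apply: K_flat_max => -[|n]; first by rewrite phi0 ler01.
  by rewrite phiE // a00 powRr0.
have {}a0 : 0 < alpha by rewrite lt_neqAle eq_sym a00.
right; exists alpha^-1; first by rewrite invf_ge1.
by move=> w; rewrite invrK; exact: K_power_sum.
Qed.

End lp_model.

(** * Finite-dimensional subspaces *)

Section finite_dimensional_subspaces.
Context {R : realType}.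
Implicit Types (X : normedModType R) (u w : seq R) (a b : R).

Definition wsum w : R := \sum_(a <- w) `|a|.

Definition independent X (v : nat -> X) n :=
  forall w, size w = n -> comb v w = 0 -> w = nseq n 0.

Definition wspan X (v : nat -> X) n : set X :=
  [set x | exists2 w, size w = n & comb v w = x].

Lemma wsum_ge0 w : 0 <= wsum w.
Proof. exact: sumr_ge0. Qed.

Lemma wsum_wscale c w : wsum (wscale c w) = `|c| * wsum w.
Proof.
rewrite /wsum big_map mulr_sumr; apply: eq_bigr => a _.
exact: normrM.
Qed.

Lemma comb_le X (v : nat -> X) w b : (forall i, (i < size w)%N -> `|v i| <= b) ->
  `|comb v w| <= b * wsum w.
Proof.
elim: w v => [|a w IH] v vb.
  by rewrite comb_nil normr0 /wsum big_nil mulr0.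
rewrite comb_cons /wsum big_cons mulrDr.
apply: le_trans (ler_normD _ _) _; rewrite lerD //.
  by rewrite normrZ mulrC ler_wpM2r // vb.
by apply: IH => i iw; exact: vb.
Qed.

Lemma combB X (v : nat -> X) u w : size u = size w ->
  comb v (wadd u (wscale (-1) w)) = comb v u - comb v w.
Proof. by move=> uw; rewrite comb_wadd ?size_wscale // comb_wscale scaleN1r. Qed.

Lemma comb_zeros X (v : nat -> X) n : comb v (nseq n 0) = 0.
Proof.
elim: n v => [|n IH] v; first exact: comb_nil.
by rewrite /= comb_cons scale0r add0r IH.
Qed.

Definition unit_word n i : seq R := nseq i 0 ++ 1 :: nseq (n - i.+1) 0.

Lemma size_unit_word n i : (i < n)%N -> size (unit_word n i) = n.
Proof. by move=> ni; rewrite size_cat /= !size_nseq -addSnnS subnKC. Qed.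

Lemma comb_unit_word X (v : nat -> X) n i : comb v (unit_word n i) = v i.
Proof.
rewrite comb_cat comb_zeros add0r comb_cons comb_zeros addr0 scale1r size_nseq.
by rewrite addn0.
Qed.

Lemma comb_dist X (x y : nat -> X) w d : (forall i, `|x i - y i| <= d) ->
  `|comb x w - comb y w| <= d * wsum w.
Proof.
move=> xy; have -> : comb x w - comb y w = comb (fun i => x i - y i) w.
  by rewrite /comb -sumrB; apply: eq_bigr => i _; rewrite scalerBr.
exact: comb_le.
Qed.

Lemma small_dist (A : seq (seq R)) (e : R) : 0 < e ->
  exists2 d, 0 < d & forall w, w \in A -> d * wsum w <= e.
Proof.
move=> e0; pose W := 1 + \sum_(w <- A) wsum w.
have W0 : 0 < W by rewrite ltr_wpDr // sumr_ge0 // => w _; exact: wsum_ge0.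
exists (e / W); rewrite ?divr_gt0 // => w wA.
rewrite mulrAC ler_pdivrMr // ler_wpM2l ?(ltW e0) //.
rewrite /W (perm_big _ (perm_to_rem wA)) big_cons addrCA lerDl addr_ge0 //.
by rewrite sumr_ge0 // => u _; exact: wsum_ge0.
Qed.

Lemma wsum_close u w e : size u = size w ->
  (forall i, (i < size u)%N -> `|u`_i - w`_i| <= e) ->
  wsum (wadd u (wscale (-1) w)) <= e * (size u)%:R.
Proof.
elim: u w => [|a u IH] [|b w] //.
  by rewrite /wsum big_nil mulr0.
move=> [uw] h; rewrite wscale_cons wadd_cons mulN1r /wsum big_cons.
rewrite -[(size _)%:R]natr1 mulrDr mulr1 addrC lerD //; last exact: (h 0%N).
by apply: IH => // i iu; exact: (h i.+1).
Qed.

(** Compactness of the unit sphere of l_1^n: if words of [wsum] 1 have combinations tending to 0,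
    their coordinatewise ultralimit lies in the kernel, hence is zero, which contradicts the
    normalisation. *)
Lemma independent_lower_bound X (v : nat -> X) n : independent v n ->
  exists2 c, 0 < c & forall w, size w = n -> c * wsum w <= `|comb v w|.
Proof.
move=> vi; apply: contrapT => H.
have {H} : forall j : nat, exists w, [/\ size w = n, wsum w = 1 &
    `|comb v w| <= j.+1%:R^-1].
  move=> j; apply: contrapT => H'; apply: H; exists j.+1%:R^-1; first by rewrite invr_gt0.
  move=> w wn; rewrite leNgt; apply/negP => h; apply: H'.
  have w0 : wsum w != 0.
    by apply: contraTneq h => ->; rewrite mulr0 -leNgt.
  have w0' : 0 < wsum w by rewrite lt_neqAle eq_sym w0 wsum_ge0.
  exists (wscale (wsum w)^-1 w); split; first by rewrite size_wscale.
    by rewrite wsum_wscale gtr0_norm ?invr_gt0 // mulVf.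
  rewrite comb_wscale normrZ gtr0_norm ?invr_gt0 // ler_pdivrMl // mulrC.
  exact: ltW.
move=> /choice[w wP].
have [U [UU Uoo]] := free_ultrafilter.
have wle j i : `|(w j)`_i| <= 1.
  have [_ <- _] := wP j; have [iw|iw] := ltnP i (size (w j)); last first.
    by rewrite nth_default // normr0 wsum_ge0.
  rewrite /wsum (big_nth 0) big_mkord (bigD1 (Ordinal iw)) //= lerDl.
  exact: sumr_ge0.
pose l := mkseq (fun i => ulim U (fun j => (w j)`_i)) n.
have sl : size l = n by rewrite size_mkseq.
have close (e : R) : 0 < e -> \forall j \near U,
    forall i, (i < n)%N -> `|(w j)`_i - l`_i| <= e.
  move=> e0; rewrite /l {vi sl l}.
  have H m : (m <= n)%N -> \forall j \near U,
      forall i, (i < m)%N -> `|(w j)`_i - (mkseq (fun i => ulim U (fun j => (w j)`_i)) n)`_i| <= e.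
    elim: m => [_|m IH mn]; first by near=> j.
    have B : \forall j \near U, `|(w j)`_m| <= 1 by near=> j.
    apply: filterS2 (ulim_near e0 B) (IH (ltnW mn)) => j h1 h2 i.
    rewrite ltnS leq_eqVlt => /orP[/eqP ->|]; last exact: h2.
    by rewrite nth_mkseq.
  exact: H.
pose b := 1 + \sum_(i < n) `|v i|.
have vb i : (i < n)%N -> `|v i| <= b.
  move=> iN; rewrite /b (bigD1 (Ordinal iN)) //= addrCA lerDl.
  by rewrite addr_ge0 // sumr_ge0.
have b0 : 0 < b by rewrite ltr_wpDr // sumr_ge0.
have l0 : comb v l = 0.
  apply/eqP; rewrite -normr_le0; apply/ler_addgt0Pr => e e0; rewrite add0r.
  have [d d0 dE] : exists2 d, 0 < d & d * (1 + b * n%:R) = e.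
    have h : 0 < 1 + b * n%:R by rewrite ltr_wpDr // mulr_ge0 // ltW.
    by exists (e / (1 + b * n%:R)); rewrite ?divr_gt0 // divfK // gt_eqF.
  have h2 : \forall j \near U, j.+1%:R^-1 <= d.
    by apply: Uoo; apply: filterS (near_infty_natSinv_lt (PosNum d0)) => j /ltW.
  have [j [jd jc]] : exists j, j.+1%:R^-1 <= d /\
      forall i, (i < n)%N -> `|(w j)`_i - l`_i| <= d.
    apply: (@filter_ex _ U); apply: filterS2 h2 (close d d0) => j ? ?; by split.
  have [wn w1 wj] := wP j.
  have -> : comb v l = comb v (w j) - comb v (wadd (w j) (wscale (-1) l)).
    by rewrite combB ?wn // opprB addrC subrK.
  apply: le_trans (ler_normB _ _) _.
  rewrite -dE mulrDr mulr1 lerD ?(le_trans wj) //.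
  apply: le_trans (comb_le (b := b) _) _.
    by move=> i; rewrite size_wadd ?size_wscale ?wn //; exact: vb.
  rewrite mulrCA ler_wpM2l ?(ltW b0) // -wn; apply: wsum_close; first by rewrite wn.
  by rewrite wn.
have := vi l sl l0 => lz.
(* With n coordinates, each within 1 / (n + 1) of 0, the sum is at most n / (n + 1) < 1. *)
have n1 : 0 < (n.+1%:R : R)^-1 by rewrite invr_gt0.
have [j jc] := filter_ex (close _ n1).
have [wn w1 _] := wP j.
have : wsum (w j) <= n.+1%:R^-1 * n%:R.
  have := @wsum_close (w j) l n.+1%:R^-1; rewrite wn sl => /(_ erefl jc).
  by rewrite lz wscale_nseq mulr0 -{1}wn waddw0.
by rewrite w1 ler_pdivlMl // mulr1 ler_nat ltnn.
Unshelve. all: by end_near. Qed.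

Lemma comb_drop X (v : nat -> X) u w :
  comb v (u ++ 0 :: w) = comb (v \o bump (size u)) (u ++ w).
Proof.
have comb_eq (x y : nat -> X) p : (forall i, (i < size p)%N -> x i = y i) ->
    comb x p = comb y p.
  by move=> xy; apply: eq_bigr => i _; rewrite xy.
rewrite !comb_cat comb_cons scale0r add0r; congr (_ + _).
  by apply: comb_eq => i iu; rewrite /= /bump leqNgt iu.
by apply: comb_eq => i _; rewrite /= /bump leq_addr add1n addnS.
Qed.

(** The vector at a place where the relation has a nonzero coefficient [b] can be eliminated. *)
Lemma wspan_drop X (v : nat -> X) n w : size w = n.+1 -> comb v w = 0 ->
  w <> nseq n.+1 0 -> exists v', wspan v n.+1 = wspan v' n.
Proof.
move=> wn w0 wz.
have [p [b [q [b0 wE]]]] : exists p b q, b != 0 /\ w = p ++ b :: q.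
  apply: contrapT => H; apply: wz; rewrite -wn.
  elim: w H {wn w0} => //= a w IH H.
  have [a0|a0] := eqVneq a 0; last by exfalso; apply: H; exists [::], a, w.
  rewrite a0; congr (_ :: _); apply: IH => -[p [b [q [b0 wE]]]]; apply: H.
  by exists (a :: p), b, q; rewrite wE.
exists (v \o bump (size p)); rewrite eqEsubset; split=> x [u un <-].
  pose u' := wadd u (wscale (- (u`_(size p) / b)) w).
  have su' : size u' = n.+1 by rewrite size_wadd ?size_wscale ?un.
  have uu' : comb v u' = comb v u.
    by rewrite comb_wadd ?size_wscale ?un // comb_wscale w0 scaler0 addr0.
  have pn : (size p < n.+1)%N by rewrite -wn wE size_cat /= -addSnnS leq_addr.
  have u'p : u'`_(size p) = 0.
    rewrite /u' /wadd (nth_map (0, 0)); last by rewrite size_zip size_wscale un wn minnn.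
    rewrite nth_zip ?size_wscale ?un //= (nth_map 0) ?wn //.
    by rewrite wE nth_cat ltnn subnn /= mulNr divfK // subrr.
  have u'E : u' = take (size p) u' ++ 0 :: drop (size p).+1 u'.
    by rewrite -u'p -drop_nth ?su' // cat_take_drop.
  exists (take (size p) u' ++ drop (size p).+1 u').
    rewrite size_cat size_take su' pn size_drop su' subSS subnKC //.
  rewrite -uu' [in RHS]u'E comb_drop size_take su' pn //.
have pn : (size p <= n)%N.
  by rewrite -ltnS -wn wE size_cat /= -addSnnS leq_addr.
have uE : u = take (size p) u ++ drop (size p) u by rewrite cat_take_drop.
exists (take (size p) u ++ 0 :: drop (size p) u).
  by rewrite size_cat /= addnS -size_cat cat_take_drop un.
by rewrite comb_drop cat_take_drop size_takel // un.
Qed.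

Lemma wspan_linear X (v : nat -> X) n a x y : wspan v n x -> wspan v n y ->
  wspan v n (a *: x + y).
Proof.
move=> [w wn <-] [u un <-]; exists (wadd (wscale a w) u).
  by rewrite size_wadd ?size_wscale ?wn.
by rewrite comb_wadd ?size_wscale ?wn // comb_wscale.
Qed.

Lemma fin_dim_basis X (E : set X) : fin_dim_subspace E ->
  exists n v, independent v n /\ E = wspan v n.
Proof.
move=> [n [v0 E0]].
have {v0 E0} [v Ev] : exists v, E = wspan v n.
  exists (fun i => if insub i is Some k then v0 k else 0).
  rewrite E0 eqEsubset; split=> x.
    move=> [a ->]; exists [seq a i | i <- enum 'I_n].
      by rewrite size_map size_enum_ord.
    rewrite /comb -(big_mkord xpredT (fun i =>
      [seq a i | i <- enum 'I_n]`_i *: (if insub i is Some k then v0 k else 0))).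
    rewrite size_map size_enum_ord big_mkord; apply: eq_bigr => i _.
    rewrite valK (nth_map i) ?size_enum_ord //; congr (a _ *: _).
    exact: nth_ord_enum.
  move=> [w wn <-]; exists (fun i => w`_i); rewrite /comb.
  rewrite -(big_mkord xpredT (fun i => w`_i *: (if insub i is Some k then v0 k else 0))).
  by rewrite wn big_mkord; apply: eq_bigr => i _; rewrite valK.
elim: n v Ev => [|n IH] v Ev.
  by exists 0%N, v; split=> // w /size0nil.
have [vi|] := pselect (independent v n.+1); first by exists n.+1, v.
move=> /existsNP[w /not_implyP[wn /not_implyP[w0 wz]]].
have [v' vv'] := wspan_drop wn w0 wz.
by apply: (IH v'); rewrite Ev.
Qed.

End finite_dimensional_subspaces.

(** * Finite representability from finitely many combinations *)

Section representability.
Context {R : realType}.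
Implicit Types (X Y : normedModType R) (u w : seq R) (a b e : R).

(** With finitely many combinations and additive errors, the property can be checked on
    approximating vectors and along ultralimits. Linear independence later turns the additive error
    into the factor lambda. *)
Definition sequentially_fr X Y :=
  forall x : nat -> X, word_fr Y (fun w => `|comb x w|).

Fixpoint words_over (G : seq R) n : seq (seq R) :=
  if n is n'.+1 then [seq a :: w | a <- G, w <- words_over G n'] else [:: [::]].

Lemma words_overP G n w :
  (w \in words_over G n) = (size w == n) && all (mem G) w.
Proof.
elim: n w => [|n IH] [|a w] //=.
  by apply/negbTE/negP => /allpairsP[[b u] [_ _]].
rewrite eqSS andbCA -IH; apply/allpairsP/andP => [[[b u] [bG un [-> ->]]]|[aG wn]].
  by [].
by exists (a, w).
Qed.

Lemma finite_net n (e : R) : 0 < e -> exists A : seq (seq R),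
  (forall w, w \in A -> size w = n) /\
  forall w, size w = n -> wsum w <= 1 -> exists2 u, u \in A &
    wsum (wadd w (wscale (-1) u)) <= e.
Proof.
move=> e0.
have [m m0 me] : exists2 m, (0 < m)%N & n%:R / m%:R <= e.
  exists (Num.truncn (n%:R / e)).+1 => //.
  rewrite ler_pdivrMr ?ltr0n // mulrC -ler_pdivrMr //.
  exact/ltW/real_truncnS_gt/num_real.
have m0' : 0 < m%:R :> R by rewrite ltr0n.
pose G : seq R := [seq i%:R / m%:R | i <- iota 0 m.+1] ++
  [seq - (i%:R / m%:R) | i <- iota 0 m.+1].
exists (words_over G n); split=> [w|w wn w1].
  by rewrite words_overP => /andP[/eqP].
have Ga a : `|a| <= 1 -> exists2 g, g \in G & `|a - g| <= m%:R^-1.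
  move=> a1; pose i := Num.truncn (m%:R * `|a|).
  have /andP[i1 i2] : i%:R <= m%:R * `|a| < i.+1%:R by apply: truncn_itv; rewrite mulr_ge0.
  have im : (i <= m)%N.
    by rewrite -(ler_nat R); apply: le_trans i1 _; rewrite ler_piMr.
  have iG : i%:R / m%:R \in ([seq i%:R / m%:R | i <- iota 0 m.+1] : seq R).
    by apply/mapP; exists i => //; rewrite mem_iota ltnS.
  have iG' : - (i%:R / m%:R) \in ([seq - (i%:R / m%:R) | i <- iota 0 m.+1] : seq R).
    by apply/mapP; exists i => //; rewrite mem_iota ltnS.
  have H : `| `|a| - i%:R / m%:R| <= m%:R^-1.
    have h1 : i%:R / m%:R <= `|a| by rewrite ler_pdivrMr // mulrC.
    rewrite ger0_norm ?subr_ge0 // lerBlDr -[X in X + _]mul1r -mulrDl ler_pdivlMr //.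
    by rewrite mulrC [1 + _]addrC natr1 ltW.
  have [a0|a0] := leP 0 a.
    exists (i%:R / m%:R); first by rewrite mem_cat iG.
    by rewrite -[X in `|X - _|](ger0_norm a0).
  exists (- (i%:R / m%:R)); first by rewrite mem_cat iG' orbT.
  by rewrite opprK -normrN opprD -[X in `|X - _|](ltr0_norm a0).
have H : forall w, all (fun a => `|a| <= 1) w -> exists u, [/\ size u = size w,
    all (mem G) u & forall i, (i < size w)%N -> `|w`_i - u`_i| <= m%:R^-1].
  elim=> [|a s IH] /=; first by exists [::].
  move=> /andP[/Ga[g gG ag] /IH[u [us uG ui]]]; exists (g :: u).
  split=> /=; [by rewrite us|by rewrite gG|].
  by move=> [|i] // /ui.
have w1' : all (fun a => `|a| <= 1) w.
  apply/allP => a aw; apply: le_trans w1; rewrite /wsum (perm_big _ (perm_to_rem aw)).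
  by rewrite big_cons lerDl sumr_ge0.
have [u [us uG ui]] := H w w1'.
exists u; first by rewrite words_overP us wn eqxx.
by apply: le_trans (wsum_close (esym us) ui) _; rewrite wn mulrC.
Qed.

(** Homogeneity reduces to the ball of l_1^n, and a finite net to finitely many words. The unit
    words are tested as well, in order to bound the vectors [x i], without which closeness to the
    net would give nothing. *)
Lemma sequentially_fr_uniform X Y (y : nat -> X) n e : sequentially_fr X Y ->
  0 < e -> exists x : nat -> Y, forall w, size w = n ->
    `| `|comb x w| - `|comb y w| | <= e * wsum w.
Proof.
move=> XY e0.
pose b := 1 + \sum_(i < n) `|y i|.
have yb i : (i < n)%N -> `|y i| + 1 <= b.
  move=> iN; rewrite /b (bigD1 (Ordinal iN)) //= [leLHS]addrC lerD2l lerDl.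
  by rewrite sumr_ge0.
have b0 : 0 < b by rewrite ltr_wpDr // sumr_ge0.
pose d := Num.min (e / 2) 1.
have d0 : 0 < d by rewrite lt_min ltr01 divr_gt0.
have d1 : d <= 1 by rewrite ge_min lexx orbT.
have de : d <= e / 2 by rewrite ge_min lexx.
(* The passage to the net costs e / 4 on either side, the test words cost e / 2. *)
have [|A [An Anet]] := @finite_net n (e / 4 / b); first by rewrite !divr_gt0.
have [|x xP] := XY y n (A ++ [seq unit_word n i | i <- iota 0 n]) d d0.
  move=> w; rewrite mem_cat => /orP[/An//|/mapP[i]].
  by rewrite mem_iota add0n => iN ->; exact: size_unit_word.
have xb i : (i < n)%N -> `|x i| <= b.
  move=> iN; apply: le_trans (yb i iN).
  have := xP (unit_word n i); rewrite !comb_unit_word mem_cat => H.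
  have {H} : `| `|x i| - `|y i| | <= d.
    by apply: H; apply/orP; right; apply: map_f; rewrite mem_iota.
  by rewrite ler_norml; lra.
have yb' i : (i < n)%N -> `|y i| <= b by move=> /yb; lra.
exists x => w wn.
suff H w' : size w' = n -> wsum w' <= 1 -> `| `|comb x w'| - `|comb y w'| | <= e.
  have [w0|w0] := eqVneq (wsum w) 0.
    have := @comb_le _ _ x w b; rewrite wn => /(_ xb).
    have := @comb_le _ _ y w b; rewrite wn => /(_ yb').
    rewrite w0 !mulr0 => hy hx.
    by move: hx hy (normr_ge0 (comb x w)) (normr_ge0 (comb y w));
       rewrite ler_norml; lra.
  have wp : 0 < wsum w by rewrite lt_neqAle eq_sym w0 wsum_ge0.
  have iw : `|(wsum w)^-1| = (wsum w)^-1 by rewrite gtr0_norm // invr_gt0.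
  have := H (wscale (wsum w)^-1 w); rewrite size_wscale wsum_wscale.
  rewrite iw mulVf // => /(_ wn (lexx _)).
  rewrite !comb_wscale !normrZ iw -mulrBr normrM iw.
  by rewrite ler_pdivrMl // mulrC.
move=> wn' w1; have [u uA uw] := Anet w' wn' w1.
have un := An u uA.
have close (Z : normedModType R) (z : nat -> Z) : (forall i, (i < n)%N -> `|z i| <= b) ->
    `| `|comb z w'| - `|comb z u| | <= e / 4.
  move=> zb; apply: le_trans (ler_dist_dist _ _) _.
  rewrite -combB ?un //; apply: le_trans (comb_le (b := b) _) _.
    by move=> i; rewrite size_wadd ?size_wscale ?wn' ?un //; exact: zb.
  by rewrite mulrC -ler_pdivlMr.
have := close _ x xb; have := close _ y yb'.
have : `| `|comb x u| - `|comb y u| | <= d by apply: xP; rewrite mem_cat uA.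
by rewrite !ler_norml; lra.
Qed.

Lemma sequentially_fr_fin_representable X Y :
  sequentially_fr X Y -> fin_representable X Y.
Proof.
move=> XY E /fin_dim_basis[n [v [vi ->]]] l l1.
have [c c0 cP] := independent_lower_bound vi.
have l0 : 0 < l by lra.
(* With this error the norm of a combination changes by at most the fraction 1 - 1/l: the lower
   factor is then 1/l, and the upper one is 2 - 1/l <= l. *)
have e0 : 0 < c * (1 - l^-1) by rewrite mulr_gt0 // subr_gt0 invf_lt1.
have [x xP] := sequentially_fr_uniform v n XY e0.
pose coords (z : X) := xget [::] [set w | size w = n /\ comb v w = z].
have coordsP z : wspan v n z -> size (coords z) = n /\ comb v (coords z) = z.
  by move=> [w wn wz]; rewrite /coords; case: xgetP => // /(_ w) /(_ (conj wn wz)).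
have coords_uniq w : size w = n -> coords (comb v w) = w.
  move=> wn; have [|cn cw] := coordsP (comb v w); first by exists w.
  set u := coords _ in cn cw *.
  have : wadd u (wscale (-1) w) = nseq n 0.
    apply: vi; first by rewrite size_wadd ?size_wscale ?cn.
    by rewrite combB ?cn // cw subrr.
  move=> h; rewrite -(waddK (u := u) (v := w)) ?cn // h.
  by rewrite -wn wadd0w.
exists (fun z => comb x (coords z)).
  move=> a z z' [w wn <-] [w' wn' <-].
  rewrite -comb_wscale -comb_wadd ?size_wscale ?wn //.
  rewrite !coords_uniq ?size_wadd ?size_wscale ?wn //.
  by rewrite comb_wadd ?size_wscale ?wn // comb_wscale.
move=> _ [w wn <-]; rewrite coords_uniq //.
have := xP w wn; have := cP w wn.
have : 0 <= `|comb v w| by [].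
move: (`|comb v w|) (`|comb x w|) => p q p0 cp qp.
have : c * (1 - l^-1) * wsum w <= (1 - l^-1) * p.
  by rewrite mulrAC [leRHS]mulrC ler_wpM2r // subr_ge0 invf_le1 // ltW.
have ll : 1 - l^-1 <= l - 1.
  have : l * l^-1 = 1 by rewrite mulfV // gt_eqF.
  have : 0 < l^-1 by rewrite invr_gt0.
  nra.
have := ler_wpM2r p0 ll.
by move: qp; rewrite ler_norml; lra.
Qed.

End representability.

(** * Krivine's theorem *)

Section krivine.
Context {R : realType} (X : normedModType R).
Hypothesis X_infinite : infinite_dimensional X.

Lemma wspan_fin_dim (v : nat -> X) n : fin_dim_subspace (wspan v n).
Proof.
exists n, (fun i : 'I_n => v i); rewrite eqEsubset; split=> x.
  move=> [w wn <-]; exists (fun i => w`_i); rewrite /comb.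
  by rewrite -(big_mkord xpredT (fun i => w`_i *: v i)) wn big_mkord.
move=> [a ->]; exists [seq a i | i <- enum 'I_n].
  by rewrite size_map size_enum_ord.
rewrite /comb -(big_mkord xpredT (fun i => [seq a i | i <- enum 'I_n]`_i *: v i)).
rewrite size_map size_enum_ord big_mkord; apply: eq_bigr => i _.
by rewrite (nth_map i) ?size_enum_ord // nth_ord_enum.
Qed.

(** Riesz's lemma for the span of [s]. A vector [z] outside the span has positive distance from it,
    because a basis stays independent when [z] is appended. *)
Lemma riesz_separated (s : seq X) :
  exists x : X, `|x| <= 1 /\ forall y, y \in s -> 2^-1 <= `|x - y|.
Proof.
have [n [v [vi sv]]] := fin_dim_basis (wspan_fin_dim (nth 0 s) (size s)).
have sF y : y \in s -> wspan v n y.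
  move=> /(nthP 0)[i si <-]; rewrite -sv.
  by exists (unit_word (size s) i); [exact: size_unit_word|exact: comb_unit_word].
have [z zF] : exists z, ~ wspan v n z.
  apply: contrapT => /forallNP H; apply: X_infinite; rewrite /finite_dimensional.
  have -> : [set: X] = wspan v n.
    by rewrite eqEsubset; split=> // x _; exact: contrapT (H x).
  exact: wspan_fin_dim.
pose v' i := if (i < n)%N then v i else z.
have v'E w b : size w = n -> comb v' (rcons w b) = comb v w + b *: z.
  move=> wn; rewrite -cats1 comb_cat comb_cons comb_nil addr0 wn addn0.
  rewrite /v' ltnn; congr (_ + _); apply: eq_bigr => i _.
  by rewrite -wn ltn_ord.
have v'i : independent v' n.+1.
  move=> w; case/lastP: w => // w b; rewrite size_rcons => -[wn].
  rewrite v'E //; have [->|b0] := eqVneq b 0.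
    rewrite scale0r addr0 => /(vi _ wn) ->.
    by rewrite -cats1 -[[:: 0]]/(nseq 1 0) -nseqD addn1.
  move=> h; exfalso; apply: zF; exists (wscale (- b^-1) w).
    by rewrite size_wscale.
  move/eqP: h; rewrite addr_eq0 => /eqP h.
  by rewrite comb_wscale h scalerN scaleNr opprK scalerA mulVf // scale1r.
have [c c0 cP] := independent_lower_bound v'i.
have zc f : wspan v n f -> c <= `|z - f|.
  move=> [w wn <-]; have := cP (rcons (wscale (-1) w) 1).
  rewrite size_rcons size_wscale wn => /(_ erefl).
  rewrite v'E ?size_wscale // scale1r comb_wscale scaleN1r addrC.
  apply: le_trans; rewrite -[leLHS]mulr1 ler_pM2l //.
  rewrite /wsum -cats1 big_cat /= big_cons big_nil normr1 addr0 lerDr.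
  exact: wsum_ge0.
pose D := [set `|z - f| | f in wspan v n].
have Di : has_inf D.
  split.
    by exists `|z - comb v (nseq n 0)|, (comb v (nseq n 0)) => //; exists (nseq n 0); rewrite ?size_nseq.
  by exists c => _ [f fF <-]; exact: zc.
have d0 : 0 < inf D.
  apply: lt_le_trans c0 _; apply: lb_le_inf; first by case: Di.
  by move=> _ [f fF <-]; exact: zc.
(* The point is chosen with r < 2 inf D, whence the constant 1/2. *)
have [_ [f fF <-]] := inf_adherent d0 Di; set r := `|z - f| => fd.
have r0 : 0 < r by apply: lt_le_trans c0 (zc _ fF).
exists (r^-1 *: (z - f)); split.
  by rewrite normrZ gtr0_norm ?invr_gt0 // mulVf // gt_eqF.
move=> y /sF yF.
have -> : r^-1 *: (z - f) - y = r^-1 *: (z - (r *: y + f)).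
  rewrite opprD addrA addrAC [in RHS]scalerBr scalerA mulVf ?scale1r //.
  by rewrite gt_eqF.
rewrite normrZ gtr0_norm ?invr_gt0 // ler_pdivlMl //.
have : inf D <= `|z - (r *: y + f)|.
  by apply: ge_inf; [case: Di|exists (r *: y + f) => //; exact: wspan_linear].
by move: fd; lra.
Qed.

Lemma separated_sequence : exists x : nat -> X, (forall n, `|x n| <= 1) /\
  forall n m, (n < m)%N -> 2^-1 <= `|x n - x m|.
Proof.
have [F FP] := choice riesz_separated.
pose S := fix S n := if n is n'.+1 then F (S n') :: S n' else [::].
exists (fun n => F (S n)); split=> [n|n m nm]; first by have [] := FP (S n).
have [_ +] := FP (S m); rewrite distrC; apply.
elim: m nm => // m IH; rewrite ltnS leq_eqVlt => /orP[/eqP ->|/IH].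
  by rewrite inE eqxx.
by rewrite inE => ->; rewrite orbT.
Qed.

Lemma c0_or_lp_word_fr : exists K : seq R -> R,
  [/\ word_norm K, word_monotone K, K [:: 1] = 1, word_fr X K &
  (forall w, K w = word_max w) \/
  exists2 p : R, 1 <= p & forall w, K w = (\sum_(a <- w) `|a| `^ p) `^ p^-1].
Proof.
have [x [x1 xs]] := separated_sequence.
have [U [UU Uoo]] := free_ultrafilter.
have Nn := word_norm_iter_limit UU x1.
have N1 : 0 < iter_limit U x [:: 1; -1] 0.
  apply: lt_le_trans (iter_limit_sub UU x1 Uoo xs).
  by rewrite invr_gt0.
have [M [Mn Mfr Mm M1]] := unconditional_model Nn (word_fr_iter_limit UU x1) N1.
have [K [Kn Kfr Km K1 KP]] := block_model Mn Mm M1 Mfr.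
exists K; split=> //; exact: c0_or_lp_model Kn Km K1 KP.
Qed.

End krivine.

(** * Completion of a seminormed space *)

Section sublinear_functionals.
Context {R : realType} {V : lmodType R}.
Implicit Types (p q : V -> R) (x y : V) (s t : R).

Record sublinear p : Prop := Sublinear {
  sublinearD : forall x y, p (x + y) <= p x + p y ;
  sublinearZ : forall t x, 0 <= t -> p (t *: x) = t * p x }.

Lemma sublinear0 p : sublinear p -> p 0 = 0.
Proof. by move=> sp; rewrite -(scale0r 0) (sublinearZ sp) // mul0r. Qed.

Lemma sublinearN p x : sublinear p -> - p (- x) <= p x.
Proof.
by move=> sp; have := sublinearD sp x (- x); rewrite subrr sublinear0 //; lra.
Qed.

Lemma sublinear_intro p : p 0 = 0 -> (forall x y, p (x + y) <= p x + p y) ->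
  (forall t x, 0 < t -> p (t *: x) <= t * p x) -> sublinear p.
Proof.
move=> p0 pD pZ; split=> // t x; rewrite le_eqVlt => /orP[/eqP <-|t0].
  by rewrite scale0r mul0r.
apply/eqP; rewrite eq_le pZ //= -ler_pdivlMl //.
have := pZ t^-1 (t *: x); rewrite invr_gt0 scalerA mulVf ?gt_eqF // scale1r.
exact.
Qed.

(** For sublinear [q], a sublinear minorant whose value at -y is at most - q y. A minimal [q]
    coincides with it and is therefore additive in the direction [y]; a linear functional below it
    agrees with [q] at [y]. *)
Definition twist q y x : R := inf [set q (x + t *: y) - t * q y | t in [set t | 0 <= t]].

Lemma twist_le q y x t : sublinear q -> 0 <= t ->
  twist q y x <= q (x + t *: y) - t * q y.
Proof.
move=> sq t0; apply: ge_inf; last by exists t.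
exists (- q (- x)) => _ [s s0 <-].
have := sublinearD sq (x + s *: y) (- x).
by rewrite addrAC subrr add0r (sublinearZ sq) //; lra.
Qed.

Lemma twist_ge q y x c :
  (forall t, 0 <= t -> c <= q (x + t *: y) - t * q y) -> c <= twist q y x.
Proof.
move=> h; apply: lb_le_inf; first by exists (q (x + 0 *: y) - 0 * q y); exists 0 => /=.
by move=> _ [t t0 <-]; exact: h.
Qed.

Lemma twist_sublinear q y : sublinear q -> sublinear (twist q y).
Proof.
move=> sq; apply: sublinear_intro.
- apply/eqP; rewrite eq_le; apply/andP; split.
    have := twist_le y 0 sq (lexx 0).
    by rewrite scale0r addr0 mul0r subr0 (sublinear0 sq).
  by apply: twist_ge => t t0; rewrite add0r (sublinearZ sq) // subrr.
- move=> x x'; rewrite -lerBlDr; apply: twist_ge => t t0.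
  rewrite lerBlDr -lerBlDl; apply: twist_ge => t' t'0; rewrite lerBlDl.
  apply: le_trans (twist_le _ _ sq (addr_ge0 t0 t'0)) _.
  have := sublinearD sq (x + t *: y) (x' + t' *: y).
  by rewrite addrACA scalerDl; lra.
- move=> s x s0; rewrite -ler_pdivrMl //; apply: twist_ge => t t0.
  rewrite ler_pdivrMl //.
  apply: le_trans (twist_le _ _ sq (mulr_ge0 (ltW s0) t0)) _.
  by rewrite -scalerA -scalerDr (sublinearZ sq _ (ltW s0)) mulrBr mulrA.
Qed.

(* Hahn-Banach, through a minimal sublinear minorant. *)
Lemma sublinear_minorant p : sublinear p ->
  exists2 f : V -> R, (forall a x y, f (a *: x + y) = a * f x + f y) &
    forall x, f x <= p x.
Proof.
move=> sp.
pose T := {q : V -> R | sublinear q /\ forall x, q x <= p x}.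
pose r (q1 q2 : T) := `[< forall x, sval q2 x <= sval q1 x >].
have [| | | |[q [sq qp]] qmin] := @Zorn T r.
- by move=> q; apply/asboolP => x.
- move=> q1 q2 q3 /asboolP h /asboolP k; apply/asboolP => x.
  exact: le_trans (k x) (h x).
- move=> [q1 h1] [q2 h2] /asboolP /= h /asboolP /= k; apply: eq_exist.
  by apply/funext => x; apply/eqP; rewrite eq_le h k.
- move=> A Atot; have [[q0 Aq0]|A0] := pselect (A !=set0); last first.
    by exists (exist _ p (conj sp (fun x => lexx _))) => q Aq; exfalso; apply: A0; exists q.
  pose F x := [set sval g x | g in A].
  have Flb x : has_lbound (F x).
    exists (- p (- x)) => _ [[q [sq qp]] _ <-] /=.
    by apply: le_trans (sublinearN x sq); rewrite lerN2.
  have F0 x : F x !=set0 by exists (sval q0 x); exists q0.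
  pose i x := inf (F x).
  have ile (g : T) x : A g -> i x <= sval g x by move=> Ag; apply: ge_inf => //; exists g.
  have ige x c : (forall g : T, A g -> c <= sval g x) -> c <= i x.
    by move=> h; apply: lb_le_inf => // _ [q Aq <-]; exact: h.
  have si : sublinear i.
    apply: sublinear_intro.
    - apply/eqP; rewrite eq_le; apply/andP; split.
        by have := ile q0 0 Aq0; rewrite (sublinear0 (proj1 (svalP q0))).
      by apply: (ige) => q _; rewrite (sublinear0 (proj1 (svalP q))).
    - move=> x y; rewrite -lerBlDr; apply: (ige) => q Aq.
      rewrite lerBlDr -lerBlDl; apply: (ige) => q' Aq'; rewrite lerBlDl.
      (* Of two members of the chain, the lower one serves for both terms. *)
      have [/asboolP h|/asboolP h] := Atot _ _ Aq Aq'.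
        apply: le_trans (ile q' _ Aq') _.
        apply: le_trans (sublinearD (proj1 (svalP q')) _ _) _.
        by rewrite lerD2r.
      apply: le_trans (ile q _ Aq) _.
      apply: le_trans (sublinearD (proj1 (svalP q)) _ _) _.
      by rewrite lerD2l.
    - move=> t x t0; rewrite -ler_pdivrMl //; apply: (ige) => q Aq.
      rewrite ler_pdivrMl //; apply: le_trans (ile q _ Aq) _.
      by rewrite (sublinearZ (proj1 (svalP q))) // ltW.
  have ip x : i x <= p x.
    exact: le_trans (ile q0 x Aq0) (proj2 (svalP q0) x).
  by exists (exist _ i (conj si ip)) => q Aq; apply/asboolP => x; exact: ile.
have qD x y : q (x + y) = q x + q y.
  apply/eqP; rewrite eq_le (sublinearD sq) /=.
  have tw z : twist q y z <= q z.
    have := twist_le y z sq (lexx 0).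
    by rewrite scale0r addr0 mul0r subr0.
  have H := conj (twist_sublinear y sq) (fun z => le_trans (tw z) (qp z)).
  (* Minimality identifies [q] with its twist, for which t = 1 gives q x <= q (x + y) - q y. *)
  have /(congr1 (fun g : T => sval g x)) /= <- : (exist _ _ H : T) = exist _ _ (conj sq qp).
    by apply: qmin; apply/asboolP => z; exact: tw.
  by have := twist_le y x sq ler01; rewrite scale1r mul1r; lra.
have qN x : q (- x) = - q x.
  by have := qD x (- x); rewrite subrr (sublinear0 sq); lra.
exists q => // a x y; rewrite qD; congr (_ + _).
have [a0|a0] := leP 0 a; first exact: sublinearZ.
by rewrite -[a]opprK scaleNr qN (sublinearZ sq) ?mulNr // oppr_ge0 ltW.
Qed.

End sublinear_functionals.

Record seminorm {R : realType} (V : lmodType R) := Seminorm {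
  seminorm_fun :> V -> R ;
  seminormD : forall x y, seminorm_fun (x + y) <= seminorm_fun x + seminorm_fun y ;
  seminormZ : forall a x, seminorm_fun (a *: x) = `|a| * seminorm_fun x }.

Section norming_functionals.
Context {R : realType} {V : lmodType R} (N : seminorm V).

Definition dual_ball (f : V -> R) :=
  (forall a x y, f (a *: x + y) = a * f x + f y) /\ forall x, `|f x| <= N x.

Lemma seminorm_ge0 (x : V) : 0 <= N x.
Proof.
have := seminormD N x (- x); have := seminormZ N (-1) x.
have := seminormZ N 0 0.
by rewrite scale0r normr0 mul0r scaleN1r normrN normr1 mul1r subrr => -> ->; lra.
Qed.

Lemma norming_functional (x : V) : exists2 f, dual_ball f & f x = N x.
Proof.
have [ND NZ] := (seminormD N, seminormZ N).
have sN : sublinear N by split=> // t y t0; rewrite NZ ger0_norm.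
have [f fl fp] := sublinear_minorant (twist_sublinear x sN).
have fN y : f y <= N y.
  apply: le_trans (fp y) _; have := twist_le x y sN (lexx 0).
  by rewrite scale0r addr0 mul0r subr0.
have f0 : f 0 = 0 by have := fl 1 0 0; rewrite scale1r addr0 mul1r; lra.
have fopp y : f (- y) = - f y.
  by have := fl (-1) y 0; rewrite scaleN1r addr0 f0; lra.
have NN y : N (- y) = N y by rewrite -scaleN1r NZ normrN normr1 mul1r.
exists f.
  split=> // y; rewrite ler_norml fN andbT lerNl -fopp.
  by rewrite -[N y]NN fN.
apply/eqP; rewrite eq_le fN /=.
have := twist_le x (- x) sN ler01.
rewrite scale1r addNr mul1r (sublinear0 sN) sub0r => h.
by have := le_trans (fp (- x)) h; rewrite fopp lerN2.
Qed.

End norming_functionals.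

Section completion.
Context {R : realType} {V : lmodType R} (N : seminorm V).

Definition dual : Type := {f : V -> R | dual_ball N f}.

(* The completion of (V, N) is the uniform closure, among the functions on the
   dual ball, of the image of V under evaluation. *)
Definition completion_pred : {pred dual -> R} :=
  mem [set g : dual -> R | forall e, 0 < e ->
    exists x : V, forall f, `|g f - sval f x| <= e].

Record completion := Completion {
  completion_val :> dual -> R ; _ : completion_val \in completion_pred }.

HB.instance Definition _ := [isSub for completion_val].
HB.instance Definition _ := [Choice of completion by <:].

Lemma completion_submod_closed : submod_closed completion_pred.
Proof.
split.
  rewrite inE => e e0; exists 0 => -[f [fl fN]] /=.
  have := fl 1 0 0; rewrite scale1r addr0 mul1r => /esym/eqP.
  rewrite -subr_eq0 addrK => /eqP ->.
  by rewrite subrr normr0 ltW.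
move=> a g h /[!inE] gP hP e e0.
have a1 : 0 < `|a| + 1 by rewrite ltr_wpDl.
have [|x gx] := gP (e / (2 * (`|a| + 1))); first by rewrite divr_gt0 // mulr_gt0.
have [|y hy] := hP (e / 2); first by rewrite divr_gt0.
exists (a *: x + y) => f; have [fl _] := svalP f.
have -> : (a *: g + h) f - sval f (a *: x + y) =
    a * (g f - sval f x) + (h f - sval f y).
  have -> : (a *: g + h) f = a * g f + h f by [].
  by rewrite fl; ring.
apply: le_trans (ler_normD _ _) _; rewrite [e]splitr lerD //.
rewrite normrM; apply: (@le_trans _ _ ((`|a| + 1) * (e / (2 * (`|a| + 1))))).
  by apply: ler_pM => //; rewrite lerDl.
by rewrite le_eqVlt; apply/orP; left; apply/eqP; field; rewrite gt_eqF.
Qed.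

HB.instance Definition _ := GRing.isSubmodClosed.Build _ _ completion_pred
  completion_submod_closed.
HB.instance Definition _ := [SubChoice_isSubLmodule of completion by <:].

Definition completion_norm (g : completion) : R := sup (range (fun f => `|g f|)).

Lemma zero_dual_ball : dual_ball N (fun=> 0).
Proof.
split=> [a x y|x]; first by rewrite mulr0 addr0.
by rewrite normr0 seminorm_ge0.
Qed.

Lemma completion_has_sup (g : completion) : has_sup (range (fun f => `|g f|)).
Proof.
split; first by exists `|g (exist _ _ zero_dual_ball)|, (exist _ _ zero_dual_ball).
have /set_mem gP : (g : dual -> R) \in completion_pred := valP g.
have [x gx] := gP 1 ltr01; exists (1 + N x) => _ [f _ <-].
have -> : g f = (g f - sval f x) + sval f x by rewrite subrK.
by apply: le_trans (ler_normD _ _) _; rewrite lerD //; exact: (svalP f).2.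
Qed.

Lemma completion_norm_ub (g : completion) f : `|g f| <= completion_norm g.
Proof. by apply: sup_upper_bound; [exact: completion_has_sup|exists f]. Qed.

Lemma completion_norm_le (g : completion) M :
  (forall f, `|g f| <= M) -> completion_norm g <= M.
Proof.
by move=> gM; apply: ge_sup => [|_ [f _ <-]//]; case: (completion_has_sup g).
Qed.

Lemma completion_normD (g h : completion) :
  completion_norm (g + h) <= completion_norm g + completion_norm h.
Proof.
apply: completion_norm_le => f.
by rewrite (le_trans (ler_normD (g f) (h f)))// lerD// completion_norm_ub.
Qed.

Lemma completion_normZ (a : R) (g : completion) :
  completion_norm (a *: g) = `|a| * completion_norm g.
Proof.
have le b (h : completion) : completion_norm (b *: h) <= `|b| * completion_norm h.
  apply: completion_norm_le => f.
  have -> : (b *: h) f = b * h f by [].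
  by rewrite normrM ler_wpM2l// completion_norm_ub.
apply/eqP; rewrite eq_le le/=.
have [->|a0] := eqVneq a 0.
  rewrite normr0 mul0r.
  apply: le_trans (completion_norm_ub _ (exist _ _ zero_dual_ball)).
  exact: normr_ge0.
have := le a^-1 (a *: g).
by rewrite scalerA mulVf// scale1r normfV -ler_pdivlMl ?invr_gt0 ?normr_gt0 // invrK.
Qed.

Lemma completion_norm0_eq0 (g : completion) : completion_norm g = 0 -> g = 0.
Proof.
move=> g0; apply/val_inj/funext => f /=.
by apply/normr0_eq0/eqP; rewrite eq_le normr_ge0 -g0 completion_norm_ub.
Qed.

HB.instance Definition _ := Lmodule_isNormed.Build R completion
  completion_normD completion_normZ completion_norm0_eq0.

(** A Cauchy filter converges at each functional, uniformly over the dual ball, and approximability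
    by evaluations passes to uniform limits. *)
Lemma completion_complete (F : set_system completion) :
  ProperFilter F -> cauchy F -> cvg F.
Proof.
move=> FF /cauchyP Fc.
have near_eval (e : R) (y : completion) : F (ball y e) ->
    forall f, F [set z : completion | `|y f - z f| <= e].
  move=> Fy f; apply: filterS Fy => z; rewrite -ball_normE /= => yz.
  apply: le_trans (ltW yz).
  exact: (completion_norm_ub (y - z) f).
have eval_cvg f : cvg ((fun y : completion => y f) @ F).
  apply: cauchy_cvg; apply/cauchyP => e e0.
  have e2 : 0 < e / 2 by rewrite divr_gt0.
  have [y Fy] := Fc _ e2; exists (y f).
  have : F [set z : completion | ball (y f) e (z f)].
    apply: filterS (near_eval _ _ Fy f) => z yz.
    rewrite -ball_normE /=; apply: le_lt_trans yz _.
    by rewrite ltr_pdivrMr // ltr_pMr // ltr1n.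
  exact.
pose g f : R := lim ((fun y : completion => y f) @ F).
have g_near (e : R) (y : completion) : F (ball y e) -> forall f, `|y f - g f| <= e.
  move=> Fy f.
  have H : (fun z : completion => `|y f - z f|) @ F --> `|y f - g f|.
    by apply: cvg_norm; apply: cvgB; [exact: cvg_cst|exact: eval_cvg].
  exact: cvgr_to_le H (near_eval _ _ Fy f).
have gP : g \in completion_pred.
  rewrite inE => e e0; have e2 : 0 < e / 2 by rewrite divr_gt0.
  have [y Fy] := Fc _ e2.
  have /set_mem yP : (y : dual -> R) \in completion_pred := valP y.
  have [x yx] := yP _ e2; exists x => f.
  have -> : g f - sval f x = (y f - sval f x) - (y f - g f) by ring.
  by apply: le_trans (ler_normB _ _) _; rewrite [e]splitr lerD // g_near.
apply/cvg_ex; exists (Completion gP); apply/cvg_ballP => e e0.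
have e3 : 0 < e / 3 by rewrite divr_gt0.
have [y Fy] := Fc _ e3.
apply: (filterS _ Fy) => z; rewrite -!ball_normE /= => yz.
have yg : `|y - Completion gP| <= e / 3.
  by apply: completion_norm_le => f; exact: g_near Fy f.
have -> : Completion gP - z = (y - z) - (y - Completion gP).
  by rewrite opprB [RHS]addrC addrA subrK.
apply: le_lt_trans (ler_normB _ _) _.
by move: yz yg; move: (`|y - z|) (`|y - _|) => p q; lra.
Qed.

HB.instance Definition _ := Uniform_isComplete.Build completion completion_complete.

Lemma completion_embed_subproof (x : V) :
  (fun f : dual => sval f x) \in completion_pred.
Proof. by rewrite inE => e e0; exists x => f; rewrite subrr normr0 ltW. Qed.

Definition completion_embed (x : V) : completion :=
  Completion (completion_embed_subproof x).

Lemma completion_embed_linear a (x y : V) : completion_embed (a *: x + y) =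
  a *: completion_embed x + completion_embed y.
Proof. by apply/val_inj/funext => f /=; rewrite (svalP f).1. Qed.

Lemma completion_embed_norm x : `|completion_embed x| = N x.
Proof.
apply/eqP; rewrite eq_le; apply/andP; split.
  by apply: completion_norm_le => f; exact: (svalP f).2.
have [f fN <-] := norming_functional N x.
apply: le_trans (ler_norm _) _.
exact: (completion_norm_ub (completion_embed x) (exist _ f fN)).
Qed.

Lemma completion_embed_dense (y : completion) e : 0 < e ->
  exists x, `|y - completion_embed x| <= e.
Proof.
have /set_mem yP : (y : dual -> R) \in completion_pred := valP y.
move=> /yP[x yx]; exists x; apply: completion_norm_le => f; exact: yx.
Qed.

End completion.

Lemma completion_exists (R : realType) (V : lmodType R) (N : seminorm V) :
  exists (Y : completeNormedModType R) (j : V -> Y),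
    [/\ forall a x y, j (a *: x + y) = a *: j x + j y, forall x, `|j x| = N x &
      forall y e, 0 < e -> exists x, `|y - j x| <= e].
Proof.
exists (completion N), (completion_embed N); split.
- exact: completion_embed_linear.
- exact: completion_embed_norm.
- exact: completion_embed_dense.
Qed.

(** * Embedding a finitely representable space *)

Section separability.
Context {R : realType}.
Implicit Types X Y E : normedModType R.

Lemma denseP X (D : set X) :
  dense D <-> forall x (e : R), 0 < e -> exists2 d, D d & `|x - d| < e.
Proof.
split=> [Dd x e e0|H O [x Ox] oO].
  have [||d [/= xd Dd']] := Dd (ball x e).
  - by exists x; exact: ballxx.
  - exact: ball_open.
  by exists d => //; move: xd; rewrite -ball_normE.
have /nbhs_ballP[e /= e0 xeO] : nbhs x O by exact: open_nbhs_nbhs.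
have [d Dd xd] := H x e e0; exists d; split=> //; apply: xeO.
by rewrite -ball_normE.
Qed.

Lemma separable_comb X (v : nat -> X) :
  (forall x (e : R), 0 < e -> exists w, `|x - comb v w| < e) -> separable_space X.
Proof.
move=> vd; exists (range (fun w : seq rat => comb v [seq ratr a | a <- w])).
  by apply: sub_countable (card_image_le _ _) _; exact: countableP.
apply/denseP => x e e0; have e2 : 0 < e / 2 by rewrite divr_gt0.
have [w xw] := vd x _ e2.
pose b := 1 + \sum_(i < size w) `|v i|.
have vb i : (i < size w)%N -> `|v i| <= b.
  move=> iN; rewrite /b (bigD1 (Ordinal iN)) //= addrCA lerDl.
  by rewrite addr_ge0 // sumr_ge0.
have b0 : 0 < b by rewrite ltr_wpDr // sumr_ge0.
have [u uw ud] : exists2 u : seq rat, size u = size w &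
    forall i, (i < size w)%N ->
      `|w`_i - [seq ratr a | a <- u]`_i| <= e / 2 / b / (size w).+1%:R.
  have : 0 < e / 2 / b / (size w).+1%:R :> R by rewrite !divr_gt0.
  move: (_ / _) => d d0; elim: {xw b vb b0} w => [|a w [u us ui]]; first by exists [::].
  have [q qa] : exists q : rat, `|a - ratr q| <= d.
    have [q] : exists q : rat, a - d < ratr q < a + d.
      have /rat_in_itvoo[q] : a - d < a + d by lra.
      by rewrite in_itv /=; exists q.
    by move=> h; exists q; rewrite ler_norml; lra.
  exists (q :: u); first by rewrite /= us.
  by move=> [|i] //; exact: ui.
exists (comb v [seq ratr a | a <- u]); first by exists u.
have -> : x - comb v [seq ratr a | a <- u] =
    (x - comb v w) + comb v (wadd w (wscale (-1) [seq ratr a | a <- u])).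
  by rewrite combB ?size_map ?uw // addrA subrK.
apply: le_lt_trans (ler_normD _ _) _; rewrite [e]splitr ltr_leD //.
apply: le_trans (comb_le (b := b) _) _.
  by move=> i; rewrite size_wadd ?size_wscale ?size_map ?uw //; exact: vb.
rewrite mulrC -ler_pdivlMr //.
apply: le_trans (wsum_close _ ud) _; first by rewrite size_map uw.
rewrite mulrAC ler_pdivrMr // ler_wpM2l ?ler_nat //.
by rewrite divr_ge0 ?(ltW b0) // ltW.
Qed.

Lemma has_basis_separable X : has_basis X -> separable_space X.
Proof.
case=> [/fin_dim_basis[n [v [_ Xv]]]|[v vb]].
  apply: (@separable_comb _ v) => x e e0.
  have [w _ <-] : wspan v n x by rewrite -Xv.
  by exists w; rewrite subrr normr0.
apply: (@separable_comb _ v) => x e e0.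
have [a [xa _]] := vb x.
have /cvgrPdist_lt/(_ e e0) := xa.
move=> /filter_ex[n xn]; exists (mkseq a n); move: xn.
rewrite /series /= big_mkord /comb; congr (`|_ - _| < _).
rewrite -(big_mkord xpredT (fun i => (mkseq a n)`_i *: v i)) size_mkseq big_mkord.
by apply: eq_bigr => i _; rewrite nth_mkseq.
Qed.

(** The preimages of the balls around a limit point form a Cauchy filter base. Completeness of E is
    a hypothesis and not a structure, because [c0] and [ell] carry only their norms. *)
Lemma isometry_range_closed E X (f : {linear E -> X}) :
  (forall F : set_system E, ProperFilter F -> cauchy F -> cvg F) ->
  linear_isometry f -> closed (range f).
Proof.
move=> E_complete fi x xf.
pose B (e : R) := [set y : E | `|x - f y| < e].
have BF : ProperFilter (filter_from [set e : R | 0 < e] B).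
  apply: filter_from_proper; last first.
    move=> e /= e0; have [_ [[y _ <-]]] := xf _ (nbhsx_ballx x e e0).
    by rewrite -ball_normE; exists y.
  apply: filter_from_filter; first by exists 1 => /=.
  move=> e d /= e0 d0; exists (Num.min e d); first by rewrite /= lt_min e0.
  by move=> y; rewrite /B /= lt_min => /andP.
have : cauchy (filter_from [set e : R | 0 < e] B).
  apply/cauchyP => e e0; have e2 : 0 < e / 2 by rewrite divr_gt0.
  have [_ [[y _ <-]]] := xf _ (nbhsx_ballx x _ e2); rewrite -ball_normE /= => xy.
  exists y; exists (e / 2) => //= z; rewrite /B /= => xz.
  rewrite -ball_normE /= -fi linearB.
  have -> : f y - f z = (x - f z) - (x - f y) by rewrite opprB [RHS]addrC addrA subrK.
  apply: le_lt_trans (ler_normB _ _) _.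
  by move: xy xz; move: (`|x - f y|) (`|x - f z|) => p q; lra.
move=> /(E_complete _ BF)/cvg_ex[y yl]; exists y => //.
apply/eqP; rewrite eq_sym -subr_eq0 -normr_le0; apply/ler_addgt0Pr => e e0.
rewrite add0r; have e2 : 0 < e / 2 by rewrite divr_gt0.
have [d /= d0 dy] := yl _ (nbhsx_ballx y _ e2).
have m0 : 0 < Num.min d (e / 2) by rewrite lt_min d0.
have [_ [[z _ <-]]] := xf _ (nbhsx_ballx x _ m0); rewrite -ball_normE /= => xz.
move: xz; rewrite lt_min => /andP[xz1 xz2].
have := dy z xz1; rewrite -ball_normE /= -fi linearB => yz.
have -> : x - f y = (x - f z) - (f y - f z) by rewrite opprB addrA subrK.
apply: le_trans (ler_normB _ _) _.
by move: xz2 yz; move: (`|x - f z|) (`|f y - f z|) => p q; lra.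
Qed.

End separability.

(** * Amalgamation of X and E *)

Section amalgamation.
Context {R : realType} (X E : normedModType R).
Hypothesis EX : fin_representable E X.

(** An index is a finite list of vectors whose span is to be embedded, with the precision 1 / (n +
    1). *)
Let I : Type := (seq E * nat)%type.
Let span (s : seq E) := wspan (nth 0 s) (size s).

Lemma span_mem s y : y \in s -> span s y.
Proof.
move=> /(nthP 0)[i si <-].
by exists (unit_word (size s) i); [exact: size_unit_word|exact: comb_unit_word].
Qed.

Lemma span0 s : span s 0.
Proof. by exists (nseq (size s) 0); rewrite ?size_nseq // comb_zeros. Qed.

Lemma partial_embeddings : exists T : I -> E -> X,
  forall i, linear_on (span i.1) (T i) /\ forall y, span i.1 y ->
    `| `|T i y| - `|y| | <= i.2.+1%:R^-1 * `|y|.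
Proof.
suff /choice[T TP] : forall i : I, exists T : E -> X,
    linear_on (span i.1) T /\ forall y, span i.1 y ->
    `| `|T y| - `|y| | <= i.2.+1%:R^-1 * `|y| by exists T.
move=> [s n] /=; set t : R := n.+1%:R^-1.
have t0 : 0 < t by rewrite invr_gt0.
have [|T Tl TP] := EX (wspan_fin_dim (nth 0 s) (size s)) (lambda := 1 + t).
  by rewrite ltrDl.
exists T; split=> // y /TP /andP[h1 h2].
have h3 : (1 - t) * `|y| <= (1 + t)^-1 * `|y|.
  have l0 : 0 < 1 + t by rewrite addr_gt0.
  rewrite ler_wpM2r // -[leRHS]mul1r ler_pdivlMr //; nra.
by rewrite ler_norml; move: h1 h2 h3; lra.
Qed.

Definition exhausting : set_system I := [set A : set I |
  exists (s0 : seq E) (n0 : nat), forall (s : seq E) n, {subset s0 <= s} -> (n0 <= n)%N -> A (s, n)].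

Lemma exhausting_filter : ProperFilter exhausting.
Proof.
apply: Build_ProperFilter_ex.
  by move=> A [s [n A0]]; exists (s, n); exact: A0.
split.
- by exists [::], 0%N.
- move=> A B [s [n A0]] [s' [n' B0]]; exists (s ++ s'), (maxn n n') => s1 n1 ss.
  rewrite geq_max => /andP[h h']; split.
    by apply: A0 => // y ys; apply: ss; rewrite mem_cat ys.
  by apply: B0 => // y ys; apply: ss; rewrite mem_cat ys orbT.
- by move=> A B AB [s [n A0]]; exists s, n => s1 n1 ss nn; apply: AB; exact: A0.
Qed.

(* The norm of x + T y in an ultrapower of X, where T is the isometric embedding
   of E given by finite representability. *)
Lemma amalgam : exists N : seminorm (X * E)%type,
  [/\ forall x, N (x, 0) = `|x|, forall y, N (0, y) = `|y| &
    forall (z : nat -> X * E) k (A : seq (seq R)) (e : R), 0 < e ->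
    (forall w, w \in A -> size w = k) -> exists x : nat -> X, forall w, w \in A ->
    `| `|comb x w| - N (comb (fst \o z) w, comb (snd \o z) w)| <= e].
Proof.
have [T TP] := partial_embeddings.
have [U [UU Uex]] := ultraFilterLemma exhausting_filter.
(* [T i] is linear only on the span of [i.1], so each law below holds just for those indices whose
   span contains the vectors involved. *)
have near_mem y : U [set i : I | y \in i.1].
  by apply: Uex; exists [:: y], 0%N => s n ss _ /=; apply: ss; rewrite inE.
have near_span y : \forall i \near U, span i.1 y.
  by apply: filterS (near_mem y) => i; exact: span_mem.
have near_bound x y : \forall i \near U, `| `|x + T i y| | <= `|x| + 2 * `|y|.
  apply: filterS (near_span y) => i iy.
  rewrite normr_id; apply: le_trans (ler_normD _ _) _; rewrite lerD2l.
  have := (TP i).2 _ iy.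
  have : i.2.+1%:R^-1 * `|y| <= 1 * `|y|.
    by rewrite ler_wpM2r // invf_le1 // ler1n.
  by rewrite ler_norml; move: (_^-1 * _) => p; lra.
have T0 i : T i 0 = 0.
  have := (TP i).1 1 0 0 (span0 _) (span0 _); rewrite scaler0 addr0 scale1r.
  by move/eqP; rewrite -subr_eq0 opprD addrA subrr sub0r oppr_eq0 => /eqP.
have TD i y y' : span i.1 y -> span i.1 y' -> T i (y + y') = T i y + T i y'.
  by move=> sy sy'; have := (TP i).1 1 y y' sy sy'; rewrite !scale1r.
have TZ i a y : span i.1 y -> T i (a *: y) = a *: T i y.
  by move=> sy; have := (TP i).1 a y 0 sy (span0 _); rewrite T0 !addr0.
pose N (p : X * E) := ulim U (fun i => `|p.1 + T i p.2|).
have ND p q : N (p + q) <= N p + N q.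
  apply: ulim_leD (near_bound _ _) (near_bound _ _) (near_bound _ _) _.
  apply: filterS2 (near_span p.2) (near_span q.2) => i sp sq.
  by rewrite TD // addrACA ler_normD.
have NZ a p : N (a *: p) = `|a| * N p.
  rewrite -(ulimZ _ (near_bound p.1 p.2)); apply: ulim_near_eq.
  apply: filterS (near_span p.2) => i sp.
  by rewrite TZ // -scalerDr normrZ.
exists (Seminorm ND NZ); split=> /=.
- move=> x; rewrite /N /= -[RHS](ulim_cst (U := U)); apply: ulim_near_eq.
  by near=> i; rewrite T0 addr0.
- move=> y; apply: ulim_eq_cvg; apply/cvgrPdist_le => e e0.
  have [n ny] : exists n, forall m, (n <= m)%N -> m.+1%:R^-1 * `|y| <= e.
    exists (Num.truncn (`|y| / e)) => m nm.
    rewrite ler_pdivrMl // -ler_pdivrMr //; apply/ltW.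
    apply: lt_le_trans (real_truncnS_gt (num_real _)) _.
    by rewrite ler_nat ltnS.
  have hn : \forall i \near U, (n <= i.2)%N.
    by apply: Uex; exists [::], n => s m _ nm.
  apply: filterS2 (near_span y) hn => i sy ni.
  rewrite add0r distrC; apply: le_trans ((TP i).2 _ sy) _.
  exact: ny.
move=> z k A e e0 Ak.
(* At a single index these are vectors of X, and combinations pass through [T i] as soon as [i.1]
   contains the E-components in use. *)
pose x i l := (z l).1 + T i (z l).2.
have near_comb w : \forall i \near U,
    `|comb (x i) w| = `|comb (fst \o z) w + T i (comb (snd \o z) w)|.
  have : U [set i : I | forall l, (l < size w)%N -> (z l).2 \in i.1].
    elim: (size w) => [|l IH]; first by apply: filterE => i m; rewrite ltn0.
    apply: filterS2 (near_mem (z l).2) IH => i h1 h2 m.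
    by rewrite ltnS leq_eqVlt => /orP[/eqP ->//|]; exact: h2.
  apply: filterS => i zi.
  suff [_ ->] : span i.1 (comb (snd \o z) w) /\
    comb (x i) w = comb (fst \o z) w + T i (comb (snd \o z) w) by [].
  rewrite /x; elim: w z zi {x} => [|a w IH] z zi.
    by rewrite !comb_nil T0 addr0; split=> //; exact: span0.
  have [|sw E1] := IH (z \o succn); first by move=> l lw; exact: (zi l.+1).
  have sz := span_mem (zi 0%N isT).
  rewrite !comb_cons; split; first exact: wspan_linear.
  rewrite -[comb ((fun l => _) \o _) w]/(comb (fun l => (z l.+1).1 + T i (z l.+1).2) w).
  by rewrite E1 (TP i).1 // scalerDr addrACA.
have : \forall i \near U, forall w, w \in A ->
    `| `|comb (x i) w| - N (comb (fst \o z) w, comb (snd \o z) w)| <= e.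
  elim: A {Ak} => [|w A IH]; first by near=> i.
  have hN := ulim_near (UU := UU) e0 (near_bound (comb (fst \o z) w) (comb (snd \o z) w)).
  apply: filterS3 (near_comb w) hN IH => i h1 h2 h3 v.
  rewrite inE => /orP[/eqP ->|]; last exact: h3.
  by rewrite h1.
by move=> /filter_ex[i ix]; exists (x i).
Unshelve. all: by end_near. Qed.

End amalgamation.

Section embedding.
Context {R : realType} (X : completeNormedModType R) (E : normedModType R).
Hypothesis E_complete :
  forall F : set_system E, ProperFilter F -> cauchy F -> cvg F.

Lemma isometric_copy_of_linear (f : E -> X) :
  (forall a x y, f (a *: x + y) = a *: f x + f y) -> (forall x, `|f x| = `|x|) ->
  contains_isometric_copy X E.
Proof.
move=> fl fn.
pose g : {linear E -> X} :=
  HB.pack f (GRing.isLinear.Build R E X *:%R f fl).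
have gi : linear_isometry g by [].
exists (range g); split; last by exists g.
- split; first by exists 0 => //; exact: linear0.
  move=> a _ _ [x _ <-] [y _ <-]; exists (a *: x + y) => //; exact: linearP.
- exact: isometry_range_closed.
Qed.

(** Representability of Y in X need only be tested on the dense image of X x E, where [amalgam]
    supplies the vectors. *)
Lemma finitely_determined_contains : separable_space X -> finitely_determined X ->
  separable_space E -> fin_representable E X -> contains_isometric_copy X E.
Proof.
move=> [D1 D1c D1d] Xd [D2 D2c D2d] EX.
have [N [NX NE Nfr]] := amalgam EX.
have [Y [j [jl jn jd]]] := completion_exists N.
have N_le x y : N (x, y) <= `|x| + `|y|.
  rewrite -NX -NE; have := seminormD N (x, 0) (0, y).
  by rewrite -[(x, 0) + (0, y)]/((x + 0, 0 + y)) addr0 add0r.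
have jB p q : `|j p - j q| = N (p - q).
  rewrite -jn; congr (`|_|); have := jl (-1) q p.
  by rewrite !scaleN1r addrC [X in _ = X -> _]addrC => ->.
have Ysep : separable_space Y.
  exists (j @` (D1 `*` D2)).
    by apply: sub_countable (card_image_le _ _) _; exact: countableX.
  apply/denseP => y e e0.
  have e3 : 0 < e / 3 by rewrite divr_gt0.
  have [[x z] yxz] := jd y _ e3.
  have [d1 D1d1 xd1] := (denseP D1).1 D1d x _ e3.
  have [d2 D2d2 zd2] := (denseP D2).1 D2d z _ e3.
  exists (j (d1, d2)); first by exists (d1, d2).
  have -> : y - j (d1, d2) = (y - j (x, z)) + (j (x, z) - j (d1, d2)).
    by rewrite addrA subrK.
  apply: le_lt_trans (ler_normD _ _) _; rewrite jB.
  have := N_le (x - d1) (z - d2).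
  rewrite -[(x, z) - (d1, d2)]/((x - d1, z - d2)).
  move: yxz xd1 zd2; move: (`|y - _|) (`|x - _|) (`|z - _|) (N _) => a b c d.
  lra.
have XY : fin_representable X Y.
  move=> F _ l l1; exists (fun x => j (x, 0)).
    move=> a x y _ _; rewrite -jl.
    by rewrite -[a *: (x, 0) + (y, 0)]/((a *: x + y, a *: 0 + 0)) scaler0 addr0.
  move=> x _; rewrite jn NX ler_peMl ?andbT ?(ltW l1) //.
  by rewrite ler_piMl // invf_le1 ?(ltW l1) // (lt_trans ltr01).
have YX : fin_representable Y X.
  apply: sequentially_fr_fin_representable => y k A e e0 Ak.
  have e2 : 0 < e / 2 by rewrite divr_gt0.
  have [d d0 dA] := small_dist A e2.
  have /choice[z zy] : forall i, exists p, `|y i - j p| <= d by move=> i; exact: jd.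
  have [x xP] := Nfr z k A _ e2 Ak.
  exists x => w wA.
  have j_comb (t : nat -> X * E) u :
      comb (j \o t) u = j (comb (fst \o t) u, comb (snd \o t) u).
    elim: u t => [|a u IH] t.
      rewrite !comb_nil; have := jl 1 0 0; rewrite !scale1r addr0.
      by move/eqP; rewrite -subr_eq0 opprD addrA subrr sub0r oppr_eq0 => /eqP <-.
    rewrite !comb_cons (IH (t \o succn)) -[RHS]/(j (_, _)).
    by rewrite /= -jl; congr j.
  have h1 := xP w wA; rewrite -jn -j_comb in h1.
  have h2 : `| `|comb (j \o z) w| - `|comb y w| | <= e / 2.
    apply: le_trans (ler_dist_dist _ _) _.
    apply: le_trans (comb_dist (d := d) _ _) (dA w wA).
    by move=> i; rewrite distrC.
  by move: h1 h2; rewrite !ler_norml; lra.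
have [S Si _] := Xd Y Ysep XY YX.
apply: (@isometric_copy_of_linear (fun y => S (j (0, y)))) => [a x y|y].
  rewrite -linearP -jl.
  by rewrite -[a *: (0, x) + (0, y)]/((a *: 0 + 0, a *: x + y)) scaler0 addr0.
by rewrite Si jn NE.
Qed.

End embedding.

(** * Sequence spaces *)

Section sequence_spaces.
Context {R : realType} (X : completeNormedModType R) (E : normedModType R).
Variables (K : seq R -> R) (Kn : word_norm K) (Km : word_monotone K).
Hypotheses (K1 : K [:: 1] = 1) (Kfr : word_fr X K).
(** These hypotheses cover c_0 and l_p at once: [c] gives the coordinates and the norm is the
    supremum of [K] over initial segments. Completeness rests on [c_closed], density of the finitely
    supported sequences on [c_tail]. *)
Variable c : E -> nat -> R.
Hypothesis c_linear : forall a u v k, c (a *: u + v) k = a * c u k + c v k.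
Hypothesis c_norm_ge : forall u n, K (mkseq (c u) n) <= `|u|.
Hypothesis c_norm_le : forall u M, (forall n, K (mkseq (c u) n) <= M) -> `|u| <= M.
Hypothesis c_closed : forall g : nat -> R,
  (forall e, 0 < e -> exists u, forall n, K (mkseq (fun k => c u k - g k) n) <= e) ->
  exists u, c u =1 g.
Hypothesis c_tail : forall u e, 0 < e -> exists n, forall m,
  K (mkseq (fun k => if (k < n)%N then 0 else c u k) m) <= e.
Variable unit : nat -> E.
Hypothesis c_unit : forall i k, c (unit i) k = (i == k)%:R.

Lemma coordB u v k : c (u - v) k = c u k - c v k.
Proof. by rewrite addrC -scaleN1r c_linear mulN1r addrC. Qed.

Lemma coord0 k : c 0 k = 0.
Proof. by rewrite -(subrr 0) coordB subrr. Qed.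

Lemma coord_le u k : `|c u k| <= `|u|.
Proof.
apply: le_trans (c_norm_ge u k.+1).
by rewrite /mkseq -addn1 iotaD map_cat; exact: (K_letter_le Kn Km K1).
Qed.

Lemma K_mkseqD g h n : K (mkseq (fun k => g k + h k) n) <=
  K (mkseq g n) + K (mkseq h n).
Proof. by rewrite /mkseq -wadd_map; apply: (wnD Kn); rewrite !size_map. Qed.

Lemma K_mkseq_le g n e : (forall k, (k < n)%N -> `|g k| <= e) ->
  K (mkseq g n) <= n%:R * e.
Proof.
move=> ge; apply: le_trans (wn_bound Kn _) _; rewrite K1 mulr1.
rewrite /mkseq big_map -[X in iota _ X]subn0 -/(index_iota 0 n) big_mkord.
apply: le_trans (ler_sum _ (fun (i : 'I_n) _ => ge i (ltn_ord i))) _.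
by rewrite sumr_const card_ord mulr_natl.
Qed.

(** The limit is taken coordinatewise. As [K] is continuous on words of a fixed length, the Cauchy
    estimate passes to the limit on each initial segment, and [c_closed] returns an element of E. *)
Lemma sequence_space_complete (F : set_system E) :
  ProperFilter F -> cauchy F -> cvg F.
Proof.
move=> FF /cauchyP Fc.
have coord_cvg k : cvg ((fun u : E => c u k) @ F).
  apply: cauchy_cvg; apply/cauchyP => e e0.
  have [u Fu] := Fc _ e0; exists (c u k).
  have : F [set v : E | ball (c u k) e (c v k)].
    apply: filterS Fu => v; rewrite -!ball_normE /= -coordB.
    exact/le_lt_trans/coord_le.
  exact.
pose g k : R := lim ((fun u : E => c u k) @ F).
have near_g n (e : R) : 0 < e ->
    F [set u : E | forall k, (k < n)%N -> `|c u k - g k| <= e].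
  move=> e0; elim: n => [|n IH]; first by apply: filterE => u k; rewrite ltn0.
  have /cvgrPdist_le/(_ _ e0) H := coord_cvg n.
  apply: filterS2 IH H => u h1 h2 k.
  by rewrite ltnS leq_eqVlt => /orP[/eqP ->|/h1//]; rewrite distrC.
have g_close (e : R) u : F (ball u e) ->
    forall n, K (mkseq (fun k => c u k - g k) n) <= e.
  move=> Fu n; apply/ler_addgt0Pr => d d0.
  have d1 : 0 < d / n.+1%:R by rewrite divr_gt0.
  have [v [uv vg]] := filter_ex (filterI Fu (near_g n _ d1)).
  have -> : mkseq (fun k => c u k - g k) n =
      mkseq (fun k => c (u - v) k + (c v k - g k)) n.
    by apply: eq_map => k; rewrite coordB addrA subrK.
  apply: le_trans (K_mkseqD _ _ _) _; apply: lerD.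
    apply: le_trans (c_norm_ge _ _) _.
    by move: uv; rewrite -ball_normE => /ltW.
  apply: le_trans (K_mkseq_le vg) _.
  by rewrite mulrCA ler_piMr ?(ltW d0) // ler_pdivrMr // mul1r ler_nat.
have [u0 u0g] : exists u, c u =1 g.
  apply: c_closed => e e0; have [u Fu] := Fc _ e0; exists u; exact: g_close.
apply/cvg_ex; exists u0; apply/cvg_ballP => e e0.
have e3 : 0 < e / 3 by rewrite divr_gt0.
have [u Fu] := Fc _ e3.
have uu0 : `|u - u0| <= e / 3.
  apply: c_norm_le => n; have := g_close _ _ Fu n; congr (K _ <= _).
  by apply: eq_map => k; rewrite coordB u0g.
apply: (filterS _ Fu) => z; rewrite -!ball_normE /= => uz.
have -> : u0 - z = (u - z) - (u - u0) by rewrite opprB [RHS]addrC addrA subrK.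
apply: le_lt_trans (ler_normB _ _) _.
by move: uz uu0; move: (`|u - z|) (`|u - u0|) => p q; lra.
Qed.

Lemma coord_comb w k : c (comb unit w) k = w`_k.
Proof.
suff H m : c (comb (fun i => unit (m + i)%N) w) (m + k)%N = w`_k.
  by rewrite -(H 0%N).
elim: w m k => [|a w IH] m k; first by rewrite comb_nil coord0 nth_nil.
rewrite comb_cons c_linear c_unit addn0.
have -> : (fun i => unit (m + i)%N) \o succn = (fun i => unit (m.+1 + i)%N).
  by apply/funext => i /=; rewrite addnS addSn.
case: k => [|k]; last first.
  have -> : (m == m + k.+1)%N = false by rewrite -{1}(addn0 m) eqn_add2l.
  by rewrite mulr0 add0r addnS -addSn IH.
rewrite addn0 eqxx mulr1.
suff -> : c (comb (fun i => unit (m.+1 + i)%N) w) m = 0 by rewrite addr0.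
have H j : (m < j)%N -> c (comb (fun i => unit (j + i)%N) w) m = 0.
  elim: {IH} w j => [|b w IH] j mj; first by rewrite comb_nil coord0.
  rewrite comb_cons c_linear c_unit addn0 gtn_eqF // mulr0 add0r.
  have -> : (fun i => unit (j + i)%N) \o succn = (fun i => unit (j.+1 + i)%N).
    by apply/funext => i /=; rewrite addnS addSn.
  by apply: IH; exact: ltnW.
exact: H.
Qed.

Lemma comb_unit_norm w : `|comb unit w| = K w.
Proof.
have E1 n : mkseq (c (comb unit w)) n = mkseq (fun k => w`_k) n.
  by apply: eq_map => k; exact: coord_comb.
have E2 n : K (mkseq (fun k => w`_k) (size w + n)) = K w.
  rewrite /mkseq iotaD map_cat -/(mkseq _ (size w)) mkseq_nth.
  have -> : [seq w`_k | k <- iota (0 + size w) n] = nseq n 0.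
    rewrite add0n; apply: (@eq_from_nth _ 0).
      by rewrite size_map size_iota size_nseq.
    move=> i; rewrite size_map size_iota => iN.
    rewrite (nth_map 0%N) ?size_iota // nth_iota // nth_nseq iN.
    by rewrite nth_default // leq_addr.
  by have := wn_nseq0 Kn w n [::]; rewrite !cats0.
apply/eqP; rewrite eq_le; apply/andP; split; last first.
  by rewrite -(E2 0%N) -E1; exact: c_norm_ge.
apply: c_norm_le => n; rewrite E1 -(E2 n) addnC /mkseq iotaD map_cat.
set p := map _ _; set q := map _ _.
have <- : K (p ++ nseq (size q) 0) = K p.
  by have := wn_nseq0 Kn p (size q) [::]; rewrite !cats0.
apply: Km; elim: p => [|a p IH] /=; last by rewrite lexx.
by elim: q => //= a q ->; rewrite normr0 normr_ge0.
Qed.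

Lemma comb_unit_dense u e : 0 < e -> exists w, `|u - comb unit w| <= e.
Proof.
move=> e0; have [n un] := c_tail u e0; exists (mkseq (c u) n).
apply: c_norm_le => m; have := un m; congr (K _ <= _).
apply: eq_map => k; rewrite coordB coord_comb; case: ltnP => kn.
  by rewrite nth_mkseq // subrr.
by rewrite nth_default ?size_mkseq // subr0.
Qed.

(** Each [y i] is replaced by a finite combination of unit vectors, padded by zeros to the common
    length [L]. A word [w] in these combinations becomes the word [mix w] in the unit vectors, to
    which the approximation of [K] in X applies. *)
Lemma sequence_space_fr : fin_representable E X.
Proof.
apply: sequentially_fr_fin_representable => y k A e e0 Ak.
have e2 : 0 < e / 2 by rewrite divr_gt0.
have [d d0 dA] := small_dist A e2.
have /choice[u uy] : forall i, exists w, `|y i - comb unit w| <= d.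
  by move=> i; exact: comb_unit_dense.
pose L := \max_(i < k) size (u i).
pose t i := u i ++ nseq (L - size (u i)) 0.
have comb_t (Z : normedModType R) (z : nat -> Z) i : comb z (t i) = comb z (u i).
  by rewrite /t comb_cat comb_zeros addr0.
have st i : (i < k)%N -> size (t i) = L.
  move=> ik; rewrite size_cat size_nseq subnKC //.
  exact: (leq_bigmax (Ordinal ik)).
pose mix w := foldr (fun i v => wadd (wscale (w`_i) (t i)) v) (nseq L 0) (iota 0 k).
have mixP w : size (mix w) = L /\ forall (Z : normedModType R) (z : nat -> Z),
    comb z (mix w) = \sum_(i <- iota 0 k) w`_i *: comb z (u i).
  rewrite /mix; have : all (fun i => (i < k)%N) (iota 0 k).
    by apply/allP => i; rewrite mem_iota.
  elim: (iota 0 k) => [|i s IH] /=.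
    by split=> [|Z z]; rewrite ?size_nseq // big_nil comb_zeros.
  move=> /andP[ik /IH[s1 s2]]; split.
    by rewrite size_wadd ?size_wscale ?st.
  move=> Z z; rewrite comb_wadd ?size_wscale ?st // comb_wscale s2 big_cons.
  by rewrite comb_t.
have comb_mix (Z : normedModType R) (z : nat -> Z) w : size w = k ->
    comb z (mix w) = comb (fun i => comb z (u i)) w.
  move=> wk; rewrite (mixP w).2 -[X in iota _ X]subn0 -/(index_iota 0 k) big_mkord.
  rewrite /comb -(big_mkord xpredT (fun i => w`_i *: \sum_(j < size (u i)) (u i)`_j *: z j)).
  rewrite -(big_mkord xpredT (fun i => w`_i *: \sum_(j < size (u i)) (u i)`_j *: z j)).
  by rewrite wk.
have [|x xP] := @Kfr L [seq mix w | w <- A] _ e2.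
  by move=> _ /mapP[w _ ->]; exact: (mixP w).1.
exists (fun i => comb x (u i)) => w wA; have wk := Ak w wA.
have h1 := xP _ (map_f _ wA).
rewrite comb_mix // -comb_unit_norm comb_mix // in h1.
have h2 : `| `|comb (fun i => comb unit (u i)) w| - `|comb y w| | <= e / 2.
  apply: le_trans (ler_dist_dist _ _) _.
  apply: le_trans (comb_dist (d := d) _ _) (dA w wA).
  by move=> i; rewrite distrC.
by move: h1 h2; rewrite !ler_norml; lra.
Qed.

Lemma sequence_space_contained : separable_space X -> finitely_determined X ->
  contains_isometric_copy X E.
Proof.
move=> Xs Xd; apply: finitely_determined_contains => //.
- exact: sequence_space_complete.
- apply: (@separable_comb _ _ unit) => u e e0.
  have [|w uw] := @comb_unit_dense u (e / 2); first by rewrite divr_gt0.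
  exists w; apply: le_lt_trans uw _.
  by rewrite ltr_pdivrMr // ltr_pMr // ltr1n.
- exact: sequence_space_fr.
Qed.

End sequence_spaces.

(** * The spaces c_0 and l_p *)

Section concrete_sequence_spaces.
Context {R : realType} (X : completeNormedModType R).
Variables (K : seq R -> R) (Kn : word_norm K) (Km : word_monotone K).
Hypotheses (K1 : K [:: 1] = 1) (Kfr : word_fr X K).
Hypotheses (X_separable : separable_space X) (X_determined : finitely_determined X).

Lemma word_max_mkseq_le (g : nat -> R) n M : 0 <= M ->
  (forall k, `|g k| <= M) -> word_max (mkseq g n) <= M.
Proof.
move=> M0 gM; apply: word_max_le => //.
by apply/allP => _ /mapP[k _ ->].
Qed.

Lemma word_max_mkseq_ge (g : nat -> R) k : `|g k| <= word_max (mkseq g k.+1).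
Proof.
apply: (allP (word_max_ub _)).
by apply: map_f; rewrite mem_iota /=.
Qed.

Lemma c0_contained : (forall w, K w = word_max w) -> contains_isometric_copy X (c0 R).
Proof.
move=> KE.
have c0P (u : c0 R) : (u : nat -> R) @ \oo --> (0 : R).
  by have /set_mem := valP u.
have c0_mem (g : nat -> R) : g @ \oo --> (0 : R) -> g \in (c0_pred : {pred nat -> R}).
  by move=> g0; rewrite inE.
pose d (i : nat) : nat -> R := fun k => (i == k)%:R.
have dP i : d i \in (c0_pred : {pred nat -> R}).
  apply: c0_mem; apply/cvgrPdist_le => e e0; near=> k.
  rewrite /d ltn_eqF; last by near: k; exact: nbhs_infty_gt.
  by rewrite subrr normr0 ltW.
apply: (@sequence_space_contained _ X (c0 R) K Kn Km K1 Kfr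
  (fun (u : c0 R) (k : nat) => u k) _ _ _ _ _ (fun i => C0 (dP i))) => //.
- move=> u n; rewrite KE; apply: word_max_mkseq_le => // k.
  exact: c0_norm_ub.
- move=> u M uM; apply: c0_norm_le => n.
  by apply: le_trans (uM n.+1); rewrite KE; exact: word_max_mkseq_ge.
- move=> g gP; have g0 : g @ \oo --> (0 : R).
    apply/cvgrPdist_le => e e0; have e2 : 0 < e / 2 by rewrite divr_gt0.
    have [u ug] := gP _ e2.
    have /cvgrPdist_le/(_ _ e2) := c0P u.
    apply: filterS => k; rewrite !sub0r !normrN => uk.
    have := ug k.+1; rewrite KE => /(le_trans (word_max_mkseq_ge _ k)) h.
    have -> : g k = u k - (u k - g k) by rewrite subKr.
    by apply: le_trans (ler_normB _ _) _; rewrite [e]splitr lerD.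
  by exists (C0 (c0_mem _ g0)).
- move=> u e e0; have /cvgrPdist_le/(_ _ e0)[n _ nu] := c0P u.
  exists n => m; rewrite KE; apply: word_max_mkseq_le; first exact: ltW.
  move=> k; case: ltnP => [_|/nu]; first by rewrite normr0 ltW.
  by rewrite /= sub0r normrN.
Unshelve. all: by end_near. Qed.

Section lp.
Variables (p : R) (p1 : 1 <= p).
Local Notation psum g n := (\sum_(k < n) `|g k| `^ p).

Let p0 : 0 < p. Proof. exact: lt_le_trans ltr01 p1. Qed.
Let ip0 : 0 < p^-1. Proof. by rewrite invr_gt0. Qed.

Lemma psum_ge0 (g : nat -> R) n : 0 <= psum g n.
Proof. by apply: sumr_ge0 => k _; exact: powR_ge0. Qed.

Lemma psum_series (g : nat -> R) l :
  ((\sum_(0 <= k <oo) (`|g k| `^ p)%:E)%E <= l%:E)%E <-> forall n, psum g n <= l.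
Proof.
have g0 k : (0 <= (`|g k| `^ p)%:E)%E by rewrite lee_fin powR_ge0.
have E n : (\sum_(0 <= k < n) (`|g k| `^ p)%:E)%E = (psum g n)%:E.
  by rewrite sumEFin big_mkord.
split=> [gl n|gl].
  rewrite -lee_fin -E; apply: le_trans gl.
  by apply: nneseries_lim_ge => k _.
apply: lime_le; first by apply: is_cvg_nneseries => k _.
by near=> n; rewrite E lee_fin.
Unshelve. all: by end_near. Qed.

Lemma ell_series (u : ell p1) :
  (\sum_(0 <= k <oo) (`|u k| `^ p)%:E)%E = (`|u| `^ p)%:E.
Proof.
have := ell_normE u.
have : (0 <= \sum_(0 <= k <oo) (`|u k| `^ p)%:E)%E.
  by apply: nneseries_ge0 => k _ _; rewrite lee_fin powR_ge0.
case: (X in (0 <= X)%E) => [l| |] //.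
  rewrite lee_fin poweR_EFin => l0 [->].
  by rewrite -powRrM mulVf ?gt_eqF // powRr1.
by rewrite poweRyr // gt_eqF.
Qed.

Lemma psum_norm (u : ell p1) l : 0 <= l ->
  `|u| <= l <-> forall n, psum u n <= l `^ p.
Proof.
move=> l0; rewrite -psum_series ell_series lee_fin; split=> h.
  by apply: ge0_ler_powR => //; rewrite ?nnegrE // ltW.
rewrite leNgt; apply/negP => /(@gt0_ltr_powR _ p p0 l `|u|).
by rewrite !nnegrE ltNge h => /(_ l0 (normr_ge0 _)).
Qed.

Lemma ell_of_psum (g : nat -> R) l : (forall n, psum g n <= l) ->
  exists u : ell p1, (u : nat -> R) = g.
Proof.
by move=> /psum_series gl; apply: ell_sub; apply: le_lt_trans gl _; rewrite ltry.
Qed.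

Lemma lp_contained : (forall w, K w = (\sum_(a <- w) `|a| `^ p) `^ p^-1) ->
  contains_isometric_copy X (ell p1).
Proof.
move=> KE.
have KEm g n : K (mkseq g n) = (psum g n) `^ p^-1.
  by rewrite KE /mkseq big_map -[X in iota _ X]subn0 -/(index_iota 0 n) big_mkord.
have K_le g n l : 0 <= l -> K (mkseq g n) <= l <-> psum g n <= l `^ p.
  move=> l0; rewrite KEm; split=> h.
    have : (psum g n `^ p^-1) `^ p <= l `^ p.
      by apply: ge0_ler_powR; rewrite ?nnegrE ?powR_ge0 // ltW.
    by rewrite -powRrM mulVf ?gt_eqF // powRr1 // psum_ge0.
  have -> : l = (l `^ p) `^ p^-1 by rewrite -powRrM mulfV ?gt_eqF // powRr1.
  apply: ge0_ler_powR; rewrite ?nnegrE ?powR_ge0 ?psum_ge0 //.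
  exact: ltW.
pose d (i : nat) : nat -> R := fun k => (i == k)%:R.
have /choice[unit unitE] : forall i, exists u : ell p1, (u : nat -> R) = d i.
  move=> i; apply: (@ell_of_psum _ 1) => n.
  apply: (@le_trans _ _ (\sum_(k < n | k == i :> nat) 1)).
    rewrite [leRHS]big_mkcond; apply: ler_sum => k _; rewrite /d eq_sym.
    by case: eqP => _; rewrite ?normr1 ?normr0 ?powR1 // powR0 // gt_eqF.
  rewrite sumr_const; rewrite -[leRHS]/(1%:R) ler_nat.
  rewrite (@leq_trans #|[pred k : 'I_n | k == i :> nat]|) //.
  apply/card_le1_eqP => k k'; rewrite !inE => /eqP ki /eqP k'i.
  by apply: val_inj; rewrite /= ki k'i.
apply: (@sequence_space_contained _ X (ell p1) K Kn Km K1 Kfr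
  (fun (u : ell p1) (k : nat) => u k) _ _ _ _ _ unit) => //.
- move=> u n; apply/K_le => //.
  exact: ((psum_norm u (normr_ge0 _)).1 (lexx _)).
- move=> u M uM.
  have M0 : 0 <= M := le_trans (wn_ge0 Kn _) (uM 0%N).
  by apply/psum_norm => // n; exact: ((K_le u n M M0).1 (uM n)).
(* The error 1 suffices: u - g has bounded sums of p-th powers, hence lies in l_p, and g is a
   difference of two elements. *)
- move=> g /(_ 1 ltr01)[u ug].
  have [|v vE] := @ell_of_psum (fun k => u k - g k) (1 `^ p).
    by move=> n; exact: ((K_le _ n 1 ler01).1 (ug n)).
  exists (u - v) => k; have -> : (u - v) k = u k - v k by [].
  by rewrite vE subKr.
- move=> u e e0.
  have ep : 0 < e `^ p by rewrite powR_gt0.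
  (* The first [n] coordinates carry all but e^p of the p-th power of the norm, which leaves at most
     e^p for the tail. *)
  have [n un] : exists n, `|u| `^ p - e `^ p <= psum u n.
    apply: contrapT => /forallNP H.
    have : ((\sum_(0 <= k <oo) (`|u k| `^ p)%:E)%E <= (`|u| `^ p - e `^ p)%:E)%E.
      by apply: (psum_series u _).2 => n; rewrite leNgt; apply/negP => /ltW; exact: H.
    by rewrite ell_series lee_fin lerBrDr gerDl leNgt ep.
  exists n => m; apply/K_le; first exact: ltW.
  have hs : psum u (n + m) <= `|u| `^ p.
    by apply: (psum_series u _).1; rewrite ell_series.
  pose t k : R := if (k < n)%N then 0 else u k.
  have h : psum u n + psum t m <= psum u (n + m).
    apply: (@le_trans _ _ (psum u n + psum t (n + m)%N)).
      rewrite lerD2l addnC big_split_ord /= lerDl.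
      by apply: sumr_ge0 => k _; exact: powR_ge0.
    rewrite !big_split_ord /= lerD2l.
    rewrite big1 => [|k _]; last by rewrite /t ltn_ord normr0 powR0 // gt_eqF.
    by rewrite add0r; apply: ler_sum => k _; rewrite /t ltnNge leq_addr.
  suff : psum t m <= e `^ p by [].
  by lra.
- by move=> i k; rewrite unitE.
Qed.

End lp.
End concrete_sequence_spaces.

Theorem corollary1p9 (R : realType) (X : completeNormedModType R)
    (X_infinite : infinite_dimensional X)
    (X_separable : separable_space X)
    (X_determined : finitely_determined X) :
  (contains_isometric_copy X (c0 R) \/
   exists (p : R) (p1 : 1 <= p), contains_isometric_copy X (ell p1)) /\
  (forall E : completeNormedModType R,
     has_basis E -> fin_representable E X -> contains_isometric_copy X E).
Proof.
split; last first.
  move=> E /has_basis_separable Es EX.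
  by apply: finitely_determined_contains => // F; exact: cauchy_cvg.
have [K [Kn Km K1 Kfr]] := c0_or_lp_word_fr X_infinite.
case=> [KE|[p p1 KE]]; first by left; exact: c0_contained KE.
by right; exists p, p1; exact: lp_contained KE.
Qed.
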